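(* Assume the setting and assumptions (i)–(iv) of the context. Let $C_0,c_0<\infty$ be constants such that for all $R>0$, all $N\ge 3$ and all $t\ge 0$, $$\mathbb E\Big[\sup_{0\le s\le t}\mathsf{KSD}_\pi(\mu^N_s,\mu_s)\,\mathbf 1_{\{\int\|x\|^2\mu^N_0(dx)\le R\}}\Big]\le C_0N^{-\beta/2}\exp\{c_0(1+R)\exp(c_0t)\}$$ (such constants exist under the assumptions). Then there exists a finite constant $C>0$ such that, for any $\delta>0$, any $R>0$ and all sufficiently large $N$, $$\sup_{T>0}\mathbb E\Big[\mathsf{KSD}_\pi(\overline\mu_T^N,\overline\mu_T)\,\mathbf 1_{\{\int\|x\|^2\mu_0^N(dx)\le R\}}\Big]\le C N^{-\beta/2}\exp\{c_0(1+R)(\log N)^{c_0\delta}\}+C(\delta\log\log N)^{-1/2}.$$ Consequently, $$\lim_{M\to\infty}\limsup_{N\to\infty}\sup_{T>0}\mathbb P\Big[\mathsf{KSD}_\pi(\overline\mu_T^N,\overline\mu_T)\ge M(\log\log N)^{-1/2}\Big]=0.$$ Moreover, suppose that $R_N:=\int_{\mathbb R^d}\|x\|^2\,\mu_0^N(dx)$ satisfies $\sup_{N\ge1}\mathbb E\exp\{\lambda R_N^2\}<\infty$ for some $\lambda>0$. Then there exists $C<\infty$ such that, for all sufficiently large $N$, $$\sup_{T>0}\mathbb E\,\mathsf{KSD}_\pi(\overline\mu_T^N,\overline\mu_T)\le C(\log\log N)^{-1/2}.$$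
   Context: **Setting.** $\pi(dx)\propto e^{-V(x)}dx$ is a probability measure on $\mathbb R^d$, $k:\mathbb R^d\times\mathbb R^d\to\mathbb R$ a positive-definite kernel, $\mathcal H^d$ the corresponding $\mathbb R^d$-valued reproducing kernel Hilbert space ($d$-fold product of the scalar RKHS of $k$). $\nabla_2,\Delta_2$ are the gradient and Laplacian in the second argument of $k$. **KSD.** $S_\pi(\rho):=\int\{-k(\cdot,x)\nabla V(x)+\nabla_2k(\cdot,x)\}\rho(dx)\in\mathcal H^d$ and the Langevin KSD with reference $\pi$ is $\mathsf{KSD}_\pi(\mu,\nu):=\sup_{\|\varphi\|_{\mathcal H^d}\le1}\{\int T_\pi\varphi\,d\mu-\int T_\pi\varphi\,d\nu\}=\|S_\pi(\mu)-S_\pi(\nu)\|_{\mathcal H^d}$, where $T_\pi\varphi:=-\nabla V\cdot\varphi+\nabla\cdot\varphi$. **SVGD flows.** For a probability measure $\rho$, $v_\rho(x):=\int[-k(x,y)\nabla V(y)+\nabla_2k(x,y)]\rho(dy)$. The $N$-particle system is $\dot x_i^N(t)=v_{\mu_t^N}(x_i^N(t))$, $1\le i\le N$, with $\mu_t^N:=\frac1N\sum_{i=1}^N\delta_{x_i^N(t)}$, started from a random initial configuration. The mean-field flow $(\mu_t)_{t\ge0}$ is the weak solution started from $\mu_0$ of $\partial_t\mu_t+\nabla\cdot(v_{\mu_t}\mu_t)=0$, i.e. $\frac{d}{dt}\int\varphi\,d\mu_t=\int\nabla\varphi\cdot v_{\mu_t}\,d\mu_t$ for all $\varphi\in C_c^1(\mathbb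 R^d)$. Both are globally well-posed under the assumptions below. Time averages: $\overline\mu_T^N:=\frac1T\int_0^T\mu_t^N\,dt$, $\overline\mu_T:=\frac1T\int_0^T\mu_t\,dt$, $T>0$. $\mathsf{KL}$ is relative entropy, $W_2$ the Wasserstein-2 distance. **Assumptions.** (i) $k$ is symmetric positive definite and $k\in C_b^4(\mathbb R^d\times\mathbb R^d)$ ($k$ and all its derivatives up to order 4 exist and are bounded). (ii) $V\in C^\infty(\mathbb R^d)$, $V\ge0$, $V(x)\to\infty$ as $\|x\|\to\infty$; there is $C_V>0$ with $\|\nabla V(x)\|^2\le C_V(1+V(x))$ and $\sup_{\theta\in[0,1]}\|\nabla^2V(\theta x+(1-\theta)y)\|^2\le C_V(1+V(x)+V(y))$ for all $x,y$; and for all $a,b>0$ there is $C_{a,b}$ such that $\|y\|\le a\|x\|+b$ implies $(1+\|x\|)(\|\nabla V(y)\|+\|\nabla^2V(y)\|)\le C_{a,b}(1+V(x))$. Also the score $-\nabla V$ is Lipschitz, has at least one zero, and has mean zero under $\pi$. (iii) The joint law $P_0^N$ of $(x_1^N(0),\dots,x_N^N(0))$ has a $C^2$ density; for some $\beta>0$, $C_{\rm init}<\infty$, $\mathbb E W_2(\mu_0^N,\mu_0)\le C_{\rm init}N^{-\beta}$ for all $N$, where $\mu_0\in\mathcal P_2(\mathbb R^d)$ is deterministic with a density, $\int\|x\|^2d\mu_0<\infty$ and $\mathsf{KL}(\mu_0\|\pi)<\infty$. Moreover $\sup_{N\ge1}\frac1N\mathsf{KL}(P_0^N\|\pi^{\otimes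 N})<\infty$. (iv) $\sup_{z}C^*(z)<\infty$, where $C^*(z):=\nabla_2k(z,z)\cdot\nabla V(z)+k(z,z)\Delta V(z)-\Delta_2k(z,z)$. Constants may depend on the dimension, target, kernel and initial law data, but not on $N$ or $T$ (nor on $R,\delta$). *)

(* Defs.v *)
From HB Require Import structures.
From mathcomp Require Import all_boot all_order all_algebra.
From mathcomp Require Import all_classical all_reals all_analysis.
Import Order.TTheory GRing.Theory Num.Theory numFieldNormedType.Exports.
Set Implicit Arguments.
Unset Strict Implicit.
Unset Printing Implicit Defensive.
Local Open Scope classical_set_scope.
Local Open Scope ring_scope.

Definition mx_display : measure_display -> measure_display.
Proof. exact. Qed.

(* Matrices carry the product sigma-algebra of their entries; over the reals
   this is the Borel sigma-algebra. *)
Section measurable_matrix.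
Context {d : measure_display} {T : measurableType d} (m n : nat).

Definition mx_entry (k : 'I_(m * n)) (A : 'M[T]_(m, n)) : T := mxvec A 0 k.

Let mx_set0 : g_sigma_preimage mx_entry set0.
Proof. exact: sigma_algebra0. Qed.

Let mx_setC A : g_sigma_preimage mx_entry A ->
  g_sigma_preimage mx_entry (~` A).
Proof. exact: sigma_algebraC. Qed.

Let mx_bigcup (F : _^nat) : (forall i, g_sigma_preimage mx_entry (F i)) ->
  g_sigma_preimage mx_entry (\bigcup_i (F i)).
Proof. exact: sigma_algebra_bigcup. Qed.

HB.instance Definition _ := @isMeasurable.Build (mx_display d)
  'M[T]_(m, n) (g_sigma_preimage mx_entry) mx_set0 mx_setC mx_bigcup.

End measurable_matrix.

Lemma measurable_fun_mxP (d d' : measure_display) (T : measurableType d)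
    (T' : measurableType d') (m n : nat) (f : T' -> 'M[T]_(m, n)) :
  measurable_fun [set: T'] f <->
  forall i j, measurable_fun [set: T'] (fun x => f x i j).
Proof.
apply: (@iff_trans _ (g_sigma_preimage (fun k => mx_entry k \o f)
    `<=` measurable)).
  rewrite g_sigma_preimage_comp; split=> [mf A [/= C preC <-]|prefS].
    exact: mf.
  by move=> _ A mA; apply: prefS; exists A.
split=> [fS i j|mf].
- move=> _ A mA; apply: fS; apply: sub_sigma_algebra => /=.
  rewrite -bigcup_seq/=; exists (mxvec_index i j) => /=.
    by rewrite mem_index_enum.
  exists A => //; rewrite !setTI; apply/seteqP.
  by split => x /=; rewrite /mx_entry mxvecE.
- apply: smallest_sub; first exact: sigma_algebra_measurable.
  rewrite -bigcup_seq/=; apply: bigcup_sub => k _ A [B mB <-].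
  case/mxvec_indexP: k => i j; have := mf i j measurableT B mB.
  congr (measurable (_ `&` _)); apply/seteqP.
  by split => x /=; rewrite /mx_entry mxvecE.
Qed.

Section pushforward_can.
Local Open Scope ereal_scope.
Context {d1 d2 : measure_display} {T1 : measurableType d1}
  {T2 : measurableType d2} {R : realType}.
Variables (mu : {sigma_finite_measure set T1 -> \bar R}).
Variables (f : T1 -> T2) (g : T2 -> T1).

(* The image measure along a map with a measurable left inverse; unlike for a
   general [pushforward], sigma-finiteness is preserved. *)
Definition pushforward_can of measurable_fun [set: T1] f
    & measurable_fun [set: T2] g & cancel f g : set T2 -> \bar R :=
  pushforward mu f.

Hypotheses (mf : measurable_fun [set: T1] f) (mg : measurable_fun [set: T2] g)
  (fK : cancel f g).

Let nu := pushforward_can mf mg fK.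

Let pm0 : nu set0 = 0.
Proof. by rewrite /nu /pushforward_can /pushforward preimage_set0 measure0. Qed.

Let pm_ge0 A : 0 <= nu A.
Proof. exact: measure_ge0. Qed.

Let pm_sigma_additive : semi_sigma_additive nu.
Proof.
pose pf : {measure set T2 -> \bar R} :=
  measure_function_pushforward__canonical__measure_function_Measure mu mf.
exact: (@measure_semi_sigma_additive _ _ _ pf).
Qed.

HB.instance Definition _ := isMeasure.Build _ _ _ nu
  pm0 pm_ge0 pm_sigma_additive.

Let pm_sigma_finite : sigma_finite [set: T2] nu.
Proof.
have [F TF Foo] := sigma_finiteT mu.
exists (fun k => g @^-1` F k).
  by rewrite -preimage_bigcup -TF preimage_setT.
move=> k; have [mFk Fkoo] := Foo k; split.
  by rewrite -[X in measurable X]setTI; exact: mg.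
rewrite /nu /pushforward_can /pushforward -comp_preimage.
by rewrite (_ : g \o f = id) //; apply/funext => x /=; rewrite fK.
Qed.

HB.instance Definition _ := Measure_isSigmaFinite.Build _ _ _ nu
  pm_sigma_finite.

End pushforward_can.

(* The library declares [m1 \x m2] sigma-finite, but this instance is shadowed
   by the one for products of subprobabilities; the alias restores it. *)
Section sigma_finite_product.
Local Open Scope ereal_scope.
Context {d1 d2 : measure_display} {T1 : measurableType d1}
  {T2 : measurableType d2} {R : realType}.
Variables (m1 : {sigma_finite_measure set T1 -> \bar R})
  (m2 : {sigma_finite_measure set T2 -> \bar R}).

Definition sigma_finite_product : set (T1 * T2) -> \bar R := m1 \x m2.

HB.instance Definition _ := Measure.copy sigma_finite_product (m1 \x m2).

Let sigma_finite_product_sigma_finite :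
  sigma_finite [set: T1 * T2] sigma_finite_product.
Proof.
have /sigma_finiteP[F [TF ndF Foo]] := sigma_finiteT m1.
have /sigma_finiteP[G [TG ndG Goo]] := sigma_finiteT m2.
exists (fun n => F n `*` G n).
  rewrite -setXTT TF TG predeqE => -[x y]; split.
    move=> [/= [n _ Fnx] [k _ Gky]]; exists (maxn n k) => //; split.
    - by move: x Fnx; exact/subsetPset/ndF/leq_maxl.
    - by move: y Gky; exact/subsetPset/ndG/leq_maxr.
  by move=> [n _ []/= ? ?]; split; exists n.
move=> k; have [? ?] := Foo k; have [? ?] := Goo k.
split; first exact: measurableX.
by rewrite /sigma_finite_product product_measure1E// lte_mul_pinfty// ge0_fin_numE.
Qed.

HB.instance Definition _ := Measure_isSigmaFinite.Build _ _ _
  sigma_finite_product sigma_finite_product_sigma_finite.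

End sigma_finite_product.

(* The product measure of [n] copies of [mu]. *)
Section tuple_measure.
Context {d : measure_display} {T : measurableType d} {R : realType}.
Variable mu : {sigma_finite_measure set T -> \bar R}.

Definition tuple_cons n (p : T * n.-tuple T) : n.+1.-tuple T :=
  [the n.+1.-tuple T of p.1 :: p.2].

Definition tuple_uncons n (t : n.+1.-tuple T) : T * n.-tuple T :=
  (thead t, [tuple of behead t]).

Lemma measurable_tuple_cons n : measurable_fun setT (@tuple_cons n).
Proof. exact: measurable_cons. Qed.

Lemma measurable_tuple_uncons n : measurable_fun setT (@tuple_uncons n).
Proof.
apply/measurable_fun_pairP; split; last exact: measurable_behead.
exact: measurable_tnth.
Qed.

Lemma tuple_consK n : cancel (@tuple_cons n) (@tuple_uncons n).
Proof. by case=> x t; congr pair; exact: val_inj. Qed.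

Definition tuple_measure_step n
    (nu : {sigma_finite_measure set (n.-tuple T) -> \bar R}) :
    {sigma_finite_measure set (n.+1.-tuple T) -> \bar R} :=
  pushforward_can
    (sigma_finite_product mu nu)
    (@measurable_tuple_cons n) (@measurable_tuple_uncons n) (@tuple_consK n).

Fixpoint tuple_measure n : {sigma_finite_measure set (n.-tuple T) -> \bar R} :=
  match n with
  | 0 => \d_([tuple] : 0.-tuple T)
  | n'.+1 => tuple_measure_step (tuple_measure n')
  end.

End tuple_measure.

Section lebesgue_mx.
Context {R : realType} {m n : nat}.

Definition mx_of_tuple (t : (m * n).-tuple (measurableTypeR R)) : 'M[R]_(m, n) :=
  \matrix_(i, j) tnth t (mxvec_index i j).

Definition tuple_of_mx (A : 'M[R]_(m, n)) : (m * n).-tuple (measurableTypeR R) :=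
  [tuple mxvec A 0 k | k < m * n].

Lemma measurable_mx_of_tuple : measurable_fun setT mx_of_tuple.
Proof.
apply/measurable_fun_mxP => i j.
rewrite (_ : (fun _ => _) = @tnth _ (measurableTypeR R) ^~ (mxvec_index i j)).
  exact: (@measurable_tnth _ (measurableTypeR R) (m * n) (mxvec_index i j)).
by apply/funext => t; rewrite mxE.
Qed.

Lemma measurable_tuple_of_mx : measurable_fun setT tuple_of_mx.
Proof.
apply/measurable_fun_tnthP => k; case/mxvec_indexP: k => i j.
have := (measurable_fun_mxP (@id 'M[R]_(m, n))).1 (@measurable_id _ _ _) i j.
rewrite (_ : (fun _ => _) =
  (@tnth _ (measurableTypeR R) ^~ (mxvec_index i j) \o tuple_of_mx)) //.
by apply/funext => A /=; rewrite tnth_mktuple mxvecE.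
Qed.

Lemma mx_of_tupleK : cancel mx_of_tuple tuple_of_mx.
Proof.
move=> t; apply: eq_from_tnth => k; rewrite tnth_mktuple.
by case/mxvec_indexP: k => i j; rewrite mxvecE mxE.
Qed.

(* Lebesgue measure on the matrix space. *)
Definition lebesgue_mx : {sigma_finite_measure set 'M[R]_(m, n) -> \bar R} :=
  pushforward_can (tuple_measure (@lebesgue_measure R) (m * n))
    measurable_mx_of_tuple measurable_tuple_of_mx mx_of_tupleK.

End lebesgue_mx.

Section row_product.
Context {R : realType} {d : nat} (N : nat).

Definition mx_of_rows (t : N.-tuple 'rV[R]_d) : 'M[R]_(N, d) :=
  \matrix_(i, j) tnth t i 0 j.

Definition rows_of_mx (A : 'M[R]_(N, d)) : N.-tuple 'rV[R]_d :=
  [tuple row i A | i < N].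

Lemma measurable_mx_of_rows : measurable_fun setT mx_of_rows.
Proof.
apply/measurable_fun_mxP => i j.
rewrite (_ : (fun _ => _) = fun t => (tnth t i : 'rV[R]_d) 0 j).
  exact: (measurable_fun_mxP (@tnth N 'rV[R]_d ^~ i)).1 (measurable_tnth i) 0 j.
by apply/funext => t; rewrite mxE.
Qed.

Lemma measurable_rows_of_mx : measurable_fun setT rows_of_mx.
Proof.
apply/measurable_fun_tnthP => i; apply/measurable_fun_mxP => i0 j.
have := (measurable_fun_mxP (@id 'M[R]_(N, d))).1 (@measurable_id _ _ _) i j.
congr (measurable_fun _ _); apply/funext => A /=.
by rewrite tnth_mktuple mxE.
Qed.

Lemma mx_of_rowsK : cancel mx_of_rows rows_of_mx.
Proof.
move=> t; apply: eq_from_tnth => i; rewrite tnth_mktuple.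
by apply/rowP => j; rewrite !mxE.
Qed.

(* The product measure of [N] copies of [mu], where a configuration of [N]
   points of R^d is encoded by the matrix whose rows are the points. *)
Definition row_product (mu : {sigma_finite_measure set 'rV[R]_d -> \bar R}) :
    {sigma_finite_measure set 'M[R]_(N, d) -> \bar R} :=
  pushforward_can (tuple_measure mu N)
    measurable_mx_of_rows measurable_rows_of_mx mx_of_rowsK.

End row_product.

Section empirical_measure.
Local Open Scope ereal_scope.
Context {R : realType} {N d : nat}.
Implicit Type X : 'M[R]_(N, d).

Definition empirical X (A : set 'rV[R]_d) : \bar R :=
  (N%:R^-1)%:E * \sum_(i < N) \d_(row i X) A.

Let empirical0 X : empirical X set0 = 0.
Proof. by rewrite /empirical big1 ?mule0// => i _; rewrite measure0. Qed.

Let empirical_ge0 X A : 0 <= empirical X A.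
Proof. by rewrite mule_ge0 ?lee_fin ?invr_ge0//; apply: sume_ge0. Qed.

Let empirical_sigma_additive X : semi_sigma_additive (empirical X).
Proof.
move=> F mF tF mUF.
rewrite /empirical (_ : (fun n => _) = fun n => (N%:R^-1)%:E *
    \sum_(i < N) \sum_(0 <= k < n) \d_(row i X) (F k)); last first.
  apply/funext => n; rewrite exchange_big/= ge0_sume_distrr//.
  by move=> k _; exact: sume_ge0.
apply: cvgeZl => //; apply: cvg_nnesum => [i _|i _]; last first.
  exact: measure_semi_sigma_additive.
by apply: nearW => n; exact: sume_ge0.
Qed.

HB.instance Definition _ X := isMeasure.Build _ _ _ (empirical X)
  (@empirical0 X) (@empirical_ge0 X) (@empirical_sigma_additive X).

End empirical_measure.

Section calculus.
Context {R : realType}.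

Fixpoint Cn (V : normedModType R) (n : nat) (f : V -> R) : Prop :=
  if n is n'.+1 then
    (forall x, differentiable f x) /\ (forall v, Cn n' ('D_v f))
  else continuous f.

Definition bounded_on_space (V : normedModType R) (f : V -> R) : Prop :=
  exists M : R, forall x, `|f x| <= M.

(* [f] is of class C^n and all its derivatives of order at most [n] are
   bounded; the bound may depend on the directions of differentiation, which
   in finite dimension is the same as bounding each partial derivative. *)
Fixpoint Cnb (V : normedModType R) (n : nat) (f : V -> R) : Prop :=
  bounded_on_space f /\
  if n is n'.+1 then
    (forall x, differentiable f x) /\ (forall v, Cnb n' ('D_v f))
  else continuous f.

(* Euclidean (Frobenius) norm; the library norm on matrices is the sup norm. *)
Definition enorm m n (A : 'M[R]_(m, n)) : R :=
  Num.sqrt (\sum_i \sum_j A i j ^+ 2).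

Context {d : nat}.
Local Notation E := 'rV[R]_d.
Implicit Type f : E -> R.

Definition dot (u v : E) : R := \sum_j u 0 j * v 0 j.

Definition partial (j : 'I_d) f : E -> R := 'D_(delta_mx 0 j : E) f.

Definition grad f (x : E) : E := \row_j partial j f x.

Definition hess f (x : E) : 'M[R]_d :=
  \matrix_(i, j) partial i (partial j f) x.

Definition laplacian f (x : E) : R := \sum_j partial j (partial j f) x.

Definition component (phi : E -> E) (j : 'I_d) : E -> R := fun x => phi x 0 j.

Definition divergence (phi : E -> E) (x : E) : R :=
  \sum_j partial j (component phi j) x.

Definition test_function f : Prop :=
  Cn 1 f /\ compact (closure [set x | f x != 0]).

End calculus.

Section probability_notions.
Context {R : realType}.
Local Open Scope ereal_scope.

Definition KL {dT : measure_display} {T : measurableType dT}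
    (mu : {finite_measure set T -> \bar R})
    (nu : {sigma_finite_measure set T -> \bar R}) : \bar R :=
  if `[< mu `<< nu >] then
    \int[mu]_x lne (Radon_Nikodym (charge_of_finite_measure mu) nu x)
  else +oo.

Definition has_density m n (mu : set 'M[R]_(m, n) -> \bar R)
    (p : 'M[R]_(m, n) -> R) : Prop :=
  forall A, measurable A -> mu A = \int[lebesgue_mx]_(x in A) (p x)%:E.

Context {d : nat}.
Local Notation E := 'rV[R]_d.

Definition second_moment (mu : set E -> \bar R) : \bar R :=
  \int[mu]_x (enorm x ^+ 2)%:E.

Definition moment_event {Om : Type} N (x0 : Om -> 'M[R]_(N, d)) (r : R) :
    set Om :=
  [set w | second_moment (empirical (x0 w)) <= r%:E].

Definition coupling (mu nu : set E -> \bar R)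
    (gamma : probability (E * E)%type R) : Prop :=
  forall A, measurable A ->
    gamma (A `*` setT) = mu A /\ gamma (setT `*` A) = nu A.

Definition W2 (mu nu : set E -> \bar R) : \bar R :=
  sqrte (ereal_inf [set \int[gamma]_z (enorm (z.1 - z.2) ^+ 2)%:E
                   | gamma in coupling mu nu]).

Definition time_average (mu : R -> set E -> \bar R) (T : R)
    (A : set E) : \bar R :=
  (T^-1)%:E * \int[lebesgue_measure]_(t in `[0%R, T]) mu t A.

End probability_notions.

Section stein.
Context {R : realType} {d : nat}.
Local Notation E := 'rV[R]_d.
Implicit Types (V : E -> R) (k : E -> E -> R).

Definition positive_definite_kernel k : Prop :=
  forall (n : nat) (x : 'I_n -> E) (c : 'I_n -> R),
    0 <= \sum_i \sum_j c i * c j * k (x i) (x j).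

(* [H] with inner product [ip] is the reproducing kernel Hilbert space of [k];
   values of [ip] outside of [H] are irrelevant. *)
Record is_rkhs k (H : set (E -> R)) (ip : (E -> R) -> (E -> R) -> R) : Prop := {
  rkhs_lin : forall (a : R) f g, H f -> H g -> H (fun x => a * f x + g x) ;
  rkhs_ipC : forall f g, H f -> H g -> ip f g = ip g f ;
  rkhs_ip_lin : forall (a : R) f g h, H f -> H g -> H h ->
    ip (fun x => a * f x + g x) h = a * ip f h + ip g h ;
  rkhs_ip_ge0 : forall f, H f -> 0 <= ip f f ;
  rkhs_ip_eq0 : forall f, H f -> ip f f = 0 -> forall x, f x = 0 ;
  rkhs_complete : forall u : nat -> E -> R, (forall n, H (u n)) ->
    (forall e, 0 < e -> exists n0, forall m n, (n0 <= m)%N -> (n0 <= n)%N ->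
      ip (u m \- u n) (u m \- u n) < e) ->
    exists2 f, H f & ip (u n \- f) (u n \- f) @[n --> \oo] --> (0 : R) ;
  rkhs_kernel : forall x, H (fun y => k y x) ;
  rkhs_reproducing : forall f x, H f -> ip f (fun y => k y x) = f x
}.

(* The unit ball of the d-fold product H^d. *)
Definition product_ball (H : set (E -> R)) (ip : (E -> R) -> (E -> R) -> R) :
    set (E -> E) :=
  [set phi | (forall j, H (component phi j)) /\
             \sum_j ip (component phi j) (component phi j) <= 1].

Definition stein V (phi : E -> E) (x : E) : R :=
  - dot (grad V x) (phi x) + divergence phi x.

Definition KSD V H ip (mu nu : set E -> \bar R) : \bar R :=
  ereal_sup [set (\int[mu]_x (stein V phi x)%:E -
                  \int[nu]_x (stein V phi x)%:E)%E
            | phi in product_ball H ip].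

Definition svgd_velocity V k (rho : {measure set E -> \bar R}) (x : E) : E :=
  \row_j \int[rho]_y (- k x y * grad V y 0 j + grad (k x) y 0 j).

Definition particle_flow V k N (X : R -> 'M[R]_(N, d)) (x0 : 'M[R]_(N, d)) :
    Prop :=
  [/\ X 0 = x0,
      {within [set t | 0 <= t], continuous X} &
      forall (t : R) (i : 'I_N), 0 < t ->
        is_derive t (1 : R) (fun s => row i (X s))
          (svgd_velocity V k (empirical (X t)) (row i (X t)))].

(* The local bound on the second moment fixes the class of curves in which weak
   solutions are considered; in particular the velocity is well-defined. *)
Definition mean_field_flow V k (mu : R -> probability E R)
    (mu0 : probability E R) : Prop :=
  [/\ mu 0 = mu0 :> (set E -> \bar R),
      forall T : R, exists M : R, forall t, 0 <= t <= T ->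
        (second_moment (mu t) <= M%:E)%E,
      forall phi : E -> R, test_function phi ->
        {within [set t | 0 <= t],
          continuous (fun t => \int[mu t]_x phi x : R)} &
      forall (phi : E -> R) (t : R), test_function phi -> 0 < t ->
        is_derive t (1 : R) (fun s => \int[mu s]_x phi x : R)
          (\int[mu t]_x dot (grad phi x) (svgd_velocity V k (mu t) x))].

Record kernel_assumption k : Prop := {
  kernel_sym : forall x y, k x y = k y x ;
  kernel_pd : positive_definite_kernel k ;
  kernel_Cb4 : Cnb 4 (fun z : E * E => k z.1 z.2)
}.

Record target_assumption V (pi : probability E R) : Prop := {
  target_density : exists2 Z : R, 0 < Z &
    has_density pi (fun x => Z^-1 * expR (- V x)) ;
  target_smooth : forall n, Cn n V ;
  target_ge0 : forall x, 0 <= V x ;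
  target_coercive : forall A : R, exists r : R, forall x,
    r <= enorm x -> A <= V x ;
  target_growth : exists2 CV : R, 0 < CV &
    (forall x, enorm (grad V x) ^+ 2 <= CV * (1 + V x)) /\
    (forall x y (theta : R), 0 <= theta <= 1 ->
      enorm (hess V (theta *: x + (1 - theta) *: y)) ^+ 2
        <= CV * (1 + V x + V y)) ;
  target_dilation : forall a b : R, 0 < a -> 0 < b -> exists Cab : R,
    forall x y, enorm y <= a * enorm x + b ->
      (1 + enorm x) * (enorm (grad V y) + enorm (hess V y))
        <= Cab * (1 + V x) ;
  score_lipschitz : exists L : R, forall x y,
    enorm (grad V x - grad V y) <= L * enorm (x - y) ;
  score_zero : exists x, grad V x = 0 ;
  score_centered : forall j,
    pi.-integrable setT (fun x => (grad V x 0 j)%:E) /\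
    \int[pi]_x grad V x 0 j = 0
}.

Record initial_assumption {dO : measure_display} {Om : measurableType dO}
    (P : probability Om R) (pi mu0 : probability E R)
    (x0 : forall N, {RV P >-> 'M[R]_(N, d)}) (beta : R) : Prop := {
  init_C2_density : forall N, (0 < N)%N -> exists p : 'M[R]_(N, d) -> R,
    [/\ Cn 2 p, forall x, 0 <= p x & has_density (distribution P (x0 N)) p] ;
  init_rate_gt0 : 0 < beta ;
  init_W2 : exists Cinit : R, forall N, (0 < N)%N ->
    (\int[P]_w W2 (empirical (x0 N w)) mu0 <= (Cinit * N%:R `^ (- beta))%:E)%E ;
  init_limit_density : exists p : E -> R,
    [/\ measurable_fun setT p, forall x, 0 <= p x & has_density mu0 p] ;
  init_limit_moment : (second_moment mu0 < +oo)%E ;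
  init_limit_KL : (KL mu0 pi < +oo)%E ;
  init_KL : (ereal_sup [set ((N%:R^-1)%:E *
      KL (distribution P (x0 N)) (row_product N pi))%E | N in [set N | (0 < N)%N]]
    < +oo)%E
}.

Definition Cstar V k (z : E) : R :=
  dot (grad (k z) z) (grad V z) + k z z * laplacian V z - laplacian (k z) z.

End stein.

(* Main.v *)
(* Along the particle flow, relative entropy with respect to the N-fold product
   of pi decreases at rate N KSD^2 up to the bounded self-interaction term Cstar,
   so the expected time average of KSD(mu^N_t, pi)^2 over [0, T] is at most a
   constant times 1/T + 1/N.  This is obtained without smoothness of the flow
   map: the flow is replaced by an Euler scheme that moves one coordinate at a
   time, for which the change of variables is one-dimensional, and entropy enters
   through its variational formula.  The Langevin Stein operator then bounds the
   KSD between the time averages by the two KSDs to pi.  The bound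
   KSD(mubar_T, pi) <= C T^(-1/2) for the mean-field flow is inherited from the
   particles by letting N go to infinity at fixed T.  Averaging up to
   T = delta log log N is handled by the finite-time estimate, and larger T by
   the entropy estimate. *)

Require Import Defs.
From HB Require Import structures.
From mathcomp Require Import all_boot all_order all_algebra.
From mathcomp Require Import all_classical all_reals all_analysis.
From mathcomp Require Import measurable_realfun ring lra.
Import Order.TTheory GRing.Theory Num.Theory numFieldNormedType.Exports.
Set Implicit Arguments.
Unset Strict Implicit.
Unset Printing Implicit Defensive.
Local Open Scope classical_set_scope.
Local Open Scope ring_scope.

(** * Integrals over product measures *)

(** The entropy of the law at time T is never formed. The variational formula is tested at time 0
    only, against [action]: along a flow, the exponential of [action] is the density of the pullback
    of [row_product N pi], so its integral is at most 1 and the mean of [action] under the initial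
    law is at most the initial entropy. Since [action] dominates N times the time integral of the
    squared KSD up to [Cstar] terms, this is the entropy estimate. For a composition of shears the
    bound by 1 is an inequality between one-dimensional integrals over balls, which survives the
    limit of vanishing mesh. The squared KSD to pi is represented by [stein_mean], a double average
    of the Stein kernel. Test functions in the unit ball are controlled at finitely many points by
    Cauchy-Schwarz in H, so no H-valued integral is formed. Young's inequality with a free parameter
    e keeps every bound linear in [stein_mean], so that time averages and expectations come first
    and e is chosen last. *)

Section tuple_measure_domination.
Local Open Scope ereal_scope.
Context {d : measure_display} {T : measurableType d} {R : realType}.
Variable mu : {sigma_finite_measure set T -> \bar R}.

Definition tset n (t : n.-tuple T) (i : 'I_n) (s : T) : n.-tuple T :=
  [tuple if k == i then s else tnth t k | k < n].

Lemma ge0_integral_tuple_measureS n (f : n.+1.-tuple T -> \bar R) :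
  measurable_fun setT f -> (forall t, 0 <= f t) ->
  \int[tuple_measure mu n.+1]_t f t =
  \int[sigma_finite_product mu (tuple_measure mu n)]_p f (tuple_cons p).
Proof.
move=> mf f0.
exact: (ge0_integral_pushforward (@measurable_tuple_cons d T n)).
Qed.

Lemma tset_cons0 n x (t : n.-tuple T) s :
  tset (tuple_cons (x, t)) ord0 s = tuple_cons (s, t).
Proof.
apply: eq_from_tnth => k; rewrite tnth_mktuple.
case: (unliftP ord0 k) => [j ->|->]; last by rewrite eqxx.
by rewrite eq_sym (negbTE (neq_lift _ _)) !tnthS.
Qed.

Lemma tset_consS n x (t : n.-tuple T) i s :
  tset (tuple_cons (x, t)) (lift ord0 i) s = tuple_cons (x, tset t i s).
Proof.
apply: eq_from_tnth => k; rewrite tnth_mktuple.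
case: (unliftP ord0 k) => [j ->|->]; last by rewrite (negbTE (neq_lift _ _)).
by rewrite (inj_eq lift_inj) !tnthS tnth_mktuple.
Qed.

(** By Tonelli, a comparison over the product reduces to one over a single coordinate with the
    others frozen. A shear moves a single entry, so its change of variables becomes one-dimensional.
    For coordinate 0 the head is the inner variable; otherwise the inner integral runs over the tail
    and induction applies. *)
Lemma le_integral_tuple_measure n (i : 'I_n) (f g : n.-tuple T -> \bar R) :
  measurable_fun setT f -> measurable_fun setT g ->
  (forall t, 0 <= f t) -> (forall t, 0 <= g t) ->
  (forall t, \int[mu]_s f (tset t i s) <= \int[mu]_s g (tset t i s)) ->
  \int[tuple_measure mu n]_t f t <= \int[tuple_measure mu n]_t g t.
Proof.
elim: n i f g => [[]//|n IH] i f g mf mg f0 g0 fg.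
rewrite !ge0_integral_tuple_measureS//.
have mc (h : n.+1.-tuple T -> \bar R) : measurable_fun setT h ->
    measurable_fun setT (fun p : T * n.-tuple T => h (tuple_cons p)).
  by move=> mh; apply: (measurableT_comp mh); exact: measurable_tuple_cons.
case: (unliftP ord0 i) => [j|] ij; subst i.
- rewrite !fubini_tonelli1//; [|exact: mc mg|exact: mc mf].
  apply: ge0_le_integral => //.
  + by move=> x _; apply: integral_ge0.
  + exact: (measurable_fun_fubini_tonelli_F _ (mc _ mf)).
  + exact: (measurable_fun_fubini_tonelli_F _ (mc _ mg)).
  + move=> x _; apply: (IH j) => // [| |t].
    * exact: measurable_fun_pair2 (mc _ mf).
    * exact: measurable_fun_pair2 (mc _ mg).
    * by have := fg (tuple_cons (x, t)); under eq_integral do rewrite tset_consS;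
        under [leRHS]eq_integral do rewrite tset_consS.
- rewrite !fubini_tonelli2//; [|exact: mc mg|exact: mc mf].
  apply: ge0_le_integral => //.
  + by move=> x _; apply: integral_ge0.
  + exact: (measurable_fun_fubini_tonelli_G _ (mc _ mf)).
  + exact: (measurable_fun_fubini_tonelli_G _ (mc _ mg)).
  + move=> t _.
    (* [fg] speaks of full tuples, so some head [x] is needed to use it; without one, both integrals
       run over an empty type. *)
    have [[x]|noT] := pselect (inhabited T); last first.
      by rewrite le_eqVlt; apply/predU1P; left; apply: eq_integral => x _;
        case: noT.
    by have := fg (tuple_cons (x, t)); under eq_integral do rewrite tset_cons0;
        under [leRHS]eq_integral do rewrite tset_cons0.
Qed.

End tuple_measure_domination.

Ltac nneg := repeat first [done | exact: expR_ge0 | exact: sqr_ge0 |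
  apply: mulr_ge0 | apply: addr_ge0].

Section real_continuity.
Context {R : realType} {T : topologicalType}.
Implicit Types f g : T -> R.

Lemma contC (c : R) : continuous (fun _ : T => c).
Proof. by move=> x; exact: cvg_cst. Qed.

Lemma contD f g : continuous f -> continuous g -> continuous (fun x => f x + g x).
Proof. by move=> cf cg x; apply: continuousD; [exact: cf|exact: cg]. Qed.

Lemma contN f : continuous f -> continuous (fun x => - f x).
Proof. by move=> cf x; apply: continuousN; exact: cf. Qed.

Lemma contB f g : continuous f -> continuous g -> continuous (fun x => f x - g x).
Proof. by move=> cf cg; apply: contD => //; exact: contN. Qed.

Lemma contM f g : continuous f -> continuous g -> continuous (fun x => f x * g x).
Proof. by move=> cf cg x; apply: continuousM; [exact: cf|exact: cg]. Qed.

Lemma cont_sum (I : Type) (r : seq I) (P : pred I) (F : I -> T -> R) :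
  (forall i, continuous (F i)) -> continuous (fun x => \sum_(i <- r | P i) F i x).
Proof.
move=> cF; elim: r => [|i r IH].
  by under eq_fun do rewrite big_nil; exact: contC.
under eq_fun do rewrite big_cons; case: (P i) => //.
exact: contD.
Qed.

Lemma cont_comp (S U : topologicalType) (f : T -> S) (g : S -> U) :
  continuous f -> continuous g -> continuous (fun x => g (f x)).
Proof. by move=> cf cg x; apply: continuous_comp; [exact: cf|exact: cg]. Qed.

End real_continuity.

Section density.
Local Open Scope ereal_scope.
Context {d : measure_display} {T : measurableType d} {R : realType}.

(** [p] and the Radon-Nikodym derivative have the same integral over every measurable set, hence
    agree almost everywhere. *)
Lemma ge0_integral_density (nu : {finite_measure set T -> \bar R})
    (mu : {sigma_finite_measure set T -> \bar R}) (p : T -> R)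
    (f : T -> \bar R) :
  measurable_fun setT p -> (forall x, (0 <= p x)%R) ->
  (forall A, measurable A -> nu A = \int[mu]_(x in A) (p x)%:E) ->
  measurable_fun setT f -> (forall x, 0 <= f x) ->
  \int[nu]_x f x = \int[mu]_x (f x * (p x)%:E).
Proof.
move=> mp p0 nup mf f0.
have numu : nu `<< mu.
  apply/null_content_dominatesP => A mA A0; rewrite nup//.
  by apply: null_set_integral => //; apply/measurable_funTS/measurable_EFinP.
rewrite -(Radon_Nikodym_SigmaFinite.change_of_variables numu)//.
have mRN := Radon_Nikodym_SigmaFinite.f_integrable numu.
apply: ae_eq_integral => //.
- by apply: emeasurable_funM => //; exact: measurable_int mRN.
- by apply: emeasurable_funM => //; exact/measurable_EFinP.
apply: ae_eqe_mul2l.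
apply: integral_ae_eq => // [|A _ mA].
  exact/measurable_EFinP.
by rewrite -nup// -Radon_Nikodym_SigmaFinite.f_integral.
Qed.

End density.

Section matrix_integrals.
Context {R : realType}.

Definition rset N d (x : 'M[R]_(N, d)) (i : 'I_N) (y : 'rV[R]_d) : 'M[R]_(N, d) :=
  \matrix_(k, l) if k == i then y 0 l else x k l.

Definition mset m n (x : 'M[R]_(m, n)) (i : 'I_m) (j : 'I_n) (s : R) :
    'M[R]_(m, n) :=
  \matrix_(k, l) if (k == i) && (l == j) then s else x k l.

Local Open Scope ereal_scope.

Lemma le_integral_row_product N d (mu : {sigma_finite_measure set 'rV[R]_d -> \bar R})
    (i : 'I_N) (f g : 'M[R]_(N, d) -> \bar R) :
  measurable_fun setT f -> measurable_fun setT g ->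
  (forall x, 0 <= f x) -> (forall x, 0 <= g x) ->
  (forall x, \int[mu]_y f (rset x i y) <= \int[mu]_y g (rset x i y)) ->
  \int[row_product N mu]_x f x <= \int[row_product N mu]_x g x.
Proof.
move=> mf mg f0 g0 fg.
have mrows := @measurable_mx_of_rows R d N.
rewrite (ge0_integral_pushforward mrows (tuple_measure mu N))//.
rewrite (ge0_integral_pushforward mrows (tuple_measure mu N))//.
rewrite !preimage_setT.
have rsetE t y : mx_of_rows (tset t i y) = rset (mx_of_rows t) i y.
  by apply/matrixP => k l; rewrite !mxE tnth_mktuple; case: eqP.
apply: (@le_integral_tuple_measure _ _ _ _ _ i) => //=.
- exact: measurableT_comp mf mrows.
- exact: measurableT_comp mg mrows.
- move=> t; have := fg (mx_of_rows t).
  by under eq_integral do rewrite -rsetE;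
     under [leRHS]eq_integral do rewrite -rsetE.
Qed.

Lemma le_integral_lebesgue_mx m n (i : 'I_m) (j : 'I_n)
    (f g : 'M[R]_(m, n) -> \bar R) :
  measurable_fun setT f -> measurable_fun setT g ->
  (forall x, 0 <= f x) -> (forall x, 0 <= g x) ->
  (forall x, \int[lebesgue_measure]_s f (mset x i j s)
          <= \int[lebesgue_measure]_s g (mset x i j s)) ->
  \int[lebesgue_mx]_x f x <= \int[lebesgue_mx]_x g x.
Proof.
move=> mf mg f0 g0 fg.
have mt := @measurable_mx_of_tuple R m n.
rewrite (ge0_integral_pushforward mt (tuple_measure (@lebesgue_measure R) (m * n)))//.
rewrite (ge0_integral_pushforward mt (tuple_measure (@lebesgue_measure R) (m * n)))//.
rewrite !preimage_setT.
have msetE t y : mx_of_tuple (tset t (mxvec_index i j) y) = mset (mx_of_tuple t) i j y.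
  apply/matrixP => k l; rewrite !mxE tnth_mktuple.
  by rewrite (inj_eq (@cast_ord_inj _ _ _)) (inj_eq enum_rank_inj) xpair_eqE.
apply: (@le_integral_tuple_measure _ _ _ _ _ (mxvec_index i j)) => //=.
- exact: measurableT_comp mf mt.
- exact: measurableT_comp mg mt.
- move=> t; have := fg (mx_of_tuple t).
  by under eq_integral do rewrite -msetE;
     under [leRHS]eq_integral do rewrite -msetE.
Qed.

End matrix_integrals.

(** * Topology and measurability of matrices *)

Section matrix_topology.
Context {R : realType} {m n : nat}.
Local Notation M := 'M[R]_(m, n).

Lemma mx_norm_le (x : M) (r : R) : 0 <= r ->
  (`|x| <= r) <-> (forall i j, `|x i j| <= r).
Proof.
move=> r0; rewrite [`|x|]/Num.norm/= mx_normrE; split.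
  by move=> /bigmax_leP[_ h] i j; exact: (h (i, j)).
by move=> h; apply/bigmax_leP; split => // -[i j] _; exact: h.
Qed.

Lemma mx_norm_lt (x : M) (r : R) : 0 < r ->
  (`|x| < r) <-> (forall i j, `|x i j| < r).
Proof.
move=> r0; rewrite [`|x|]/Num.norm/= mx_normrE; split.
  by move=> /bigmax_ltP[_ h] i j; exact: (h (i, j)).
by move=> h; apply/bigmax_ltP; split => // -[i j] _; exact: h.
Qed.

Lemma ler_mx_entry (x : M) i j : `|x i j| <= `|x|.
Proof. exact: ((mx_norm_le x (normr_ge0 x)).1 (lexx _) i j). Qed.

Lemma dense_ratr_mx (x : M) (e : R) : 0 < e ->
  exists q : 'M[rat]_(m, n), `|x - map_mx ratr q| < e.
Proof.
move=> e0.
have h i j : exists q : rat, `|x i j - ratr q| < e.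
  have /rat_in_itvoo[q] : x i j - e < x i j + e by lra.
  by rewrite in_itv/= => /andP[a b]; exists q; rewrite ltr_norml; lra.
pose q := \matrix_(i, j) sval (cid (h i j)).
exists q; apply/(mx_norm_lt _ e0) => i j; rewrite !mxE.
by case: cid.
Qed.

Lemma continuous_mx_entry (i : 'I_m) (j : 'I_n) : continuous (fun x : M => x i j).
Proof.
by move=> x; apply: differentiable_continuous; exact: differentiable_coord.
Qed.

Lemma continuous_mxP (T : topologicalType) (f : T -> M) (t : T) :
  {for t, continuous f} <-> forall i j, {for t, continuous (fun x => f x i j)}.
Proof.
split => [cf i j|cf].
  apply: (@continuous_comp _ _ _ f (fun x : M => x i j)) => //.
  exact: continuous_mx_entry.
apply/cvgrPdist_lt => e e0.
have : \forall t' \near t, forall i j, `|f t i j - f t' i j| < e.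
  apply: filter_forall => i; apply: filter_forall => j.
  by have /cvgrPdist_lt := cf i j; exact.
apply: filterS => t' h; apply/(mx_norm_lt _ e0) => i j.
by rewrite !mxE.
Qed.

Lemma measurable_mx_entry (i : 'I_m) (j : 'I_n) : measurable_fun setT (fun x : M => x i j).
Proof. by have /measurable_fun_mxP := @measurable_id _ M setT; exact. Qed.

(** Every point of [O] lies in a cube with rational centre that stays inside [O], and such cubes are
    countably many. This links the topology to a sigma-algebra that is generated by the entries. *)
Lemma open_mx_measurable (O : set M) : open O -> measurable O.
Proof.
move=> oO.
pose B (q : 'M[rat]_(m, n) * nat) : set M :=
  \bigcap_(ij in [set: 'I_m * 'I_n])
    [set x : M | `|x ij.1 ij.2 - ratr (q.1 ij.1 ij.2)| < q.2.+1%:R^-1].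
have mB q : measurable (B q).
  apply: fin_bigcap_measurable => // -[i j] _ /=.
  have -> : [set x : M | `|x i j - ratr (q.1 i j)| < q.2.+1%:R^-1] =
      setT `&` (fun x : M => x i j) @^-1` (ball (ratr (q.1 i j) : R) q.2.+1%:R^-1).
    by rewrite setTI; apply/seteqP; split => x /=; rewrite /ball/= distrC.
  by apply: measurable_mx_entry => //; exact: measurable_ball.
have -> : O = \bigcup_(q in [set: 'M[rat]_(m, n) * nat])
    (if `[< B q `<=` O >] then B q else set0).
  apply/seteqP; split => [x Ox|x [q _]]; last by case: asboolP => // + Bx; exact.
  have /nbhs_ballP[e /= e0 eO] := open_nbhs_nbhs (conj oO Ox).
  have [k ke] : exists k : nat, k.+1%:R^-1 < e / 2.
    have /cvgrPdist_lt/(_ (e / 2)) := @cvg_harmonic R.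
    move=> /(_ _)[|k _ /(_ k (leqnn _)) /=]; first by rewrite divr_gt0.
    by rewrite sub0r normrN ger0_norm// => ke; exists k.
  have k0 : 0 < k.+1%:R^-1 :> R by rewrite invr_gt0.
  have [q xq] := dense_ratr_mx x k0.
  have qx i j : `|x i j - ratr (q i j)| < k.+1%:R^-1.
    by have := (mx_norm_lt _ k0).1 xq i j; rewrite !mxE.
  exists (q, k) => //; case: asboolP => [_ [i j] _ /=|]; first exact: qx.
  move=> []; move=> y By; apply: eO; rewrite mx_norm_ball /ball_/=.
  apply/(mx_norm_lt _ e0) => i j; rewrite !mxE.
  have /= := By (i, j) I; have := qx i j => h1 h2.
  rewrite (_ : x i j - y i j = (x i j - ratr (q i j)) - (y i j - ratr (q i j))); last by ring.
  apply: (le_lt_trans (ler_normB _ _)); apply: (lt_trans (ltrD h1 h2)).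
  by rewrite [ltRHS]splitr ltrD.
apply: countable_bigcupT_measurable => // q.
by case: asboolP.
Qed.

Lemma continuous_mx_measurable (f : M -> R) : continuous f -> measurable_fun setT f.
Proof.
move=> /continuousP cf; apply: (measurability _ (RGenOpens.measurableE R)).
move=> _ [_ [a [b ->] <-]]; rewrite setTI; apply: open_mx_measurable.
exact/cf/interval_open.
Qed.

End matrix_topology.

(** * One-dimensional change of variables *)

Section substitution.
Context {R : realType}.
Local Notation leb := (@lebesgue_measure R).

(** The increasing map [phi] sends [[a, b]] onto [[phi a, phi b]], a subinterval of [[a', b']]; the
    rest can be added because [w] is nonnegative there. *)
Lemma le_integral_substitution (phi J w : R -> R) (a b a' b' : R) :
  (forall s, is_derive s (1 : R) phi (J s)) -> continuous J -> continuous w ->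
  (forall s, a <= s <= b -> 0 < J s) ->
  (forall s, a <= s <= b -> a' <= phi s <= b') ->
  (forall s, a' <= s <= b' -> 0 <= w s) ->
  (\int[leb]_(s in `[a, b]) (w (phi s) * J s)%:E <=
   \int[leb]_(s in `[a', b']) (w s)%:E)%E.
Proof.
move=> dphi cJ cw J0 phiab w0.
have w0' : (0 <= \int[leb]_(s in `[a', b']) (w s)%:E)%E.
  by apply: integral_ge0 => s; rewrite /= in_itv/= lee_fin; exact: w0.
have [ab|ba] := ltP a b; last first.
  move: ba; rewrite le_eqVlt => /predU1P[->|ba]; first by rewrite set_itv1 integral_set1.
  by rewrite set_itv_ge ?bnd_simp -?ltNge// integral_set0.
have derE : (phi^`())%classic = J.
  by apply/funext => s; rewrite derive1E; exact: derive_val.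
have cphi : continuous phi.
  by move=> s; apply: differentiable_continuous; apply/derivable1_diffP.
have incr : {in `[a, b] &, {homo phi : x y / x < y}}.
  move=> x y /[!in_itv]/= /andP[ax xb] /andP[ay yb] xy.
  apply: (@gtr0_derive1_lt_cc _ phi x y) => //; rewrite ?in_itv/= ?lexx ?(ltW xy)//.
  - move=> z /[!in_itv]/= /andP[xz zy]; rewrite derE; apply: J0.
    by rewrite (le_trans ax (ltW xz)) (le_trans (ltW zy) yb).
  - exact: continuous_subspaceT.
apply: (@le_trans _ _ (\int[leb]_(s in `[phi a, phi b]) (w s)%:E)%E).
  rewrite (@integration_by_substitution_increasing R phi w a b (ltW ab) incr).
  - by rewrite derE le_eqVlt; apply/predU1P; left; apply: eq_integral => s _.
  - by rewrite derE => s _; exact: cJ.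
  - rewrite derE; apply/cvg_ex; exists (J a); apply: cvg_at_right_filter; exact: cJ.
  - rewrite derE; apply/cvg_ex; exists (J b); apply: cvg_at_left_filter; exact: cJ.
  - split.
    + by move=> s _; have := dphi s => /@ex_derive.
    + by apply: cvg_at_right_filter; exact: cphi.
    + by apply: cvg_at_left_filter; exact: cphi.
  - exact: continuous_subspaceT.
apply: ge0_subset_integral => //.
- by apply/measurable_EFinP/measurable_funTS; exact: continuous_measurable_fun.
- have /andP[h1 _] : a' <= phi a <= b' by apply: phiab; rewrite lexx ltW.
  have /andP[_ h2] : a' <= phi b <= b' by apply: phiab; rewrite lexx ltW.
  move=> s; rewrite /= !in_itv/= => /andP[h3 h4].
  by rewrite (le_trans h1 h3) (le_trans h4 h2).
Qed.

End substitution.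

(** * One-coordinate shears and the splitting scheme *)

Section shear.
Context {R : realType} {N d : nat}.
Local Notation M := 'M[R]_(N, d).
Local Notation E := 'rV[R]_d.

Definition mx_ball0 m n (r : R) : set 'M[R]_(m, n) := [set x | `|x| <= r].

Lemma measurable_mx_ball0 m n r : measurable (@mx_ball0 m n r).
Proof.
have mn := continuous_mx_measurable (@norm_continuous _ 'M[R]_(m, n)).
have -> : @mx_ball0 m n r = setT `&` (@Num.norm _ _) @^-1` `]-oo, r].
  by rewrite setTI; apply/seteqP; split => x /=; rewrite in_itv.
exact: mn.
Qed.

Lemma mset_row (x : M) i j s : row i (mset x i j s) = mset (row i x) 0 j s.
Proof. by apply/rowP => l; rewrite !mxE eqxx. Qed.

Lemma msetE (x : M) i j s : mset x i j s i j = s.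
Proof. by rewrite mxE !eqxx. Qed.

Lemma mset_mset m n (x : 'M[R]_(m, n)) i j s t : mset (mset x i j s) i j t = mset x i j t.
Proof. by apply/matrixP => k l; rewrite !mxE; case: (_ && _). Qed.

Lemma continuous_mset (x : M) i j : continuous (mset x i j).
Proof.
move=> s; apply/continuous_mxP => k l.
have [kl|kl] := boolP ((k == i) && (l == j)).
  rewrite (_ : (fun _ => _) = id) //; apply/funext => t.
  by rewrite mxE kl.
rewrite (_ : (fun _ => _) = cst (x k l)); first exact: cst_continuous.
by apply/funext => t; rewrite mxE (negbTE kl).
Qed.

Lemma mset_ball (x : M) i j s (r : R) : 0 <= r ->
  (`|mset x i j s| <= r) =
  (`|s| <= r) && `[< forall k l, ~~ ((k == i) && (l == j)) -> `|x k l| <= r >].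
Proof.
move=> r0; apply/idP/andP.
  move=> /(mx_norm_le _ r0) h; split; first by have := h i j; rewrite msetE.
  by apply/asboolP => k l kl; have := h k l; rewrite mxE (negbTE kl).
move=> [sr /asboolP h]; apply/(mx_norm_le _ r0) => k l.
by rewrite mxE; case: ifPn => // /h.
Qed.

Variables (V : E -> R) (pi : probability E R) (Z : R).
Hypotheses (Z0 : 0 < Z) (cV : continuous V)
  (piV : has_density pi (fun x => Z^-1 * expR (- V x))).

Definition shear (f : M -> R) (h : R) (i : 'I_N) (j : 'I_d) (x : M) : M :=
  mset x i j (x i j + h * f x).

(** With [D] the derivative of [f] in the moving entry, this is the Jacobian of the shear times the
    ratio of the densities of the product of [pi] at the image and at [x]; all rows but [i] cancel
    in that ratio. *)
Definition shear_weight (f D : M -> R) (h : R) (i : 'I_N) (j : 'I_d) (x : M) : R :=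
  (1 + h * D x) * expR (V (row i x) - V (row i (shear f h i j x))).

Lemma continuous_row (i : 'I_N) : continuous (fun x : M => row i x).
Proof.
move=> x; apply/continuous_mxP => k l.
rewrite (_ : (fun _ => _) = (fun x : M => x i l)); first exact: continuous_mx_entry.
by apply/funext => y; rewrite mxE.
Qed.

Lemma continuous_shear f h i j : continuous f -> continuous (shear f h i j).
Proof.
move=> cf x; apply/continuous_mxP => k l.
have [kl|kl] := boolP ((k == i) && (l == j)).
  rewrite (_ : (fun _ => _) = (fun x : M => x i j + h * f x)); last first.
    by apply/funext => t; rewrite mxE kl.
  apply: contD; first exact: continuous_mx_entry.
  by apply: contM => //; exact: contC.
rewrite (_ : (fun _ => _) = fun x : M => x k l); first exact: continuous_mx_entry.
by apply/funext => t; rewrite mxE (negbTE kl).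
Qed.

Lemma continuous_shear_weight f D h i j : continuous f -> continuous D ->
  continuous (shear_weight f D h i j).
Proof.
move=> cf cD; apply: contM.
  by apply: contD; [exact: contC|apply: contM => //; exact: contC].
apply: cont_comp; last exact: continuous_expR.
apply: contB; first by apply: cont_comp => //; exact: continuous_row.
apply: cont_comp => //; apply: cont_comp; [exact: continuous_shear|exact: continuous_row].
Qed.

(* The mass escaping the ball of radius [r'] is dropped, so that only an
   inequality remains; this avoids any global control of the Jacobian. *)
Lemma shear_integral_le (f D w : M -> R) (h : R) (i : 'I_N) (j : 'I_d) (r r' : R) :
  0 <= r -> r <= r' ->
  continuous f -> continuous D -> continuous w ->
  (forall x s, is_derive s (1 : R) (fun s => f (mset x i j s)) (D (mset x i j s))) ->
  (forall x, `|x| <= r -> 0 < 1 + h * D x) ->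
  (forall x, `|x| <= r -> `|shear f h i j x| <= r') ->
  (forall x, `|x| <= r' -> 0 <= w x) ->
  (\int[row_product N pi]_(x in mx_ball0 r)
      (shear_weight f D h i j x * w (shear f h i j x))%:E <=
   \int[row_product N pi]_(x in mx_ball0 r') (w x)%:E)%E.
Proof.
move=> r0 rr' cf cD cw dfD J0 shr w0.
have r'0 := le_trans r0 rr'.
rewrite integral_mkcond [leRHS]integral_mkcond.
have cl : continuous (fun x => shear_weight f D h i j x * w (shear f h i j x)).
  apply: contM; first exact: continuous_shear_weight.
  by apply: cont_comp => //; exact: continuous_shear.
have mres r1 (g : M -> R) : continuous g ->
    measurable_fun setT ((fun x => (g x)%:E) \_ (mx_ball0 r1)).
  move=> cg; apply/(measurable_restrictT _ _).1; first exact: measurable_mx_ball0.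
  by apply/measurable_funTS/measurable_EFinP; exact: continuous_mx_measurable.
have sw0 x : `|x| <= r -> 0 <= shear_weight f D h i j x * w (shear f h i j x).
  move=> xr; rewrite mulr_ge0//; last by apply: w0; exact: shr.
  by rewrite mulr_ge0 ?expR_ge0// ltW// J0.
have res0 r1 (g : M -> R) : (forall x, `|x| <= r1 -> 0 <= g x) ->
    forall x, (0 <= ((fun x => (g x)%:E) \_ (mx_ball0 r1)) x)%E.
  by move=> g0 x; apply: erestrict_ge0 => y /= yr; rewrite lee_fin g0.
apply: (@le_integral_row_product _ _ _ _ i).
- exact: mres.
- exact: mres.
- exact: res0.
- exact: res0.
move=> x.
have mrset : measurable_fun setT (rset x i).
  apply/measurable_fun_mxP => k l; under eq_fun do rewrite mxE.
  by case: (k == i); [exact: measurable_mx_entry|exact: measurable_cst].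
have pV0 y : 0 <= Z^-1 * expR (- V y).
  by rewrite mulr_ge0 ?expR_ge0// invr_ge0 ltW.
have mpV : measurable_fun setT (fun y => Z^-1 * expR (- V y)).
  apply: continuous_mx_measurable; apply: contM; first exact: contC.
  by apply: cont_comp; [exact: contN|exact: continuous_expR].
rewrite (@ge0_integral_density _ _ _ pi lebesgue_mx _ _ mpV pV0 piV); first last.
- by move=> y; apply: res0.
- exact: measurableT_comp (mres _ _ cl) mrset.
rewrite (@ge0_integral_density _ _ _ pi lebesgue_mx _ _ mpV pV0 piV); first last.
- by move=> y; apply: res0.
- exact: measurableT_comp (mres _ _ cw) mrset.
apply: (@le_integral_lebesgue_mx _ _ _ 0 j).
- apply: emeasurable_funM; last exact/measurable_EFinP.
  exact: measurableT_comp (mres _ _ cl) mrset.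
- apply: emeasurable_funM; last exact/measurable_EFinP.
  exact: measurableT_comp (mres _ _ cw) mrset.
- by move=> y; rewrite mule_ge0 ?lee_fin//; exact: res0.
- by move=> y; rewrite mule_ge0 ?lee_fin//; exact: res0.
move=> y; set x' := rset x i y.
have zE s : rset x i (mset y 0 j s) = mset x' i j s.
  apply/matrixP => k l; rewrite !mxE/=.
  by case: (k == i); case: (l == j).
have yE s : mset y 0 j s = row i (mset x' i j s).
  rewrite mset_row; congr mset; apply/rowP => l; rewrite !mxE eqxx.
  by [].
pose phi s := s + h * f (mset x' i j s).
pose J s := 1 + h * D (mset x' i j s).
pose W s := w (mset x' i j s) * (Z^-1 * expR (- V (row i (mset x' i j s)))).
pose good (r1 : R) := forall k l, ~~ ((k == i) && (l == j)) -> `|x' k l| <= r1.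
have inball r1 s : 0 <= r1 -> mset x' i j s \in mx_ball0 r1 = (`|s| <= r1) && `[< good r1 >].
  by move=> r10; rewrite -mset_ball//; apply/idP/idP; rewrite inE.
have [gr|ngr] := pselect (good r); last first.
  apply: (@le_trans _ _ 0%E); last first.
    by apply: integral_ge0 => s _; rewrite mule_ge0 ?lee_fin//; exact: res0.
  rewrite integral0_eq// => s _; rewrite zE patchE inball// (asboolF ngr) andbF.
  by rewrite mul0e.
have gr' : good r' by move=> k l kl; apply: le_trans rr'; exact: gr.
under eq_integral => s _ do rewrite zE yE patchE inball// (asboolT gr) andbT.
under [leRHS]eq_integral => s _ do rewrite zE yE patchE inball// (asboolT gr') andbT.
have cmset := @continuous_mset x' i j.
have itvE (r1 s : R) : s \in `[- r1, r1]%classic = (`|s| <= r1).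
  by rewrite ler_norml; apply/idP/idP; rewrite inE/= in_itv.
(* The density at the source cancels the factor exp(V) of the weight and leaves [W] at the image
   times the Jacobian [J], the integrand of a substitution. *)
have lE s : ((if (`|s| <= r)%R then (shear_weight f D h i j (mset x' i j s) *
      w (shear f h i j (mset x' i j s)))%:E else point) *
    (Z^-1 * expR (- V (row i (mset x' i j s))))%:E)%E =
    ((fun s => (W (phi s) * J s)%:E) \_ `[- r, r]) s.
  rewrite patchE itvE; case: ifP => sr; last by rewrite mul0e.
  rewrite -EFinM; congr EFin.
  rewrite /W /phi /J /shear_weight /shear msetE mset_mset.
  set a := V (row i (mset x' i j s)); set b := V _.
  rewrite expRD -/b; have : expR a * expR (- a) = 1 by rewrite -expRD subrr expR0.
  move: (expR a) (expR (-a)) (expR (-b)) => ea ena enb eE.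
  by transitivity ((1 + h * D (mset x' i j s)) * (ea * ena) * enb *
    w (mset x' i j (s + h * f (mset x' i j s))) / Z); [ring|rewrite eE; ring].
have rE s : ((if (`|s| <= r')%R then (w (mset x' i j s))%:E else point) *
    (Z^-1 * expR (- V (row i (mset x' i j s))))%:E)%E =
    ((fun s => (W s)%:E) \_ `[- r', r']) s.
  by rewrite patchE itvE; case: ifP => sr; rewrite ?mul0e// EFinM.
under eq_integral => s _ do rewrite lE.
under [leRHS]eq_integral => s _ do rewrite rE.
rewrite -integral_mkcond -[leRHS]integral_mkcond.
apply: le_integral_substitution.
- apply: contD; first exact: contC.
  by apply: contM; [exact: contC|exact: cont_comp].
- apply: contM; first exact: cont_comp.
  apply: contM; first exact: contC.
  apply: cont_comp; last exact: continuous_expR.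
  apply: contN; apply: cont_comp => //.
  by apply: cont_comp; [exact: cmset|exact: continuous_row].
- move=> s; rewrite -ler_norml => sr; apply: J0; rewrite mset_ball// sr/=.
  exact/asboolT.
- move=> s; rewrite -!ler_norml => sr.
  have : `|mset x' i j s| <= r by rewrite mset_ball// sr/=; exact/asboolT.
  move=> /shr; rewrite /shear msetE mset_mset mset_ball//.
  by move=> /andP[].
- move=> s; rewrite -ler_norml => sr; rewrite mulr_ge0//; apply: w0.
  by rewrite mset_ball// sr/=; exact/asboolT.
Qed.

End shear.

Section scheme.
Context {R : realType} {N d : nat}.
Local Notation M := 'M[R]_(N, d).
Local Notation E := 'rV[R]_d.
Local Notation I := ('I_N * 'I_d)%type.
Variables (F D : I -> M -> R).

Definition step (h : R) (c : I) : M -> M := shear (F c) h c.1 c.2.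

Fixpoint orbit (h : R) (cs : seq I) (x : M) : M :=
  if cs is c :: cs' then orbit h cs' (step h c x) else x.

(** The logarithm of the Jacobian determinant of [orbit]: a step changes a single entry, so its
    determinant is one diagonal term. *)
Fixpoint ldet (h : R) (cs : seq I) (x : M) : R :=
  if cs is c :: cs' then ln (1 + h * D c x) + ldet h cs' (step h c x) else 0.

Lemma orbit_cat h s1 s2 x : orbit h (s1 ++ s2) x = orbit h s2 (orbit h s1 x).
Proof. by elim: s1 x => //= c s IH x; rewrite IH. Qed.

Lemma ldet_cat h s1 s2 x : ldet h (s1 ++ s2) x = ldet h s1 x + ldet h s2 (orbit h s1 x).
Proof. by elim: s1 x => [|c s IH] x /=; rewrite ?add0r// IH addrA. Qed.

Definition sweep (h : R) : M -> M := orbit h (enum [set: I]%SET).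

Definition sweeps (m : nat) : seq I := flatten (nseq m (enum [set: I]%SET)).

Lemma sweepsS m : sweeps m.+1 = enum [set: I]%SET ++ sweeps m.
Proof. by []. Qed.

Lemma orbit_sweeps h m x : orbit h (sweeps m) x = iter m (sweep h) x.
Proof.
elim: m x => //= m IH x; rewrite sweepsS orbit_cat IH -/(sweep h x).
by rewrite -iterS -iterSr.
Qed.

Lemma ldet_sweeps h m x :
  ldet h (sweeps m) x = \sum_(l < m) ldet h (enum [set: I]%SET) (iter l (sweep h) x).
Proof.
elim: m x => [|m IH] x; first by rewrite big_ord0.
rewrite sweepsS ldet_cat IH big_ord_recl; congr (_ + _).
by apply: eq_bigr => l _; rewrite -/(sweep h x) /= -iterS iterSr.
Qed.

Lemma size_sweeps m : size (sweeps m) = (m * (N * d))%N.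
Proof.
rewrite size_flatten /shape map_nseq sumn_nseq.
by rewrite -cardE cardsT card_prod !card_ord mulnC.
Qed.

Lemma stepE h (c c' : I) x :
  step h c x c'.1 c'.2 = if c' == c then x c.1 c.2 + h * F c x else x c'.1 c'.2.
Proof. by rewrite mxE; case: c c' => [i j] [k l]; rewrite xpair_eqE. Qed.

(* Each coordinate is updated once along a duplicate-free list of steps. *)
Lemma orbit_coord h cs x c : uniq cs ->
  orbit h cs x c.1 c.2 = if c \in cs then
    x c.1 c.2 + h * F c (orbit h (take (index c cs) cs) x) else x c.1 c.2.
Proof.
elim: cs x => //= c' cs IH x /andP[c'cs ucs]; rewrite IH// stepE in_cons eq_sym.
have [cc'|cc'] /= := eqVneq c c'; last by case: ifP.
by subst c'; rewrite (negbTE c'cs).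
Qed.

Lemma ldet_uniq h cs x : uniq cs -> ldet h cs x =
  \sum_(c <- cs) ln (1 + h * D c (orbit h (take (index c cs) cs) x)).
Proof.
elim: cs x => [|c' cs IH] x /=; first by rewrite big_nil.
move=> /andP[c'cs ucs]; rewrite big_cons eqxx take0/= IH//; congr (_ + _).
apply: eq_big_seq => c ccs; case: eqVneq => [c'c|_ //].
by move: c'cs; rewrite c'c ccs.
Qed.

Variables (a : R).
Hypotheses (a0 : 0 <= a) (Fa : forall c x, `|F c x| <= a * (1 + `|x|)).

Lemma step_norm h c x : 0 <= h -> 1 + `|step h c x| <= expR (h * a) * (1 + `|x|).
Proof.
move=> h0; apply: (@le_trans _ _ ((1 + h * a) * (1 + `|x|))); last first.
  by rewrite ler_wpM2r ?expR_ge1Dx// addr_ge0.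
have ha : 0 <= h * a * (1 + `|x|) by rewrite !mulr_ge0// addr_ge0.
have -> : (1 + h * a) * (1 + `|x|) = 1 + (`|x| + h * a * (1 + `|x|)) by ring.
rewrite lerD2l; apply/mx_norm_le; first by rewrite addr_ge0.
move=> i j; rewrite (stepE h c (i, j)); case: ifP => _; last first.
  by rewrite (le_trans (ler_mx_entry _ _ _))// lerDl.
apply: (le_trans (ler_normD _ _)); apply: lerD; first exact: ler_mx_entry.
by rewrite normrM ger0_norm// -mulrA ler_wpM2l.
Qed.

Lemma orbit_norm h cs x : 0 <= h ->
  1 + `|orbit h cs x| <= expR (h * a * (size cs)%:R) * (1 + `|x|).
Proof.
move=> h0; elim: cs x => [|c cs IH] x /=; first by rewrite mulr0 expR0 mul1r.
apply: (le_trans (IH _)); rewrite -natr1 [h * a * (_ + _)]mulrDr mulr1 expRD -[leRHS]mulrA.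
by rewrite ler_wpM2l ?expR_ge0// step_norm.
Qed.

Section weight.
Variables (V : E -> R) (pi : probability E R) (Z : R).
Hypotheses (Z0 : 0 < Z) (cV : continuous V)
  (piV : has_density pi (fun x => Z^-1 * expR (- V x))).
Hypotheses (cF : forall c, continuous (F c)) (cD : forall c, continuous (D c)).
Hypothesis dF : forall (c : I) x (s : R),
  is_derive s (1 : R) (fun s => F c (mset x c.1 c.2 s)) (D c (mset x c.1 c.2 s)).

(** As long as the Jacobians stay positive, the density, relative to the product of [pi], of the
    pullback of that product along [orbit]. *)
Fixpoint weight (h : R) (cs : seq I) (x : M) : R :=
  if cs is c :: cs' then
    shear_weight V (F c) (D c) h c.1 c.2 x * weight h cs' (step h c x)
  else 1.

(** Minus the logarithm of the density of the product of [pi], up to a constant. *)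
Definition total (x : M) : R := \sum_i V (row i x).

Lemma total_step h c x :
  total x - total (step h c x) = V (row c.1 x) - V (row c.1 (step h c x)).
Proof.
rewrite /total -sumrB (bigD1 c.1)//= big1 ?addr0// => i ic.
rewrite (_ : row i (step h c x) = row i x) ?subrr//.
by apply/rowP => l; rewrite !mxE (negbTE ic).
Qed.

Lemma continuous_step h c : continuous (step h c).
Proof. exact: continuous_shear. Qed.

Lemma continuous_weight h cs : continuous (weight h cs).
Proof.
elim: cs => /= [|c cs IH]; first exact: contC.
apply: contM; first exact: continuous_shear_weight.
by apply: cont_comp => //; exact: continuous_step.
Qed.

(** The ratios of densities telescope along the orbit. The condition on [r] keeps the whole orbit in
    a ball where every factor [1 + h * D] is positive, so that the exponential of its logarithm
    gives it back. *)
Lemma weightE h cs x r : 0 <= h ->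
  expR (h * a * (size cs)%:R) * (1 + `|x|) <= 1 + r ->
  (forall c y, `|y| <= r -> 0 < 1 + h * D c y) ->
  weight h cs x = expR (ldet h cs x + total x - total (orbit h cs x)).
Proof.
move=> h0 + J0; elim: cs x => [|c cs IH] x /= xr.
  by rewrite add0r subrr expR0.
rewrite IH; last first.
  apply: le_trans xr; rewrite -natr1 [h * a * (_ + _)]mulrDr mulr1 expRD -[leRHS]mulrA.
  by rewrite ler_wpM2l ?expR_ge0// step_norm.
have xr1 : `|x| <= r.
  rewrite -(lerD2l 1); apply: le_trans xr; rewrite ler_peMl ?addr_ge0//.
  by rewrite -expR0 ler_expR !mulr_ge0.
rewrite /shear_weight -/(step h c x) -total_step.
rewrite -[in LHS](lnK (J0 c x xr1)) -!expRD; congr expR; ring.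
Qed.

(** The weighted integral is the mass of an image, hence at most the total mass. [shear_integral_le]
    peels off the first step, with the weight of the remaining ones as integrand; each step
    multiplies [1 + r] by at most [expR (h * a)], and [r'] bounds the final radius. *)
Lemma weight_integral_le h cs (r r' : R) : 0 <= h -> 0 <= r ->
  expR (h * a * (size cs)%:R) * (1 + r) <= 1 + r' ->
  (forall c y, `|y| <= r' -> 0 < 1 + h * D c y) ->
  (\int[row_product N pi]_(x in mx_ball0 r) (weight h cs x)%:E <=
   row_product N pi setT)%E.
Proof.
move=> h0; elim: cs r => [|c cs IH] r r0 /= rr' J0.
  rewrite integral_cst//; last exact: measurable_mx_ball0.
  rewrite mul1e; apply: le_measure => //; rewrite inE//.
  exact: measurable_mx_ball0.
pose r1 := expR (h * a) * (1 + r) - 1.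
have er1 : 1 <= expR (h * a) by rewrite -expR0 ler_expR mulr_ge0.
have rr1 : r <= r1.
  rewrite /r1 -(lerD2l 1); have -> : 1 + (expR (h * a) * (1 + r) - 1) = expR (h * a) * (1 + r) by ring.
  by rewrite ler_peMl// addr_ge0.
have r1r' : expR (h * a * (size cs)%:R) * (1 + r1) <= 1 + r'.
  rewrite /r1 addrC subrK mulrA -expRD; apply: le_trans rr'.
  by rewrite -natr1 [h * a * (_ + _)]mulrDr mulr1.
have rr'1 : r <= r'.
  rewrite -(lerD2l 1); apply: le_trans rr'; rewrite ler_peMl ?addr_ge0//.
  by rewrite -expR0 ler_expR !mulr_ge0.
apply: (le_trans _ (IH r1 _ r1r' J0)); last exact: le_trans rr1.
apply: (shear_integral_le Z0 cV piV) => //.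
- exact: continuous_weight.
- by move=> x xr; apply: J0; exact: le_trans rr'1.
- move=> x xr; rewrite -(lerD2l 1) /r1 [leRHS]addrC subrK.
  apply: (le_trans (step_norm _ _ h0)); rewrite ler_wpM2l ?expR_ge0//.
  by rewrite lerD2l.
- move=> x xr; rewrite (@weightE h cs x r')// ?expR_ge0//.
  by apply: le_trans r1r'; rewrite ler_wpM2l ?expR_ge0// lerD2l.
Qed.

End weight.

End scheme.

(** * Variational formula for relative entropy *)

Section entropy.
Local Open Scope ereal_scope.
Context {d : measure_display} {T : measurableType d} {R : realType}.

Lemma measurable_lne : measurable_fun setT (@lne R).
Proof.
have -> : @lne R = fun x => if x <= 0 then -oo else
    (if x == +oo then +oo else (ln (fine x))%:E).
  by apply/funext => -[r| |] //=; rewrite ?leNye// lee_fin.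
apply: measurable_fun_ifT => //.
  exact: (measurable_fun_lee (@measurable_id _ _ _) (measurable_cst 0)).
apply: measurable_fun_ifT => //.
  exact: (measurable_fun_eqe (@measurable_id _ _ _) (measurable_cst +oo)).
by apply/measurable_EFinP; apply: measurableT_comp.
Qed.

Lemma ae_le_integral (nu : {measure set T -> \bar R}) (f h : T -> \bar R) :
  nu.-integrable setT f -> measurable_fun setT h ->
  {ae nu, forall x, f x <= h x} -> \int[nu]_x f x <= \int[nu]_x h x.
Proof.
move=> intf mh fh; rewrite integralE [leRHS]integralE.
have mf := measurable_int _ intf.
have pos : \int[nu]_x f^\+ x <= \int[nu]_x h^\+ x.
  apply: ae_ge0_le_integral => //; try exact: measurable_funepos.
  by apply: filterS fh => x fhx _; exact: (@funepos_le _ _ [set x] f h (fun y yx => ltac:(by move: yx; rewrite inE => ->)) x (mem_set erefl)).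
have neg : \int[nu]_x h^\- x <= \int[nu]_x f^\- x.
  apply: ae_ge0_le_integral => //; try exact: measurable_funeneg.
  by apply: filterS fh => x fhx _; exact: (@funeneg_le _ _ [set x] f h (fun y yx => ltac:(by move: yx; rewrite inE => ->)) x (mem_set erefl)).
exact: leeB.
Qed.

Lemma probability_bounded_integrable (nu : probability T R) (g : T -> R) (K : R) :
  measurable_fun setT g -> (forall x, (`|g x| <= K)%R) ->
  nu.-integrable setT (EFin \o g).
Proof.
move=> mg gK; apply: (@le_integrable _ _ _ nu _ measurableT _ (EFin \o cst K)).
- exact/measurable_EFinP.
- by move=> x _ /=; rewrite lee_fin (le_trans (gK x))// ler_norm.
- exact: finite_measure_integrable_cst.
Qed.

(* Pointwise, [g a <= a ln a - a + e^g] with [a] the density of [nu]; this is a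
   linearised Donsker-Varadhan inequality. *)
Lemma KL_variational (nu : probability T R)
    (mu : {sigma_finite_measure set T -> \bar R}) (g : T -> R) (K : R) :
  measurable_fun setT g -> (forall x, (`|g x| <= K)%R) ->
  \int[mu]_x (expR (g x))%:E < +oo ->
  \int[nu]_x (g x)%:E + 1 <= KL nu mu + \int[mu]_x (expR (g x))%:E.
Proof.
move=> mg gK intg.
have eg0 : 0 <= \int[mu]_x (expR (g x))%:E.
  by apply: integral_ge0 => x _; rewrite lee_fin expR_ge0.
have egfin : \int[mu]_x (expR (g x))%:E \is a fin_num by rewrite ge0_fin_numE.
rewrite /KL; case: asboolP => [numu|_]; last by rewrite addye ?leey// gt_eqF// (lt_le_trans _ eg0).
set a := Radon_Nikodym _ _; pose b := Radon_Nikodym_SigmaFinite.f nu mu.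
have b0 x : 0 <= b x by exact: Radon_Nikodym_SigmaFinite.f_ge0.
have bfin x : b x \is a fin_num by exact: Radon_Nikodym_SigmaFinite.f_fin_num.
have mb := measurable_int _ (Radon_Nikodym_SigmaFinite.f_integrable numu).
have ma : measurable_fun setT a.
  by apply: (measurable_int mu); exact: Radon_Nikodym_integrable.
have ab : \int[nu]_x lne (a x) = \int[nu]_x lne (b x).
  apply: ae_eq_integral => //; [exact: measurableT_comp measurable_lne ma|
    exact: measurableT_comp measurable_lne mb|].
  have /ae_eq_sym : ae_eq mu setT b a by exact: ae_eq_Radon_Nikodym_SigmaFinite.
  move=> /(ae_eq_comp (@lne R)) [N [mN N0 h]]; exists N; split => //.
  by move/null_content_dominatesP : numu; apply.
rewrite ab.
(* Where the density [b] is positive, [psi] is e^g / b; so [b * psi] is at most e^g and the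
   [nu]-integral of [psi] at most the [mu]-integral of e^g. *)
pose psi x : R := if (0 < fine (b x))%R then expR (g x - ln (fine (b x)))%R else 0%R.
have psi0 x : (0 <= psi x)%R.
  by rewrite /psi; case: ifPn => // b1; rewrite expR_ge0.
have mfb : measurable_fun setT (fine \o b) by exact: measurableT_comp.
have mpsi : measurable_fun setT psi.
  apply: measurable_fun_ifT => //.
    exact: measurable_fun_ltr.
  apply: measurableT_comp => //; apply: measurable_funB => //.
  exact: measurableT_comp mfb.
have intpsi : \int[nu]_x (psi x)%:E <= \int[mu]_x (expR (g x))%:E.
  rewrite -(Radon_Nikodym_SigmaFinite.change_of_variables numu)//; last exact/measurable_EFinP.
  apply: ge0_le_integral => //.
  - by move=> x _; rewrite mule_ge0 ?lee_fin.
  - by apply: emeasurable_funM => //; exact/measurable_EFinP.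
  - by apply/measurable_EFinP; exact: measurableT_comp.
  - move=> x _; rewrite -[Radon_Nikodym_SigmaFinite.f nu mu x]/(b x) -(fineK (bfin x)) -EFinM lee_fin /psi.
    case: ifPn => b1; last by rewrite mul0r expR_ge0.
    by rewrite expRB lnK// divfK// gt_eqF.
have ipsi : nu.-integrable setT (EFin \o psi).
  apply/integrableP; split; first exact/measurable_EFinP.
  under eq_integral do rewrite /= ger0_norm//.
  exact: le_lt_trans intpsi intg.
have ig : nu.-integrable setT (EFin \o g).
  exact: probability_bounded_integrable gK.
have i1 : nu.-integrable setT (EFin \o cst 1%R).
  by apply: finite_measure_integrable_cst.
have main : \int[nu]_x (g x)%:E - \int[nu]_x (psi x)%:E + 1 <= \int[nu]_x lne (b x).
  have -> : \int[nu]_x (g x)%:E - \int[nu]_x (psi x)%:E + 1 =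
      \int[nu]_x ((EFin \o g) x - (EFin \o psi) x + (EFin \o cst 1%R) x).
    rewrite (integralD measurableT (integrableB measurableT ig ipsi) i1).
    rewrite (integralB measurableT ig ipsi)/= integral_cst//.
    by congr (_ + _); rewrite mul1e; exact/esym/probability_setT.
  apply: ae_le_integral.
  - by apply: integrableD => //; exact: integrableB.
  - exact: measurableT_comp measurable_lne mb.
  (* The exceptional set is where [b] vanishes, which is [nu]-null; elsewhere the bound is
     [1 + u <= expR u] at [u = g - ln b]. *)
  - exists (b @^-1` [set 0]); split.
    + by rewrite -[X in measurable X]setTI; apply: mb.
    + transitivity (\int[mu]_(x in b @^-1` [set 0]) b x).
        apply: Radon_Nikodym_SigmaFinite.f_integral => //.
        by rewrite -[X in measurable X]setTI; apply: mb.
      by apply: integral0_eq => x /= bx.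
    + move=> x /=; apply: contra_notP => bx.
      have b1 : (0 < fine (b x))%R.
        rewrite lt_neqAle fine_ge0// andbT eq_sym fine_eq0//.
        by apply/eqP.
      rewrite -(fineK (bfin x)) lne_EFin// /psi b1 !lee_fin.
      have := expR_ge1Dx (g x - ln (fine (b x))).
      lra.
rewrite -leeBlDr//; apply: le_trans main.
have gfin := integrable_fin_num measurableT ig.
have psifin := integrable_fin_num measurableT ipsi.
move: gfin psifin egfin intpsi; rewrite /=.
move: (\int[nu]_x (g x)%:E) (\int[nu]_x (psi x)%:E) (\int[mu]_x (expR (g x))%:E) => [u| |] [v| |] [w| |]//= _ _ _.
rewrite -!EFinD !lee_fin; lra.
Qed.

Lemma row_product_setT N n (mu : probability 'rV[R]_n R) :
  row_product N mu setT = 1.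
Proof.
suff h k : tuple_measure mu k setT = 1 by exact: h.
elim: k => [|k IH] /=; first by rewrite /= diracT.
rewrite /tuple_measure_step /= /pushforward_can /pushforward preimage_setT.
rewrite /sigma_finite_product -setXTT product_measure1E//.
by rewrite IH mule1; exact: probability_setT.
Qed.

End entropy.

(** * Riemann sums and the expansion of the logarithm *)

Section primitive.
Context {R : realType}.
Local Notation leb := (@lebesgue_measure R).
Variable f : R -> R.
Hypothesis cf : continuous f.

Definition prim (t : R) : R := \int[leb]_(s in `[0, t]) f s.

Lemma continuous_itv_integrable (a b : R) : leb.-integrable `[a, b] (EFin \o f).
Proof.
apply: continuous_compact_integrable; first exact: segment_compact.
exact: continuous_subspaceT.
Qed.

Lemma prim_derive (t : R) : 0 < t -> is_derive t (1 : R) prim (f t).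
Proof.
move=> t0.
have t1 : t < t + 1 by rewrite ltrDl.
have [d1 d2] := continuous_FTC1_closed t1 (continuous_itv_integrable 0 (t + 1)) t0 (cf (x:=t)).
have d3 : 'D_1 prim t = f t by exact: etrans (esym (derive1E _ _)) d2.
exact: DeriveDef d1 d3.
Qed.

Lemma prim_continuous (u : R) : 0 <= u -> {within `[0, u], continuous prim}.
Proof.
by move=> u0; apply: parameterized_integral_continuous => //; exact: continuous_itv_integrable.
Qed.

Lemma prim0 : prim 0 = 0.
Proof. by rewrite /prim set_itv1 Rintegral_set1. Qed.

(** By the mean value theorem the primitive grows over each cell by [h] times a value of [f] inside
    it, so each sample [v l] need only be [e]-close to [f] on its own cell. *)
Lemma riemann_sum (h e : R) (m : nat) (v : nat -> R) : 0 <= h ->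
  (forall l s, (l < m)%N -> l%:R * h <= s <= l.+1%:R * h -> `|v l - f s| <= e) ->
  `|h * (\sum_(l < m) v l) - prim (m%:R * h)| <= e * (m%:R * h).
Proof.
move=> h0; elim: m => [|m IH] vf.
  by rewrite big_ord0 mulr0 mul0r prim0 subr0 normr0 mulr0.
rewrite big_ord_recr/=.
have mh : m%:R * h <= m.+1%:R * h by rewrite ler_wpM2r// ler_nat.
have mh0 : 0 <= m%:R * h by rewrite mulr_ge0.
have [c + ->] : exists2 c, c \in `[m%:R * h, m.+1%:R * h]%R &
    prim (m.+1%:R * h) = prim (m%:R * h) + f c * h.
  have [//|x xi||c ci fc] := @MVT_segment R prim f (m%:R * h) (m.+1%:R * h).
  - by apply: prim_derive; move: xi; rewrite in_itv/= => /andP[+ _]; exact: le_lt_trans.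
  - apply: (@continuous_subspaceW _ _ _ `[0, m.+1%:R * h]).
      by move=> x; rewrite /= !in_itv/= => /andP[+ ->]; rewrite andbT; exact: le_trans.
    by apply: prim_continuous; rewrite (le_trans mh0).
  - exists c => //; move: fc; rewrite -mulrBl -natrB// subSnn mul1r => <-.
    by rewrite addrC subrK.
rewrite in_itv/= => /andP[c1 c2].
have h1 : `|h * \sum_(i < m) v i - prim (m%:R * h)| <= e * (m%:R * h).
  by apply: IH => l s lm; apply: vf; exact: ltnW.
have h2 : `|v m - f c| <= e by apply: vf => //; rewrite c1.
rewrite (_ : _ - _ = (h * (\sum_(i < m) v i) - prim (m%:R * h)) + h * (v m - f c)); last by ring.
apply: (le_trans (ler_normD _ _)).
have -> : e * (m.+1%:R * h) = e * (m%:R * h) + h * e by rewrite -natr1; ring.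
by apply: lerD => //; rewrite normrM ger0_norm// ler_wpM2l.
Qed.

End primitive.

Section log_bounds.
Context {R : realType}.

Lemma ln1D_bound (z : R) : `|z| <= 2^-1 -> `|ln (1 + z) - z| <= 2 * z ^+ 2.
Proof.
rewrite ler_norml => /andP[z1 z2].
have z0 : 0 < 1 + z by lra.
have h1 : ln (1 + z) <= z by apply: le_ln1Dx; lra.
have h2 : - ln (1 + z) <= (1 + z)^-1 - 1.
  rewrite -lnV ?posrE//; have := @le_ln1Dx R ((1 + z)^-1 - 1).
  rewrite [1 + (_ - 1)]addrC subrK; apply.
  by rewrite ltrBrDr addrC subrr invr_gt0.
have h3 : (1 + z)^-1 - 1 <= - z + 2 * z ^+ 2.
  rewrite -(ler_pM2r z0) mulrBl mulVf ?gt_eqF//.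
  have : 0 <= z ^+ 2 * (1 + 2 * z) by rewrite mulr_ge0 ?sqr_ge0//; lra.
  by rewrite expr2; nra.
rewrite ler_norml; have : 0 <= z ^+ 2 by exact: sqr_ge0.
by lra.
Qed.

End log_bounds.

Lemma cvg_fsum {R : realType} (I T : Type) (F : set_system T) {FF : Filter F}
    (r : seq I) (P : pred I) (f : I -> T -> R) (l : I -> R) :
  (forall i, P i -> f i x @[x --> F] --> l i) ->
  \sum_(i <- r | P i) f i x @[x --> F] --> \sum_(i <- r | P i) l i.
Proof.
move=> fl; elim: r => [|i r IH].
  rewrite big_nil (_ : (fun _ => _) = cst 0); first exact: cvg_cst.
  by apply/funext => x; rewrite big_nil.
rewrite big_cons (_ : (fun _ => _) = fun x =>
    if P i then f i x + \sum_(i <- r | P i) f i x else \sum_(i <- r | P i) f i x).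
  by case: ifPn => // Pi; apply: cvgD => //; exact: fl.
by apply/funext => x; rewrite big_cons.
Qed.

(** * Convergence of the splitting scheme *)

Section trajectory.
Context {R : realType} {N d : nat}.
Local Notation M := 'M[R]_(N, d).
Local Notation I := ('I_N * 'I_d)%type.
Local Notation leb := (@lebesgue_measure R).
Local Notation steps := (enum [set: I]%SET).
Variables (F D : I -> M -> R) (a : R).
Hypotheses (a0 : 0 <= a) (Fa : forall c x, `|F c x| <= a * (1 + `|x|)).
Hypothesis FL : forall r : R, exists2 L : R, 0 <= L &
  forall c x y, `|x| <= r -> `|y| <= r -> `|F c x - F c y| <= L * `|x - y|.
Hypothesis cD : forall c, continuous (D c).
Hypothesis DB : forall r : R, exists B : R, forall c x, `|x| <= r -> `|D c x| <= B.
Variables (X : R -> M).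
Hypothesis cX : {within [set t | 0 <= t], continuous X}.
Hypothesis dX : forall (t : R) (c : I), 0 < t ->
  is_derive t (1 : R) (fun s => X s c.1 c.2) (F c (X t)).

(* The trajectory is only continuous on nonnegative times. *)
Definition Xext (t : R) : M := X (Num.max 0 t).

Lemma XextE t : 0 <= t -> Xext t = X t.
Proof. by move=> t0; rewrite /Xext max_r. Qed.

Lemma Xext_continuous : continuous Xext.
Proof.
move=> t; rewrite /Xext; apply/cvgrPdist_lt => e e0.
have m0 : 0 <= Num.max 0 t by rewrite le_max lexx.
have /subspace_continuousP/(_ _ m0)/cvgrPdist_lt/(_ _ e0) := cX.
rewrite near_withinE => /nbhs_ballP[de /= de0 h].
apply/nbhs_ballP; exists de => //= s ts; apply: h; last by rewrite /= le_max lexx.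
apply: le_lt_trans ts; rewrite /ball_/=.
have := ler_norm (t - s); have := ler_norm (- (t - s)); rewrite normrN.
have := normr_ge0 (t - s); move: (`|t - s|) => u u0 u1 u2; rewrite ler_norml.
by case: (lerP 0 t) => t1; case: (lerP 0 s) => s1; apply/andP; split; lra.
Qed.

Lemma X_within (s t : R) : 0 <= s -> {within `[s, t], continuous X}.
Proof.
move=> s0; apply: continuous_subspaceW cX => u /=.
by rewrite in_itv/= => /andP[+ _]; exact: le_trans.
Qed.

Lemma X_bounded (T : R) : 0 <= T -> exists r : R, forall s, 0 <= s <= T -> `|X s| <= r.
Proof.
move=> T0; have cn : continuous (fun t => `|Xext t|).
  by apply: (cont_comp Xext_continuous); exact: norm_continuous.
have [c _ h] := EVT_max T0 (continuous_subspaceT cn (A := `[0, T]%classic)).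
by exists `|Xext c| => s /[dup] /andP[s0 _] sT; rewrite -XextE//; apply: h; rewrite in_itv.
Qed.

Lemma X_mvt (c : I) (s t : R) : 0 <= s -> s <= t ->
  exists2 u, s <= u <= t & X t c.1 c.2 - X s c.1 c.2 = F c (X u) * (t - s).
Proof.
move=> s0 st.
have [||u us ->] := @MVT_segment R (fun s => X s c.1 c.2) (fun s => F c (X s)) s t st.
- move=> x; rewrite in_itv/= => /andP[sx _]; apply: dX; exact: le_lt_trans sx.
- apply: (@cont_comp (subspace `[s, t]) _ _ X (fun y : M => y c.1 c.2)).
    exact: X_within.
  exact: continuous_mx_entry.
- by exists u => //; move: us; rewrite in_itv.
Qed.

(** Compactness of [[0, T]] makes the modulus of continuity of [g] uniform in a tube around the
    trajectory. *)
Lemma X_uniform (g : M -> R) (T e : R) : continuous g -> 0 < e ->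
  exists2 de : R, 0 < de & forall s y, 0 <= s <= T -> `|y - X s| < de ->
    `|g y - g (X s)| < e.
Proof.
move=> cg e0.
pose P (de s : R) := 0 < de -> forall y, `|y - Xext s| < de -> `|g y - g (Xext s)| < e.
have [|de /= de0 h] := (@compact_near_coveringP _ `[0, T]%classic).1
    (@segment_compact R 0 T) _ 0^'+ P _ _; last first.
  exists (de / 2); first by rewrite divr_gt0.
  move=> s y /[dup] /andP[s0 _] sT ys; have := h (de / 2); rewrite /P -(XextE s0).
  apply => //.
  - by rewrite /ball_/= sub0r normrN gtr0_norm ?divr_gt0// ltr_pdivrMr// ltr_pMr// ltr1n.
  - by rewrite divr_gt0.
  - by rewrite divr_gt0.
  - by rewrite XextE.
move=> s _.
have e2 : 0 < e / 2 by rewrite divr_gt0.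
have /cvgrPdist_lt/(_ _ e2)/nbhs_ballP[r /= r0 gr] := cg (Xext s).
have r2 : 0 < r / 2 by rewrite divr_gt0.
have /cvgrPdist_lt/(_ _ r2) nX := Xext_continuous (x := s).
near=> s' de => /= de0 y ys'.
have h1 : `|Xext s - Xext s'| < r / 2 by near: s'.
have h2 : `|Xext s' - y| < r / 2.
  by rewrite distrC; apply: (lt_trans ys'); near: de; exact: nbhs_right_lt.
have h3 : `|g (Xext s) - g (Xext s')| < e / 2.
  apply: gr; rewrite mx_norm_ball /ball_/=; apply: (lt_trans h1).
  by rewrite ltr_pdivrMr// ltr_pMr// ltr1n.
have h4 : `|g (Xext s) - g y| < e / 2.
  apply: gr; rewrite mx_norm_ball /ball_/= (splitr r).
  by rewrite -(subrK (Xext s') (Xext s)) -addrA (le_lt_trans (ler_normD _ _))// ltrD.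
rewrite (splitr e) -(subrK (g (Xext s)) (g y)) -addrA.
by rewrite (le_lt_trans (ler_normD _ _))// ltrD// distrC.
Unshelve. all: by end_near. Qed.

(** The bound depends on the horizon [T] but not on the mesh, so one ball contains all the schemes,
    partial sweeps included. *)
Lemma scheme_box (T h : R) (m : nat) x (cs : seq I) : 0 <= h -> m.+1%:R * h = T ->
  (size cs <= m.+1 * (N * d))%N ->
  1 + `|orbit F h cs x| <= expR (a * T * (N * d)%:R) * (1 + `|x|).
Proof.
move=> h0 mT sz; apply: (le_trans (orbit_norm a0 Fa cs x h0)).
rewrite ler_wpM2r ?addr_ge0// ler_expR -mT.
have -> : a * (m.+1%:R * h) * (N * d)%:R = h * a * (m.+1 * (N * d))%:R.
  by rewrite natrM; ring.
by rewrite ler_wpM2l ?mulr_ge0// ler_nat.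
Qed.

Lemma size_steps : size steps = (N * d)%N.
Proof. by rewrite -cardE cardsT card_prod !card_ord. Qed.

Lemma iter_sweep_partial h l k x :
  orbit F h (take k steps) (iter l (sweep F h) x) =
  orbit F h (@sweeps N d l ++ take k steps) x.
Proof. by rewrite orbit_cat orbit_sweeps. Qed.

Lemma size_partial m l k : (l < m.+1)%N ->
  (size (@sweeps N d l ++ take k steps) <= m.+1 * (N * d))%N.
Proof.
move=> lm; rewrite size_cat size_sweeps.
apply: (@leq_trans (l * (N * d) + N * d)%N).
  by rewrite leq_add2l -size_steps size_take_min geq_minr.
by rewrite -mulSnr leq_mul2r lm orbT.
Qed.

(** A discrete Gronwall argument. Partial sweeps [take k steps] are covered because each coordinate
    is updated from a configuration that is already partly updated. *)
Lemma scheme_error (T : R) : 0 <= T -> exists2 C : R, 0 <= C &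
  forall m l k s (h := T / m.+1%:R), (l < m.+1)%N -> l%:R * h <= s <= l.+1%:R * h ->
    `|orbit F h (take k steps) (iter l (sweep F h) (X 0)) - X s| <= C * h.
Proof.
move=> T0; have [r1 Xr1] := X_bounded T0.
pose r := Num.max r1 (expR (a * T * (N * d)%:R) * (1 + `|X 0|)).
have Xr s : 0 <= s <= T -> `|X s| <= r by move=> /Xr1 h; rewrite le_max h.
have r0 : 0 <= r by rewrite le_max mulr_ge0 ?orbT ?expR_ge0// addr_ge0.
have [L L0 FLr] := FL r.
pose K := a * (1 + r).
have K0 : 0 <= K by rewrite mulr_ge0// addr_ge0.
have FK c y : `|y| <= r -> `|F c y| <= K.
  by move=> yr; apply: (le_trans (Fa _ _)); rewrite ler_wpM2l// lerD2l.
(* The three terms are the displacement within a sweep, the error accumulated over the sweeps, and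
   the motion of [X] within a cell. *)
exists (K + expR (L * T) * (2 * K * L * T) + K).
  by nneg.
move=> m l k s h lm ls.
have h0 : 0 <= h by rewrite divr_ge0.
have mh : m.+1%:R * h = T by rewrite mulrC divfK// pnatr_eq0.
have lT l' : (l' <= m.+1)%N -> l'%:R * h <= T by move=> ?; rewrite -mh ler_wpM2r// ler_nat.
pose y l k := orbit F h (take k steps) (iter l (sweep F h) (X 0)).
have yr l' k' : (l' < m.+1)%N -> `|y l' k'| <= r.
  move=> lm'; rewrite /y iter_sweep_partial le_max; apply/orP; right.
  have := scheme_box (X 0) h0 mh (size_partial k' lm').
  by apply: le_trans; rewrite lerDr.
(* A partial sweep changes each entry at most once, so in the sup norm it moves by at most [h * K]
   whatever the number of entries. *)
have ydiff l' k' : (l' < m.+1)%N -> `|y l' k' - iter l' (sweep F h) (X 0)| <= h * K.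
  move=> lm'; apply/mx_norm_le; first by rewrite mulr_ge0.
  move=> i j; rewrite !mxE.
  have := orbit_coord F h (iter l' (sweep F h) (X 0)) (i, j) (take_uniq k' (enum_uniq [set: I]%SET)).
  rewrite -/(y l' k') => /= ->; case: ifP => [inc|_]; last by rewrite subrr normr0 mulr_ge0.
  rewrite addrAC subrr add0r normrM ger0_norm// ler_wpM2l//; apply: FK.
  by rewrite take_takel; [exact: yr|rewrite (leq_trans (index_size _ _))// size_take_min geq_minl].
have Xlip s1 s2 : 0 <= s1 -> s1 <= s2 -> s2 <= T -> `|X s2 - X s1| <= K * (s2 - s1).
  move=> s10 s12 s2T; apply/mx_norm_le; first by rewrite mulr_ge0// subr_ge0.
  move=> i j; rewrite !mxE.
  have [u /andP[u1 u2] ->] := X_mvt (i, j) s10 s12.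
  rewrite normrM [X in _ * X]ger0_norm ?subr_ge0// ler_wpM2r ?subr_ge0//.
  by apply/FK/Xr; rewrite (le_trans s10 u1) (le_trans u2 s2T).
pose e l := `|iter l (sweep F h) (X 0) - X (l%:R * h)|.
(* The drift of the scheme is evaluated off the trajectory by the previous error and two
   displacements of order [h]. *)
have eS l' : (l' < m.+1)%N -> e l'.+1 <= (1 + h * L) * e l' + 2 * K * L * h ^+ 2.
  move=> lm'; rewrite /e; apply/mx_norm_le.
    by rewrite addr_ge0 ?mulr_ge0 ?sqr_ge0// addr_ge0 ?mulr_ge0.
  move=> i j; rewrite !mxE iterS.
  have := orbit_coord F h (iter l' (sweep F h) (X 0)) (i, j) (enum_uniq [set: I]%SET).
  rewrite -/(sweep F h _) mem_enum finset.inE => /= ->.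
  rewrite -/(y l' _); set y' := y l' _.
  have lh0 : 0 <= l'%:R * h by rewrite mulr_ge0.
  have lh1 : l'%:R * h <= l'.+1%:R * h by rewrite ler_wpM2r// ler_nat.
  have [u /andP[u1 u2]] := X_mvt (i, j) lh0 lh1.
  have -> : l'.+1%:R * h - l'%:R * h = h by rewrite -natr1; ring.
  move=> /= /eqP; rewrite subr_eq => /eqP ->.
  set A := iter l' _ _; set B := X (l'%:R * h).
  have -> : A i j + h * F (i, j) y' - (F (i, j) (X u) * h + B i j) =
     (A i j - B i j) + h * (F (i, j) y' - F (i, j) (X u)) by ring.
  have h1 : `|A i j - B i j| <= e l'.
    by have := ler_mx_entry (A - B) i j; rewrite !mxE.
  have uT : 0 <= u <= T by rewrite (le_trans lh0 u1) (le_trans u2 (lT _ lm')).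
  have h2 : `|F (i, j) y' - F (i, j) (X u)| <= L * (h * K + e l' + h * K).
    apply: (le_trans (FLr _ _ _ (yr _ _ lm') (Xr _ uT))); rewrite ler_wpM2l//.
    rewrite (_ : y' - X u = (y' - A) + (A - B) + (B - X u)); last by rewrite !subrKA.
    apply: (le_trans (ler_normD _ _)); apply: lerD.
      by apply: (le_trans (ler_normD _ _)); apply: lerD => //; exact: ydiff.
    rewrite distrC; apply: (le_trans (Xlip _ _ lh0 u1 _)); first by case/andP: uT.
    rewrite mulrC ler_wpM2r//; apply: (le_trans (lerB u2 (lexx _))).
    by rewrite -natr1; lra.
  apply: (le_trans (ler_normD _ _)).
  have -> : (1 + h * L) * e l' + 2 * K * L * h ^+ 2 = e l' + h * (L * (h * K + e l' + h * K)).
    by ring.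
  by apply: lerD => //; rewrite normrM (ger0_norm h0) ler_wpM2l.
have ebound l' : (l' <= m.+1)%N -> e l' <= expR (L * h * l'%:R) * (2 * K * L * h) * (l'%:R * h).
  elim: l' => [_|l' IH lm']; first by rewrite /e/= mul0r subrr normr0 mulr0.
  apply: (le_trans (eS _ lm')).
  apply: (@le_trans _ _ (expR (L * h) * (expR (L * h * l'%:R) * (2 * K * L * h) * (l'%:R * h))
      + expR (L * h * l'.+1%:R) * (2 * K * L * h ^+ 2))).
    apply: lerD; first apply: ler_pM.
    - by rewrite addr_ge0 ?mulr_ge0.
    - exact: normr_ge0.
    - by rewrite mulrC; exact: expR_ge1Dx.
    - exact: IH (ltnW lm').
    - apply: ler_peMl; first by nneg.
      by rewrite -[leLHS]expR0 ler_expR; nneg.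
  rewrite le_eqVlt; apply/predU1P; left.
  have -> : expR (L * h * l'.+1%:R) = expR (L * h) * expR (L * h * l'%:R).
    by rewrite -expRD -natr1; congr expR; ring.
  by rewrite -natr1; ring.
have el : e l <= expR (L * T) * (2 * K * L * T) * h.
  apply: (le_trans (ebound _ (ltnW lm))).
  have -> : expR (L * T) * (2 * K * L * T) * h = expR (L * T) * (2 * K * L * h) * T by ring.
  apply: ler_pM.
  - by nneg.
  - by rewrite mulr_ge0.
  - apply: ler_wpM2r; first by nneg.
    rewrite ler_expR -mulrA ler_wpM2l//.
    by rewrite mulrC; exact: lT (ltnW lm).
  - exact: lT (ltnW lm).
have lh0 : 0 <= l%:R * h by rewrite mulr_ge0.
move/andP: ls => [ls1 ls2].
rewrite -/(y l k) (_ : y l k - X s = (y l k - iter l (sweep F h) (X 0)) +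
  (iter l (sweep F h) (X 0) - X (l%:R * h)) + (X (l%:R * h) - X s)); last first.
  by rewrite !subrKA.
rewrite mulrDl [(K + _) * h]mulrDl; apply: (le_trans (ler_normD _ _)); apply: lerD.
  apply: (le_trans (ler_normD _ _)); apply: lerD; last exact: el.
  by rewrite mulrC; exact: ydiff.
rewrite distrC; apply: (le_trans (Xlip _ _ lh0 ls1 _)); first exact: le_trans ls2 (lT _ lm).
by rewrite ler_wpM2l//; apply: (le_trans (lerB ls2 (lexx _))); rewrite -natr1; lra.
Qed.

Section limits.
Variables (T : R).
Hypothesis T0 : 0 < T.
Local Notation h m := (T / m.+1%:R).

Lemma mesh_cvg0 (c : R) : c * h m @[m --> \oo] --> (0 : R).
Proof.
rewrite -(mulr0 c); apply: cvgMl_tmp; rewrite -(mulr0 T); apply: cvgMl_tmp.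
exact: cvg_harmonic.
Qed.

(** The configurations reached after [k] updates of each sweep are uniformly close to the
    trajectory, so the sum is a perturbed Riemann sum. *)
Lemma scheme_sum_cvg (g : M -> R) (k : nat) : continuous g ->
  h m * (\sum_(l < m.+1) g (orbit F (h m) (take k steps) (iter l (sweep F (h m)) (X 0))))
    @[m --> \oo] --> prim (g \o Xext) T.
Proof.
move=> cg; have [C C0 Cerr] := scheme_error (ltW T0).
apply/cvgrPdist_le => e e0.
have eT : 0 < e / T by rewrite divr_gt0.
have [de de0 hde] := X_uniform T cg eT.
have /cvgrPdist_lt/(_ _ de0) := mesh_cvg0 C.
apply: filterS => m; rewrite sub0r normrN => Cm.
have h0 : 0 <= h m by rewrite divr_ge0// ltW.
rewrite distrC; have mT : m.+1%:R * h m = T by rewrite mulrC divfK// pnatr_eq0.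
have cgX : continuous (g \o Xext) by apply: (cont_comp Xext_continuous).
have := @riemann_sum R _ cgX (h m) (e / T) m.+1
  (fun l => g (orbit F (h m) (take k steps) (iter l (sweep F (h m)) (X 0)))) h0.
rewrite mT divfK ?gt_eqF//; apply => //.
move=> l s lm ls; have s0 : 0 <= s.
  by case/andP: ls => + _; apply: le_trans; rewrite mulr_ge0.
rewrite /= XextE//; apply/ltW/hde.
  rewrite s0/= -mT; case/andP: ls => _ /le_trans; apply.
  by rewrite ler_wpM2r// ler_nat.
by apply: (le_lt_trans (Cerr m l k s lm ls)); rewrite (le_lt_trans _ Cm)// ler_norm.
Qed.

Lemma scheme_end_cvg : iter m.+1 (sweep F (h m)) (X 0) @[m --> \oo] --> X T.
Proof.
have [C C0 Cerr] := scheme_error (ltW T0).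
apply/cvgrPdist_lt => e e0.
have /cvgrPdist_lt/(_ _ e0) := mesh_cvg0 C.
apply: filterS => m; rewrite sub0r normrN distrC => Cm.
have mT : m.+1%:R * h m = T by rewrite mulrC divfK// pnatr_eq0.
have := Cerr m m (size steps) T (ltnSn m).
rewrite take_size iterS mT lexx andbT => H.
apply: (le_lt_trans (H _)); last by rewrite (le_lt_trans _ Cm)// ler_norm.
by rewrite -[leRHS]mT ler_wpM2r ?ler_nat// divr_ge0// ltW.
Qed.

(** To first order [ln (1 + h * D)] is [h * D], which sums to an integral; the remainders are of
    order [h ^+ 2] and their number is of order [1/h]. *)
Lemma scheme_ldet_cvg : ldet F D (h m) (sweeps m.+1) (X 0) @[m --> \oo] -->
  \sum_(c : I) prim (D c \o Xext) T.
Proof.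
have [B DBr] := DB (expR (a * T * (N * d)%:R) * (1 + `|X 0|)).
pose z m l c := D c (orbit F (h m) (take (index c steps) steps) (iter l (sweep F (h m)) (X 0))).
have zB m l c : (l < m.+1)%N -> `|z m l c| <= B.
  move=> lm; apply: DBr; rewrite iter_sweep_partial.
  have h0 : 0 <= h m by rewrite divr_ge0// ltW.
  have mT : m.+1%:R * h m = T by rewrite mulrC divfK// pnatr_eq0.
  have := scheme_box (X 0) h0 mT (size_partial (index c steps) lm).
  by apply: le_trans; rewrite lerDr.
have sE (G : I -> R) : \sum_(c <- steps) G c = \sum_(c : I) G c.
  by rewrite big_enum; apply: eq_bigl => c; rewrite finset.inE.
have ldetE m : ldet F D (h m) (sweeps m.+1) (X 0) =
    \sum_(c : I) h m * (\sum_(l < m.+1) z m l c) +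
    \sum_(c : I) \sum_(l < m.+1) (ln (1 + h m * z m l c) - h m * z m l c).
  rewrite ldet_sweeps -big_split/=.
  under eq_bigr => l _ do rewrite (ldet_uniq _ _ _ _ (enum_uniq _)).
  rewrite exchange_big sE; apply: eq_bigr => c _.
  by rewrite mulr_sumr -big_split/=; apply: eq_bigr => l _; rewrite addrC subrK.
rewrite (funext ldetE) -[X in _ --> X]addr0; apply: cvgD.
  apply: cvg_fsum => c _.
  exact: (@scheme_sum_cvg (D c) (index c steps)).
pose B' := Num.max B 1.
have B'0 : 0 < B' by rewrite lt_max ltr01 orbT.
have zB' m l c : (l < m.+1)%N -> `|z m l c| <= B'.
  by move=> lm; rewrite le_max zB.
have h12 : 0 < (2 * B')^-1 by rewrite invr_gt0 mulr_gt0.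
apply/cvgrPdist_le => e e0.
pose K := #|{: I}|%:R * (T * (2 * B' ^+ 2)).
near=> m; rewrite sub0r normrN.
have hm0 : 0 <= h m by rewrite divr_ge0// ltW.
have hm : h m <= (2 * B')^-1.
  near: m; have /cvgrPdist_le/(_ _ h12) := mesh_cvg0 1.
  by apply: filterS => m; rewrite sub0r normrN mul1r; apply: le_trans; exact: ler_norm.
apply: (@le_trans _ _ (K * h m)); last first.
  near: m; have /cvgrPdist_le/(_ _ e0) := mesh_cvg0 K.
  by apply: filterS => m; rewrite sub0r normrN; apply: le_trans; exact: ler_norm.
apply: (le_trans (ler_norm_sum _ _ _)).
have -> : K * h m = \sum_(c : I) (T * (2 * B' ^+ 2) * h m).
  by rewrite sumr_const -[RHS]mulr_natl /K; ring.
apply: ler_sum => c _; apply: (le_trans (ler_norm_sum _ _ _)).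
have -> : T * (2 * B' ^+ 2) * h m = \sum_(l < m.+1) (2 * (h m * B') ^+ 2).
  rewrite sumr_const card_ord -[RHS]mulr_natl.
  rewrite (_ : m.+1%:R * _ = (m.+1%:R * h m) * (2 * B' ^+ 2) * h m); last by ring.
  by rewrite [m.+1%:R * _]mulrC divfK// pnatr_eq0.
apply: ler_sum => l _.
have zl : `|h m * z m l c| <= h m * B'.
  by rewrite normrM (ger0_norm hm0) ler_wpM2l// zB'.
apply: (le_trans (ln1D_bound _)).
  apply: (le_trans zl); apply: (le_trans (ler_wpM2r (ltW B'0) hm)).
  by rewrite invfM -mulrA mulVf ?mulr1// gt_eqF.
rewrite ler_wpM2l// -[leLHS]real_normK ?num_real// ler_sqr ?nnegrE//.
by rewrite mulr_ge0// ltW.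
Unshelve. all: by end_near. Qed.

End limits.

End trajectory.

Lemma probability_integral_cst {R : realType} {d} {T : measurableType d}
    (P : probability T R) (c : R) : (\int[P]__ c%:E = c%:E)%E.
Proof.
rewrite integral_cst//= (_ : P setT = 1%E) ?mule1//.
exact: probability_setT.
Qed.

(** * Entropy along a flow *)

Section entropy_flow.
Context {R : realType} {N d : nat}.
Local Notation M := 'M[R]_(N, d).
Local Notation E := 'rV[R]_d.
Local Notation I := ('I_N * 'I_d)%type.
Variables (F D : I -> M -> R) (a : R).
Hypotheses (a0 : 0 <= a) (Fa : forall c x, `|F c x| <= a * (1 + `|x|)).
Hypothesis FL : forall r : R, exists2 L : R, 0 <= L &
  forall c x y, `|x| <= r -> `|y| <= r -> `|F c x - F c y| <= L * `|x - y|.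
Hypotheses (cF : forall c, continuous (F c)) (cD : forall c, continuous (D c)).
Hypothesis DB : forall r : R, exists B : R, forall c x, `|x| <= r -> `|D c x| <= B.

Lemma measurable_step h c : measurable_fun setT (step F h c).
Proof.
apply/measurable_fun_mxP => i j; apply: continuous_mx_measurable.
apply: (cont_comp (f := step F h c) (g := fun x : M => x i j)).
  exact: continuous_step.
exact: continuous_mx_entry.
Qed.

Lemma measurable_orbit h cs : measurable_fun setT (orbit F h cs).
Proof.
elim: cs => /= [|c cs IH]; first exact: measurable_id.
exact: (measurableT_comp IH (measurable_step h c)).
Qed.

Lemma measurable_ldet h cs : measurable_fun setT (ldet F D h cs).
Proof.
elim: cs => /= [|c cs IH]; first exact: measurable_cst.
apply: measurable_funD.
  apply: measurableT_comp; first exact: measurable_ln.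
  apply: continuous_mx_measurable; apply: contD; first exact: contC.
  by apply: contM => //; exact: contC.
exact: (measurableT_comp IH (measurable_step h c)).
Qed.

Variables (V : E -> R) (pi : probability E R) (Z : R).
Hypotheses (Z0 : 0 < Z) (cV : continuous V)
  (piV : has_density pi (fun x => Z^-1 * expR (- V x))).
Hypothesis VB : forall r : R, exists B : R, forall x, `|x| <= r -> `|V x| <= B.
Hypothesis dF : forall (c : I) x (s : R),
  is_derive s (1 : R) (fun s => F c (mset x c.1 c.2 s)) (D c (mset x c.1 c.2 s)).

Lemma continuous_total : continuous (total V : M -> R).
Proof.
apply: cont_sum => i; apply: cont_comp => //; exact: continuous_row.
Qed.

Lemma row_norm_le (x : M) i : `|row i x| <= `|x|.
Proof. by apply/mx_norm_le => // k l; rewrite mxE ler_mx_entry. Qed.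

Lemma total_bounded (r : R) : exists B : R, forall x : M, `|x| <= r -> `|total V x| <= B.
Proof.
have [B VBr] := VB r; exists (\sum_(i < N) B) => x xr.
apply: (le_trans (ler_norm_sum _ _ _)); apply: ler_sum => i _.
by apply: VBr; exact: le_trans (row_norm_le _ _) xr.
Qed.

(** Makes the approximate action bounded on balls, as the variational formula demands; the bound is
    uniform in the mesh because [h] times the number of steps is fixed. *)
Lemma ldet_bound h cs (x : M) (r B : R) : 0 <= h ->
  expR (h * a * (size cs)%:R) * (1 + `|x|) <= 1 + r ->
  (forall c y, `|y| <= r -> `|D c y| <= B) -> h * B <= 2^-1 ->
  `|ldet F D h cs x| <= (size cs)%:R * (2 * (h * B)).
Proof.
move=> h0 + DBr hB; elim: cs x => [|c cs IH] x /= xr; first by rewrite normr0 mul0r.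
have xr1 : `|x| <= r.
  rewrite -(lerD2l 1); apply: le_trans xr; apply: ler_peMl; first by nneg.
  by rewrite -[leLHS]expR0 ler_expR; nneg.
rewrite -natr1 mulrDl mul1r addrC; apply: (le_trans (ler_normD _ _)); apply: lerD.
  apply: IH; apply: le_trans xr; rewrite -natr1 [h * a * (_ + _)]mulrDr mulr1 expRD -[leRHS]mulrA.
  by rewrite ler_wpM2l ?expR_ge0// step_norm.
have hD : `|h * D c x| <= h * B by rewrite normrM (ger0_norm h0) ler_wpM2l// DBr.
have hD2 := le_trans hD hB.
rewrite -(subrK (h * D c x) (ln _)); apply: (le_trans (ler_normD _ _)).
rewrite mulr_natl mulr2n lerD//; apply: (le_trans (ln1D_bound hD2)).
rewrite -[_ ^+ 2]real_normK ?num_real// expr2 mulrA.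
have := normr_ge0 (h * D c x); move: (`|h * D c x|) hD hD2 => u u1 u2 u0.
have : 2 * u * u <= 1 * u by rewrite ler_wpM2r//; lra.
by lra.
Qed.

Context {dO : measure_display} {Om : measurableType dO} (P : probability Om R).
Variables (x0 : {RV P >-> M}) (X : Om -> R -> M).
Hypotheses (X0 : forall w, X w 0 = x0 w)
  (cX : forall w, {within [set t | 0 <= t], continuous (X w)})
  (dX : forall w (t : R) (c : I), 0 < t ->
    is_derive t (1 : R) (fun s => X w s c.1 c.2) (F c (X w t))).

Lemma measurable_sample : measurable_fun setT (x0 : Om -> M).
Proof. exact: measurable_funPT. Qed.

(** Measurability in [w] comes from the scheme: the time integral is a pointwise limit of functions
    of the initial configuration alone. *)
Lemma measurable_prim (g : M -> R) (T : R) : 0 < T -> continuous g ->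
  measurable_fun setT (fun w => prim (g \o Xext (X w)) T).
Proof.
move=> T0 cg.
apply: (@measurable_fun_cvg _ _ _ setT (fun m w => T / m.+1%:R *
  (\sum_(l < m.+1) g (orbit F (T / m.+1%:R) (take 0 (enum [set: I]%SET))
     (iter l (sweep F (T / m.+1%:R)) (x0 w))))) _).
  move=> m; apply: measurable_funM; first exact: measurable_cst.
  apply: measurable_sum => l.
  rewrite take0; under eq_fun do rewrite -orbit_sweeps.
  apply: (@measurableT_comp _ _ _ _ M _ g); first exact: continuous_mx_measurable.
  exact: measurableT_comp (measurable_orbit _ _) measurable_sample.
move=> w _; rewrite -X0.
exact: (scheme_sum_cvg a0 Fa FL (@cX w) (@dX w) T0 0 cg).
Qed.

Lemma measurable_state (g : M -> R) (T : R) : 0 < T -> continuous g ->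
  measurable_fun setT (fun w => g (X w T)).
Proof.
move=> T0 cg.
apply: (@measurable_fun_cvg _ _ _ setT (fun m w =>
  g (orbit F (T / m.+1%:R) (sweeps m.+1) (x0 w))) _).
  move=> m; apply: (@measurableT_comp _ _ _ _ M _ g); first exact: continuous_mx_measurable.
  exact: measurableT_comp (measurable_orbit _ _) measurable_sample.
move=> w _; rewrite -X0.
under eq_fun do rewrite orbit_sweeps.
apply: (@continuous_cvg _ _ _ _ _ _ g); first exact: cg.
exact: (scheme_end_cvg a0 Fa FL (@cX w) (@dX w) T0).
Qed.

(* The log-density of the law of [x0] transported along the flow, relative to
   the product of [pi]. *)
Definition action (T : R) (w : Om) : R :=
  total V (x0 w) - total V (X w T) + \sum_(c : I) prim (D c \o Xext (X w)) T.

Lemma action_measurable T : 0 < T -> measurable_fun setT (action T).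
Proof.
move=> T0; apply: measurable_funD.
  apply: measurable_funB; last exact: measurable_state continuous_total.
  apply: (@measurableT_comp _ _ _ _ M _ (total V)); last exact: measurable_sample.
  exact: continuous_mx_measurable continuous_total.
apply: measurable_sum => c; exact: measurable_prim.
Qed.

(** The logarithm of the [weight] of the scheme with [m.+1] sweeps, in the form of [weightE]. *)
Definition action_approx (T : R) (m : nat) (x : M) : R :=
  ldet F D (T / m.+1%:R) (sweeps m.+1) x + total V x -
  total V (orbit F (T / m.+1%:R) (sweeps m.+1) x).

Lemma action_approx_measurable T m : measurable_fun setT (action_approx T m).
Proof.
have mt : measurable_fun setT (total V : M -> R).
  exact: continuous_mx_measurable continuous_total.
apply: measurable_funB; last exact: measurableT_comp mt (measurable_orbit _ _).
by apply: measurable_funD => //; exact: measurable_ldet.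
Qed.

Lemma action_approx_cvg T w : 0 < T ->
  action_approx T m (x0 w) @[m --> \oo] --> action T w.
Proof.
move=> T0; rewrite /action (addrC _ (\sum_(c : I) _)) addrA.
apply: cvgB; first apply: cvgD.
- rewrite -X0; exact: (scheme_ldet_cvg a0 Fa FL cD DB (@cX w) (@dX w) T0).
- exact: cvg_cst.
- rewrite -X0; under eq_fun do rewrite orbit_sweeps.
  apply: (@continuous_cvg _ _ _ _ _ _ (total V)); first exact: continuous_total.
  exact: (scheme_end_cvg a0 Fa FL (@cX w) (@dX w) T0).
Qed.

Section action_bound.
Variables (T kappa : R).
Hypotheses (T0 : 0 < T)
  (KLk : (KL (distribution P x0) (row_product N pi) <= kappa%:E)%E).
Local Notation h m := (T / m.+1%:R).
Local Notation Pi := (row_product N pi).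

Let PiT : Pi setT = 1%E. Proof. exact: row_product_setT. Qed.

Lemma row_product_le1 A : measurable A -> (Pi A <= 1)%E.
Proof. by move=> mA; rewrite -PiT; apply: le_measure; rewrite ?inE. Qed.

(** The variational formula takes bounded functions. Multiplying the exponent by an indicator costs
    e^0 = 1 off the ball, hence the mass of the complement in the bounds below, which vanishes as
    [n] grows. *)
Definition action_cut (n m : nat) (x : M) : R :=
  \1_(mx_ball0 n%:R) x * action_approx T m x.

Lemma action_cut_measurable n m : measurable_fun setT (action_cut n m).
Proof.
apply: measurable_funM; last exact: action_approx_measurable.
by apply: measurable_indic; exact: measurable_mx_ball0.
Qed.

Lemma action_cutE n m x : `|x| <= n%:R -> action_cut n m x = action_approx T m x.
Proof. by move=> xn; rewrite /action_cut indicE mem_set// mul1r. Qed.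

Lemma action_cut0 n m x : ~ (`|x| <= n%:R) -> action_cut n m x = 0.
Proof. by move=> xn; rewrite /action_cut indicE memNset// mul0r. Qed.

Lemma size_sweeps_mesh m : h m * a * (size (@sweeps N d m.+1))%:R = a * T * (N * d)%:R.
Proof.
rewrite size_sweeps natrM.
rewrite (_ : _ * a * _ = a * (m.+1%:R * h m) * (N * d)%:R); last by ring.
by rewrite [m.+1%:R * _]mulrC divfK// pnatr_eq0.
Qed.

Lemma action_cut_bound n : exists K : R, \forall m \near \oo,
  (forall x, `|action_cut n m x| <= K) /\
  (\int[Pi]_x (expR (action_cut n m x))%:E <= 1 + Pi (~` mx_ball0 n%:R))%E.
Proof.
(* The radius that orbits from the ball of radius [n] can reach by time [T], for every mesh. *)
pose r := expR (a * T * (N * d)%:R) * (1 + n%:R) - 1.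
have er (x : M) : `|x| <= n%:R -> expR (a * T * (N * d)%:R) * (1 + `|x|) <= 1 + r.
  move=> xn; rewrite /r [1 + (_ - 1)]addrC subrK ler_wpM2l ?expR_ge0//.
  by rewrite lerD2l.
have e1 : 1 <= expR (a * T * (N * d)%:R).
  by rewrite -[leLHS]expR0 ler_expR; nneg; exact: ltW.
have nr (x : M) : `|x| <= n%:R -> `|x| <= r.
  move=> xn; rewrite -(lerD2l 1); apply: le_trans (er _ xn).
  by apply: ler_peMl => //; nneg.
have [B DBr] := DB r.
pose B' := Num.max B 1.
have B'0 : 0 < B' by rewrite lt_max ltr01 orbT.
have DBr' c x : `|x| <= r -> `|D c x| <= B' by move=> /DBr; rewrite le_max => ->.
have [B2 VBr] := total_bounded r.
exists (`|(N * d)%:R * (2 * (T * B'))| + B2 + B2 + `|B2|).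
have h12 : 0 < (2 * B')^-1 by rewrite invr_gt0 mulr_gt0.
have /cvgrPdist_lt/(_ _ h12) := mesh_cvg0 T 1.
apply: filterS => m; rewrite sub0r normrN mul1r => hm'.
have h0 : 0 <= h m by rewrite divr_ge0// ltW.
have hm : h m < (2 * B')^-1 by apply: le_lt_trans hm'; exact: ler_norm.
have hB : h m * B' <= 2^-1.
  have -> : 2^-1 = (2 * B')^-1 * B' by rewrite invfM -mulrA mulVf ?mulr1// gt_eqF.
  exact: ler_wpM2r (ltW B'0) _ _ (ltW hm).
have J0 c y : `|y| <= r -> 0 < 1 + h m * D c y.
  move=> yr; have : `|h m * D c y| <= 2^-1.
    rewrite normrM (ger0_norm h0); apply: le_trans hB.
    by rewrite ler_wpM2l// DBr'.
  by rewrite ler_norml; move: (T / m.+1%:R * D c y) => u /andP[u1 u2]; lra.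
have orb x : `|x| <= n%:R -> `|orbit F (h m) (sweeps m.+1) x| <= r.
  move=> xn; rewrite -(lerD2l 1); apply: le_trans (er _ xn).
  by have := orbit_norm a0 Fa (sweeps m.+1) x h0; rewrite size_sweeps_mesh.
split=> [x|].
  have [xn|xn] := pselect (`|x| <= n%:R); last first.
    rewrite action_cut0// normr0 -addrA -addrA; rewrite addr_ge0// addrA.
    have := ler_norm (- B2); rewrite normrN => B20.
    have := VBr _ (nr 0 _); rewrite normr0 ler0n => /(_ isT) h3.
    have : 0 <= B2 by exact: le_trans (normr_ge0 _) h3.
    by move=> ?; rewrite !addr_ge0.
  rewrite action_cutE// /action_approx.
  apply: (le_trans (ler_normB _ _)); rewrite -[leLHS]addr0; apply: lerD => //.
  apply: lerD; last by apply: VBr; exact: orb.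
  apply: (le_trans (ler_normD _ _)); apply: lerD; last by apply: VBr; exact: nr.
  have := @ldet_bound (h m) (sweeps m.+1) x r B' h0.
  rewrite size_sweeps_mesh => /(_ (er _ xn) DBr' hB) /le_trans; apply.
  rewrite size_sweeps natrM.
  rewrite (_ : _ * _ * _ = (N * d)%:R * (2 * ((m.+1%:R * h m) * B'))); last by ring.
  by rewrite [m.+1%:R * _]mulrC divfK ?pnatr_eq0// ler_norm.
have mB := @measurable_mx_ball0 R N d n%:R.
rewrite -(setUv (mx_ball0 n%:R)) ge0_integral_setU//; last 3 first.
- exact: measurableC.
- rewrite setUv; apply/measurable_EFinP; apply: measurableT_comp => //.
  exact: action_cut_measurable.
- by apply/disj_setPS; rewrite setICr.
apply: leeD.
  have <- : Pi setT = 1%E by [].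
  have rn : expR (h m * a * (size (@sweeps N d m.+1))%:R) * (1 + n%:R) <= 1 + r.
    by rewrite size_sweeps_mesh /r [1 + (_ - 1)]addrC subrK.
  apply: le_trans (weight_integral_le a0 Fa Z0 cV piV cF cD dF h0 (ler0n R n) rn J0).
  rewrite le_eqVlt; apply/predU1P; left; apply: eq_integral => x; rewrite inE => xn.
  rewrite (weightE a0 Fa V h0 (r := r))//; last by rewrite size_sweeps_mesh; exact: er.
  by rewrite action_cutE.
rewrite (eq_integral (cst 1%E)); last by move=> x; rewrite inE => /= xn; rewrite action_cut0// expR0.
by rewrite integral_cst ?mul1e//; exact: measurableC.
Qed.

(** The variational formula reads: mean + 1 is at most [kappa] + 1 + mass of the complement, since
    the weight integrates to at most 1 on the ball. The mesh then goes to 0 by dominated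
    convergence, the bound [K] being uniform in [m]. *)
Lemma action_ball_le n :
  P.-integrable setT (fun w => (\1_(mx_ball0 n%:R) (x0 w) * action T w)%:E) /\
  (\int[P]_w (\1_(mx_ball0 n%:R) (x0 w) * action T w)%:E <=
   kappa%:E + Pi (~` mx_ball0 n%:R))%E.
Proof.
have mB := @measurable_mx_ball0 R N d n%:R.
have mCB : measurable (~` mx_ball0 n%:R : set M) by exact: measurableC.
have Pifin : Pi (~` mx_ball0 n%:R) \is a fin_num.
  by rewrite ge0_fin_numE// (le_lt_trans (row_product_le1 mCB))// ltry.
have [K [m0 _ HK]] := action_cut_bound n.
have cutle m : (m0 <= m)%N ->
    (\int[P]_w (action_cut n m (x0 w))%:E <= kappa%:E + Pi (~` mx_ball0 n%:R))%E.
  move=> /HK[cK eK].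
  have mc := action_cut_measurable n m.
  have elt : (\int[Pi]_x (expR (action_cut n m x))%:E < +oo)%E.
    by apply: (le_lt_trans eK); rewrite lte_add_pinfty ?ltry// -ge0_fin_numE.
  have i1 : P.-integrable setT (fun w => (action_cut n m (x0 w))%:E).
    apply: (@probability_bounded_integrable _ _ _ P (fun w => action_cut n m (x0 w)) K).
      exact: measurableT_comp mc measurable_sample.
    by move=> w; exact: cK.
  have := KL_variational (distribution P x0) mc cK elt.
  rewrite (@integral_distribution _ _ _ _ _ P x0 (fun x => (action_cut n m x)%:E)); last 2 first.
  - exact/measurable_EFinP.
  - exact: i1.
  have := integrable_fin_num measurableT i1.
  rewrite /comp; move: (\int[P]_x _)%E => [u| |]// _ H1.
  have := le_trans H1 (leeD KLk eK).
  rewrite -(fineK Pifin) -!EFinD !lee_fin; lra.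
have cv w : (action_cut n m (x0 w))%:E @[m --> \oo] -->
    (\1_(mx_ball0 n%:R) (x0 w) * action T w)%:E.
  apply/cvg_EFin; first exact: nearW.
  apply: cvgMl_tmp; exact: action_approx_cvg.
have mlim : measurable_fun setT (fun w => (\1_(mx_ball0 n%:R) (x0 w) * action T w)%:E).
  apply/measurable_EFinP; apply: measurable_funM; last exact: action_measurable.
  apply: (@measurableT_comp _ _ _ _ M); last exact: measurable_sample.
  by apply: measurable_indic.
have [|||||intlim _ cvint] := @dominated_convergence _ _ _ P setT measurableT
   (fun m w => (action_cut n (m + m0) (x0 w))%:E)
   (fun w => (\1_(mx_ball0 n%:R) (x0 w) * action T w)%:E) (cst K%:E).
- move=> m; apply/measurable_EFinP.
  exact: measurableT_comp (action_cut_measurable n _) measurable_sample.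
- exact: mlim.
- by apply: aeW => w _; move: (cv w); rewrite -(cvg_shiftn m0); exact.
- exact: finite_measure_integrable_cst.
- apply: aeW => w m _ /=; rewrite lee_fin.
  by have [+ _] := HK _ (leq_addl m m0); exact.
split; first exact: intlim.
rewrite -(cvg_lim _ cvint)//; apply: lime_le; first by apply/cvg_ex; exists (\int[P]_w (\1_(mx_ball0 n%:R) (x0 w) * action T w)%:E)%E.
by apply: nearW => m; apply: cutle; rewrite leq_addl.
Qed.

(** The shift by [K] makes the integrand nonnegative, so the balls exhaust the space by monotone
    convergence without prior integrability of [action]. *)
Lemma action_le (K : R) : 0 <= K -> (forall w, 0 <= action T w + K) ->
  (\int[P]_w (action T w + K)%:E <= (kappa + K)%:E)%E.
Proof.
move=> K0 aK.
have mB n := @measurable_mx_ball0 R N d n%:R.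
pose f n w := (\1_(mx_ball0 n%:R) (x0 w) * (action T w + K))%:E.
have mind n : measurable_fun setT (fun w => \1_(mx_ball0 n%:R) (x0 w) : R).
  by apply: (@measurableT_comp _ _ _ _ M); [exact: measurable_indic|exact: measurable_sample].
have mf n : measurable_fun setT (f n).
  apply/measurable_EFinP; apply: measurable_funM => //.
  by apply: measurable_funD => //; exact: action_measurable.
have f0 n w : (0 <= f n w)%E by rewrite lee_fin mulr_ge0.
have fnd w : {homo f^~ w : n m / (n <= m)%N >-> (n <= m)%E}.
  move=> n m nm; rewrite lee_fin ler_wpM2r// !indicE ler_nat.
  case: (x0 w \in _) / idP => [|_]; last by case: (_ \in _).
  rewrite inE => /= xn; rewrite mem_set//=.
  by apply: (le_trans xn); rewrite ler_nat.
have flim w : limn (f^~ w) = (action T w + K)%:E.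
  apply/cvg_lim => //; apply: cvg_near_cst.
  have [n xn] : exists n : nat, `|x0 w| <= n%:R.
    by exists (Num.bound `|x0 w|); apply/ltW/archi_boundP.
  exists n => // m /= nm; rewrite /f indicE mem_set ?mul1r//=.
  by apply: (le_trans xn); rewrite ler_nat.
have := cvg_monotone_convergence (mu := P) measurableT mf (fun n w _ => f0 n w) (fun w _ => fnd w).
under eq_integral do rewrite flim.
move=> cvint; rewrite -(cvg_lim _ cvint)//.
have PiB : Pi (~` mx_ball0 n%:R) @[n --> \oo] --> 0%E.
  rewrite -(measure0 Pi).
  have <- : \bigcap_n (~` mx_ball0 n%:R) = set0 :> set M.
    rewrite -setC_bigcup; apply/seteqP; split => x //= /(_ _)[].
    exists (Num.bound `|x|) => //.
    by apply/ltW/archi_boundP.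
  apply: (nonincreasing_cvg_mu (F := fun n => ~` mx_ball0 n%:R)).
  - by rewrite (le_lt_trans (row_product_le1 (measurableC (mB 0%N))))// ltry.
  - by move=> n; exact: measurableC.
  - by apply: bigcapT_measurable => n; exact: measurableC.
  - move=> n m nm; apply/subsetPset; apply: subsetC => x /= /le_trans; apply.
    by rewrite ler_nat.
apply/lee_addgt0Pr => e e0.
apply: lime_le; first by apply/cvg_ex; exists (\int[P]_w (action T w + K)%:E)%E.
have := PiB; move=> /fine_cvgP[Pifin /cvgrPdist_le/(_ _ e0)].
apply: filterS2 Pifin => n Pifin; rewrite sub0r normrN /= => Pie.
have [i1 le1] := action_ball_le n.
apply: (@le_trans _ _ (\int[P]_w ((\1_(mx_ball0 n%:R) (x0 w) * action T w)%:E + K%:E))%E).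
  apply: ge0_le_integral => //.
  - by apply: emeasurable_funD => //; exact: measurable_int i1.
  - move=> w _; rewrite /f -EFinD lee_fin indicE; case: (_ \in _) => /=.
      by rewrite !mul1r.
    by rewrite !mul0r add0r.
rewrite integralD//; last exact: finite_measure_integrable_cst.
rewrite probability_integral_cst.
rewrite -EFinD (_ : kappa + K + e = kappa + e + K); last by ring.
rewrite EFinD; apply: leeD => //; rewrite EFinD.
apply: (le_trans le1); apply: leeD => //.
by rewrite -(fineK Pifin) lee_fin; apply: le_trans Pie; exact: ler_norm.
Qed.

End action_bound.

End entropy_flow.

(** * Derivatives and mean values along lines *)

Section calculus_on_paths.
Context {R : realType}.

Lemma is_derive_path (W : normedModType R) (f : W -> R) (p v : W) (s : R) :
  derivable f (p + s *: v) v ->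
  is_derive s (1 : R) (fun s => f (p + s *: v)) ('D_v f (p + s *: v)).
Proof.
move=> df.
have E : (fun h : R => h^-1 *: (f (p + (h *: (1 : R) + s) *: v) - f (p + s *: v))) =
    (fun h : R => h^-1 *: (f (h *: v + (p + s *: v)) - f (p + s *: v))).
  apply/funext => h; congr (_ *: (f _ - _)).
  by rewrite scalerDl addrCA /GRing.scale/= mulr1.
by apply: DeriveDef; rewrite /derivable /derive /= /shift/= E.
Qed.

Lemma mean_value (f df : R -> R) (a b : R) :
  (forall x, is_derive x (1 : R) f (df x)) ->
  exists2 c, `|c - a| <= `|b - a| & f b - f a = df c * (b - a).
Proof.
move=> dfx.
have cf : continuous f.
  by move=> x; apply: differentiable_continuous; apply/derivable1_diffP.
have [ab|/ltW ba] := leP a b.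
  have [c] := @MVT_segment R f df a b ab (fun x _ => dfx x) (continuous_subspaceT cf).
  rewrite in_itv/= => /andP[ac cb] ->; exists c => //.
  by rewrite !ger0_norm ?subr_ge0// lerD2r.
have [c] := @MVT_segment R f df b a ba (fun x _ => dfx x) (continuous_subspaceT cf).
rewrite in_itv/= => /andP[bc ca] fE; exists c.
  by rewrite !ler0_norm ?subr_le0// lerN2 lerD2r.
by rewrite -opprB fE -mulrN opprB.
Qed.

Lemma mean_value_path (W : normedModType R) (f : W -> R) (p v : W) :
  (forall x, derivable f x v) ->
  exists2 c, `|c| <= (1 : R) & f (p + v) - f p = 'D_v f (p + c *: v).
Proof.
move=> df; have [c c1 fE] := @mean_value (fun s => f (p + s *: v))
  (fun s => 'D_v f (p + s *: v)) 0 1 (fun s => is_derive_path (df _)).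
exists c; first by move: c1; rewrite !subr0 normr1.
by move: fE; rewrite scale1r scale0r addr0 subr0 mulr1.
Qed.

Lemma mean_value_line (W : normedModType R) (f : W -> R) (p v : W) (s : R) :
  (forall x, derivable f x v) ->
  exists2 c, `|c| <= `|s| & f (p + s *: v) - f p = s * 'D_v f (p + c *: v).
Proof.
move=> df; have [c c1 fE] := @mean_value (fun s => f (p + s *: v))
  (fun s => 'D_v f (p + s *: v)) 0 s (fun s => is_derive_path (df _)).
exists c; first by move: c1; rewrite !subr0.
by move: fE; rewrite scale0r addr0 subr0 mulrC.
Qed.

Lemma derive_linear (W : normedModType R) (f : W -> R) (x u v : W) (a : R) :
  differentiable f x -> 'D_(a *: u + v) f x = a * 'D_u f x + 'D_v f x.
Proof. by move=> df; rewrite !deriveE// linearP. Qed.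

Lemma Cnb_diff (W : normedModType R) n (f : W -> R) : Cnb n.+1 f ->
  forall x, differentiable f x.
Proof. by move=> [_ []]. Qed.

Lemma Cnb_derivable (W : normedModType R) n (f : W -> R) : Cnb n.+1 f ->
  forall x v, derivable f x v.
Proof. by move=> cf x v; apply: diff_derivable; exact: Cnb_diff cf x. Qed.

Lemma Cnb_derive (W : normedModType R) n (f : W -> R) v : Cnb n.+1 f -> Cnb n ('D_v f).
Proof. by move=> [_ [_ ]]; exact. Qed.

Lemma Cnb_bounded (W : normedModType R) n (f : W -> R) : Cnb n f ->
  exists2 M : R, 0 <= M & forall x, `|f x| <= M.
Proof.
by case: n => [|n] [[M fM] _]; exists (Num.max 0 M); rewrite ?le_max ?lexx// => x;
  rewrite le_max fM orbT.
Qed.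

Lemma Cnb_continuous (W : normedModType R) n (f : W -> R) : Cnb n f -> continuous f.
Proof.
case: n => [[_ //]|n] [_ [df _]] x; exact: differentiable_continuous.
Qed.

End calculus_on_paths.

(** * Stein operator on the RKHS ball *)

Section rkhs_bounds.
Context {R : realType} {d : nat}.
Local Notation E := 'rV[R]_d.
Variables (k : E -> E -> R) (H : set (E -> R)) (ip : (E -> R) -> (E -> R) -> R).
Hypothesis hH : is_rkhs k H ip.

Lemma rkhs0 : H (fun _ => 0).
Proof.
have h := rkhs_lin hH (-1) (rkhs_kernel hH 0) (rkhs_kernel hH 0).
by rewrite (_ : (fun _ => _) = (fun y => -1 * k y 0 + k y 0))//; apply/funext => y; ring.
Qed.

Lemma ip0 g : H g -> ip (fun _ => 0) g = 0.
Proof.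
move=> Hg; have := rkhs_ip_lin hH 1 rkhs0 rkhs0 Hg.
rewrite (_ : (fun _ => _) = (fun _ => 0)); last by apply/funext => x; rewrite mul1r addr0.
by rewrite mul1r => /eqP; rewrite -subr_eq0 opprD addrA subrr sub0r oppr_eq0 => /eqP.
Qed.

Lemma rkhs_cauchy_schwarz f g : H f -> H g -> ip f g ^+ 2 <= ip f f * ip g g.
Proof.
move=> Hf Hg.
have q t : 0 <= t ^+ 2 * ip f f + 2 * t * ip f g + ip g g.
  have Hh := rkhs_lin hH t Hf Hg.
  have := rkhs_ip_ge0 hH Hh; rewrite (rkhs_ip_lin hH _ Hf Hg Hh).
  rewrite (rkhs_ipC hH Hf Hh) (rkhs_ipC hH Hg Hh) !(rkhs_ip_lin hH _ Hf Hg)//.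
  rewrite (rkhs_ipC hH Hg Hf) => h; apply: le_trans h _.
  by rewrite le_eqVlt; apply/predU1P; left; ring.
have := rkhs_ip_ge0 hH Hf; rewrite le_eqVlt => /predU1P[f0|f0].
  have fE : f = (fun _ => 0).
    by apply/funext => x; apply: (rkhs_ip_eq0 hH Hf); rewrite -f0.
  by rewrite fE !ip0// ?expr0n ?mul0r//; exact: rkhs0.
have := q (- ip f g / ip f f); set b := ip f g; set c := ip g g => h.
rewrite -subr_ge0; have -> : ip f f * c - b ^+ 2 =
    ip f f * ((- b / ip f f) ^+ 2 * ip f f + 2 * (- b / ip f f) * b + c).
  by field; rewrite gt_eqF.
by rewrite mulr_ge0// ltW.
Qed.

Lemma rkhs_comb (I : Type) (r : seq I) (c : I -> R) (x : I -> E) :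
  H (fun y => \sum_(i <- r) c i * k y (x i)).
Proof.
elim: r => [|i r IH].
  by under eq_fun do rewrite big_nil; exact: rkhs0.
under eq_fun do rewrite big_cons.
exact: (rkhs_lin hH (c i) (rkhs_kernel hH (x i)) IH).
Qed.

Lemma rkhs_ip_comb (I : Type) (r : seq I) (c : I -> R) (x : I -> E) h : H h ->
  ip h (fun y => \sum_(i <- r) c i * k y (x i)) = \sum_(i <- r) c i * h (x i).
Proof.
move=> Hh; elim: r => [|i r IH].
  under eq_fun do rewrite big_nil.
  by rewrite (rkhs_ipC hH Hh rkhs0) ip0// big_nil.
under eq_fun do rewrite big_cons.
have Hr := rkhs_comb r c x; have Hi := rkhs_kernel hH (x i).
rewrite (rkhs_ipC hH Hh (rkhs_lin hH (c i) Hi Hr)) (rkhs_ip_lin hH _ Hi Hr Hh).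
rewrite (rkhs_ipC hH Hi Hh) (rkhs_ipC hH Hr Hh) (rkhs_reproducing hH _ Hh) IH.
by rewrite big_cons.
Qed.

(** A finite combination of evaluations is the inner product with the same combination of kernel
    sections, whose squared norm is the double sum; then Cauchy-Schwarz. *)
Lemma rkhs_eval_bound (I : Type) (r : seq I) (c : I -> R) (x : I -> E) h : H h ->
  (\sum_(i <- r) c i * h (x i)) ^+ 2 <=
  ip h h * \sum_(i <- r) \sum_(j <- r) c i * c j * k (x i) (x j).
Proof.
move=> Hh; rewrite -rkhs_ip_comb//; have Hm := rkhs_comb r c x.
apply: (le_trans (rkhs_cauchy_schwarz Hh Hm)).
rewrite le_eqVlt; apply/predU1P; left; congr (_ * _).
rewrite rkhs_ip_comb//; apply: eq_bigr => i _; rewrite mulr_sumr.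
by apply: eq_bigr => j _; rewrite mulrA.
Qed.

Hypothesis hk : Cnb 4 (fun z : E * E => k z.1 z.2).
Variable j : 'I_d.
Local Notation e := (delta_mx 0 j : E).
Local Notation K := (fun z : E * E => k z.1 z.2).

Definition ker1 (x y : E) : R := 'D_((e, 0) : E * E) K (x, y).
Definition ker2 (x y : E) : R := 'D_((0, e) : E * E) K (x, y).
Definition ker12 (x y : E) : R :=
  'D_((e, 0) : E * E) ('D_((0, e) : E * E) K) (x, y).

Definition diff2 (x y : E) (s t : R) : R :=
  k (x + s *: e) (y + t *: e) - k (x + s *: e) y - k x (y + t *: e) + k x y.

Lemma pairDl (x y v : E) (s : R) : (x, y) + s *: ((v, 0) : E * E) = (x + s *: v, y).
Proof.
have h : y + s *: (0 : E) = y by rewrite scaler0 addr0.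
exact: (congr2 pair (erefl (x + s *: v)) h).
Qed.

Lemma pairDr (x y v : E) (s : R) : (x, y) + s *: ((0, v) : E * E) = (x, y + s *: v).
Proof.
have h : x + s *: (0 : E) = x by rewrite scaler0 addr0.
exact: (congr2 pair h (erefl (y + s *: v))).
Qed.

(* Mixed second differences compute [ip] of two difference quotients of kernel
   sections, hence the derivative reproducing property. *)
Lemma diff2_mean (x y : E) (s t : R) : exists2 st : R * R,
  `|st.1| <= `|s| /\ `|st.2| <= `|t| &
  diff2 x y s t = s * t * ker12 (x + st.1 *: e) (y + st.2 *: e).
Proof.
have d1 (z v : E * E) : derivable K z v by exact: (Cnb_derivable hk).
have d2 (z v : E * E) : derivable ('D_((0, e) : E * E) K) z v
  by exact: (Cnb_derivable (Cnb_derive _ hk)).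
pose g (t : R) := K ((x + s *: e, y) + t *: ((0, e) : E * E)) - K ((x, y) + t *: ((0, e) : E * E)).
have dg u : is_derive u (1 : R) g ('D_((0, e) : E * E) K ((x + s *: e, y) + u *: ((0, e) : E * E))
    - 'D_((0, e) : E * E) K ((x, y) + u *: ((0, e) : E * E))).
  by apply: is_deriveB; apply: is_derive_path.
have [tau tau1 gE] := mean_value 0 t dg.
have [sg sg1 sgE] := @mean_value_line _ _ ('D_((0, e) : E * E) K) ((x, y + tau *: e) : E * E)
  ((e, 0) : E * E) s (fun z => d2 z _).
exists (sg, tau) => /=; first by move: tau1; rewrite !subr0.
have -> : diff2 x y s t = g t - g 0.
  by rewrite /g /diff2 !pairDr !scale0r !addr0/=; ring.
by rewrite gE !pairDr subr0 -pairDl sgE !pairDl /ker12; ring.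
Qed.

Lemma ker12_continuous : continuous (fun z : E * E => ker12 z.1 z.2).
Proof.
rewrite (_ : (fun _ => _) = 'D_((e, 0) : E * E) ('D_((0, e) : E * E) K)).
  exact: Cnb_continuous (Cnb_derive _ (Cnb_derive _ hk)).
by apply/funext => -[x y].
Qed.

Lemma diff2_cvg (x y : E) (ep : R) : 0 < ep -> exists2 de : R, 0 < de &
  forall s t, s != 0 -> t != 0 -> `|s| < de -> `|t| < de ->
    `|diff2 x y s t / (s * t) - ker12 x y| < ep.
Proof.
move=> ep0.
have /cvgrPdist_lt/(_ _ ep0)/nbhs_ballP[de /= de0 kde] := ker12_continuous (x := (x, y)).
pose ne := 1 + `|e|.
have ne0 : 0 < ne by rewrite ltr_pwDl.
exists (de / ne); first by rewrite divr_gt0.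
move=> s t s0 t0 sd td; have [[s1 t1]/= [s1s t1t] ->] := diff2_mean x y s t.
rewrite [s * t * _]mulrC mulfK ?mulf_neq0// distrC.
have sm u : `|u| < de / ne -> `|u *: e| < de.
  rewrite ltr_pdivlMr// => h; rewrite normrZ; apply: le_lt_trans h.
  by rewrite ler_wpM2l// /ne lerDr.
apply: (kde (x + s1 *: e, y + t1 *: e)).
split; rewrite /= mx_norm_ball /ball_/= opprD addrA subrr sub0r normrN.
  exact: sm (le_lt_trans s1s sd).
exact: sm (le_lt_trans t1t td).
Qed.

(** The difference of two quotients is a combination of evaluations at three points, so
    [rkhs_eval_bound] applies; its double sum regroups into four mixed second quotients of the
    kernel. *)
Lemma rkhs_quotient_bound h (x : E) (s t : R) : H h -> s != 0 -> t != 0 ->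
  (s^-1 * (h (x + s *: e) - h x) - t^-1 * (h (x + t *: e) - h x)) ^+ 2 <=
  ip h h * (diff2 x x s s / (s * s) - diff2 x x s t / (s * t)
    - diff2 x x t s / (t * s) + diff2 x x t t / (t * t)).
Proof.
move=> Hh s0 t0.
have := rkhs_eval_bound [:: (s^-1, x + s *: e); (t^-1 - s^-1, x); (- t^-1, x + t *: e)]
  (fun p : R * E => p.1) (fun p => p.2) Hh.
rewrite !big_cons !big_nil /= => hb.
rewrite (_ : s^-1 * _ - _ = s^-1 * h (x + s *: e) + ((t^-1 - s^-1) * h x +
  (- t^-1 * h (x + t *: e) + 0))); last by ring.
apply: (le_trans hb); rewrite le_eqVlt; apply/predU1P; left; congr (_ * _).
by rewrite /diff2; field; rewrite s0 t0.
Qed.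

(** As [s] and [t] tend to 0, the four mixed quotients share the limit [ker12 x x] and cancel, so
    the difference quotients of [h] are Cauchy. *)
Lemma rkhs_derivable h (x : E) : H h -> derivable h x e.
Proof.
move=> Hh; apply/cauchy_cvgP; apply/cauchyP => ep ep0.
pose P := ip h h; have P0 : 0 <= P by exact: (rkhs_ip_ge0 hH).
(* Four quotients within [ep'] of their limit bound the square by [P * (4 * ep')]; the [+ 1] keeps
   this strictly below [ep ^+ 2] and covers [P = 0]. *)
pose ep' := ep ^+ 2 / (4 * P + 1).
have P1 : 0 < 4 * P + 1 by rewrite ltr_wpDl// mulr_ge0.
have ep'0 : 0 < ep' by rewrite divr_gt0// exprn_gt0.
have [de de0 dk] := diff2_cvg x x ep'0.
have main s t : s != 0 -> t != 0 -> `|s| < de -> `|t| < de ->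
    `|s^-1 * (h (x + s *: e) - h x) - t^-1 * (h (x + t *: e) - h x)| < ep.
  move=> s0 t0 sd td.
  rewrite -ltr_sqr ?nnegrE ?(ltW ep0)// real_normK ?num_real//.
  apply: (le_lt_trans (rkhs_quotient_bound x Hh s0 t0)); rewrite -/P.
  apply: (@le_lt_trans _ _ (P * (4 * ep'))).
    rewrite ler_wpM2l//.
    have := dk s s s0 s0 sd sd; have := dk s t s0 t0 sd td.
    have := dk t s t0 s0 td sd; have := dk t t t0 t0 td td.
    move: (diff2 x x s s / _) (diff2 x x s t / _) (diff2 x x t s / _) (diff2 x x t t / _).
    move: (ker12 x x) => q a1 a2 a3 a4.
    by rewrite !ltr_norml => /andP[? ?] /andP[? ?] /andP[? ?] /andP[? ?]; lra.
  have -> : P * (4 * ep') = ep ^+ 2 * (4 * P / (4 * P + 1)).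
    by rewrite /ep'; field; rewrite gt_eqF.
  by rewrite gtr_pMr ?exprn_gt0// ltr_pdivrMr// mul1r ltrDl.
pose s0 := de / 2.
have s00 : s0 != 0 by rewrite gt_eqF// divr_gt0.
have s0d : `|s0| < de by rewrite gtr0_norm ?divr_gt0// ltr_pdivrMr// ltr_pMr// ltr1n.
exists (s0^-1 *: (h (x + s0 *: e) - h x)).
have n0 : (0 : R)^' [set t | t != 0] := @nbhs_dnbhs_neq R 0.
have n1 : (0 : R)^' [set t | `|t| < de] := @dnbhs0_lt R R _ de0.
apply: filterS (filterI n0 n1) => t [t0 td] /=.
rewrite /ball/= /ball_/= [t *: e + x]addrC.
exact: main s00 t0 s0d td.
Qed.

Variable b : E -> R.

Definition stein1 (h : E -> R) (x : E) : R := - b x * h x + 'D_e h x.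

(** The Stein kernel in one direction: [stein1] applied to [k] in each of its two arguments. *)
Definition stein_ker1 (x y : E) : R :=
  b x * b y * k x y - b x * ker2 x y - b y * ker1 x y + ker12 x y.

Lemma rkhs_eval_ge0 (I : Type) (r : seq I) (c : I -> R) (x : I -> E) :
  0 <= \sum_(i <- r) \sum_(j <- r) c i * c j * k (x i) (x j).
Proof.
have Hm := rkhs_comb r c x; have := rkhs_ip_ge0 hH Hm.
rewrite rkhs_ip_comb// => /le_trans; apply; rewrite le_eqVlt; apply/predU1P; left.
by apply: eq_bigr => i _; rewrite mulr_sumr; apply: eq_bigr => l _; rewrite mulrA.
Qed.

(** With derivatives replaced by difference quotients, the left side evaluates [h] at [2n] points
    and [rkhs_eval_bound] applies; then the step tends to 0. In this way no derivative of a kernel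
    section has to be placed in [H]. *)
Lemma rkhs_stein_bound n (c : 'I_n -> R) (x : 'I_n -> E) h : H h ->
  0 <= \sum_i \sum_l c i * c l * stein_ker1 (x i) (x l) /\
  (\sum_i c i * stein1 h (x i)) ^+ 2 <=
  ip h h * \sum_i \sum_l c i * c l * stein_ker1 (x i) (x l).
Proof.
move=> Hh.
have nz : \forall s \near (0 : R)^', s != 0 by exact: (@nbhs_dnbhs_neq R 0).
pose L s := \sum_i c i * (- b (x i) * h (x i) + s^-1 * (h (x i + s *: e) - h (x i))).
pose Q s := \sum_i \sum_l c i * c l * (b (x i) * b (x l) * k (x i) (x l)
   - b (x i) * (s^-1 * (k (x i) (x l + s *: e) - k (x i) (x l)))
   - b (x l) * (s^-1 * (k (x i + s *: e) (x l) - k (x i) (x l)))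
   + diff2 (x i) (x l) s s / (s * s)).
have LQ s : s != 0 -> 0 <= Q s /\ L s ^+ 2 <= ip h h * Q s.
  move=> s0.
  (* The flag [true] marks the shifted point, with weight [1/s]; the unshifted one carries the score
     term and [-1/s]. *)
  pose c' (p : bool * 'I_n) := c p.2 * (if p.1 then s^-1 else - b (x p.2) - s^-1).
  pose x' (p : bool * 'I_n) := if p.1 then x p.2 + s *: e else x p.2.
  have QE : \sum_(p <- index_enum (bool * 'I_n)%type)
      \sum_(q <- index_enum (bool * 'I_n)%type) c' p * c' q * k (x' p) (x' q) = Q s.
    rewrite -(pair_bigA _ (fun b0 i => \sum_(j0 <- index_enum (bool * 'I_n)%type)
      c' (b0, i) * c' j0 * k (x' (b0, i)) (x' j0)))//=.
    rewrite big_bool -big_split/=; apply: eq_bigr => i _.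
    rewrite -(pair_bigA _ (fun b0 l => c' (true, i) * c' (b0, l) * k (x' (true, i)) (x' (b0, l))))//=.
    rewrite -(pair_bigA _ (fun b0 l => c' (false, i) * c' (b0, l) * k (x' (false, i)) (x' (b0, l))))//=.
    rewrite !big_bool -!big_split/=; apply: eq_bigr => l _.
    by rewrite /c' /x' /diff2/=; field.
  split; first by rewrite -QE; exact: rkhs_eval_ge0.
  have := rkhs_eval_bound (index_enum (bool * 'I_n)%type) c' x' Hh; rewrite QE.
  rewrite (_ : \sum_(i <- _) c' i * h (x' i) = L s); last first.
    rewrite -(pair_bigA _ (fun b0 i => c' (b0, i) * h (x' (b0, i))))//=.
    rewrite big_bool -big_split/=; apply: eq_bigr => i _; rewrite /c' /x' /=; ring.
  by [].
have Lc : L s @[s --> 0^'] --> \sum_i c i * stein1 h (x i).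
  apply: cvg_fsum => i _; apply: cvgMl_tmp; apply: cvgD; first exact: cvg_cst.
  rewrite (_ : (fun s => _) = (fun s => s^-1 *: ((h \o shift (x i)) (s *: e) - h (x i)))).
    exact: rkhs_derivable.
  by apply/funext => s /=; rewrite [s *: e + _]addrC.
have dK z v : derivable K z v by exact: (Cnb_derivable hk).
have Qc : Q s @[s --> 0^'] --> \sum_i \sum_l c i * c l * stein_ker1 (x i) (x l).
  apply: cvg_fsum => i _; apply: cvg_fsum => l _; apply: cvgMl_tmp.
  apply: cvgD; first apply: cvgB; first apply: cvgB.
  - exact: cvg_cst.
  - apply: cvgMl_tmp.
    rewrite (_ : (fun s => _) = (fun s => s^-1 *: ((K \o shift (x i, x l)) (s *: ((0, e) : E * E)) - K (x i, x l)))).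
      exact: dK.
    apply/funext => s; rewrite /comp /shift.
    by have -> : s *: ((0, e) : E * E) + (x i, x l) = (x i, x l + s *: e) by rewrite addrC pairDr.
  - apply: cvgMl_tmp.
    rewrite (_ : (fun s => _) = (fun s => s^-1 *: ((K \o shift (x i, x l)) (s *: ((e, 0) : E * E)) - K (x i, x l)))).
      exact: dK.
    apply/funext => s; rewrite /comp /shift.
    by have -> : s *: ((e, 0) : E * E) + (x i, x l) = (x i + s *: e, x l) by rewrite addrC pairDl.
  - apply/cvgrPdist_lt => ep ep0; have [de de0 dk] := diff2_cvg (x i) (x l) ep0.
    near=> s; rewrite distrC; apply: dk => //; near: s.
    - exact: nz.
    - exact: nz.
    - exact: (@dnbhs0_lt R R _ de0).
    - exact: (@dnbhs0_lt R R _ de0).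
have L2 : L s ^+ 2 @[s --> 0^'] --> (\sum_i c i * stein1 h (x i)) ^+ 2.
  rewrite (_ : (fun s => L s ^+ 2) = (fun s => L s * L s)) ?expr2; first exact: cvgM.
  by apply/funext => s; rewrite expr2.
split.
  apply: (@ler_cvg_to R (0 : R)^' (@Proper_dnbhs_numFieldType R 0) R _ _ _ _ (cvg_cst 0) Qc).
  by apply: filterS nz => s /LQ[].
have Q2 : ip h h * Q s @[s --> 0^'] -->
  ip h h * \sum_i \sum_l c i * c l * stein_ker1 (x i) (x l) by exact: cvgMl_tmp.
apply: (@ler_cvg_to R (0 : R)^' (@Proper_dnbhs_numFieldType R 0) R _ _ _ _ L2 Q2).
by apply: filterS nz => s /LQ[].
Unshelve. all: by end_near.
Qed.

End rkhs_bounds.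

Lemma cont_pair (T U W : topologicalType) (f : T -> U) (g : T -> W) :
  continuous f -> continuous g -> continuous (fun x => (f x, g x)).
Proof. by move=> cf cg x; apply: cvg_pair; [exact: cf|exact: cg]. Qed.

Section stein_class.
Context {R : realType} {d : nat}.
Local Notation E := 'rV[R]_d.

(** In the induction, the cross term is at most [P i * q + p * Q i] by the inequality of arithmetic
    and geometric means. *)
Lemma sum_cauchy_schwarz (I : Type) (r : seq I) (A P Q : I -> R) :
  (forall i, 0 <= P i) -> (forall i, 0 <= Q i) ->
  (forall i, A i ^+ 2 <= P i * Q i) ->
  (\sum_(i <- r) A i) ^+ 2 <= (\sum_(i <- r) P i) * (\sum_(i <- r) Q i).
Proof.
move=> P0 Q0 APQ; elim: r => [|i r IH]; first by rewrite !big_nil expr0n/= mul0r.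
rewrite !big_cons; set a := \sum_(j <- r) _ in IH *; set p := \sum_(j <- r) _ in IH *.
set q := \sum_(j <- r) _ in IH *.
have p0 : 0 <= p by apply: sumr_ge0.
have q0 : 0 <= q by apply: sumr_ge0.
have h1 : (A i * a) ^+ 2 <= (P i * Q i) * (p * q).
  by rewrite exprMn; apply: ler_pM => //; exact: sqr_ge0.
have h2 : 2 * (A i * a) <= P i * q + p * Q i.
  apply: le_trans (ler_norm _) _.
  rewrite -ler_sqr ?nnegrE ?addr_ge0 ?mulr_ge0// real_normK ?num_real// exprMn.
  apply: (@le_trans _ _ (2 ^+ 2 * ((P i * Q i) * (p * q)))); first by rewrite ler_wpM2l.
  rewrite -subr_ge0; have := sqr_ge0 (P i * q - p * Q i); move/le_trans; apply.
  by rewrite le_eqVlt; apply/predU1P; left; ring.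
have := APQ i; move: IH h2; rewrite !expr2; nra.
Qed.

Variables (V : E -> R) (k : E -> E -> R).
Variables (H : set (E -> R)) (ip : (E -> R) -> (E -> R) -> R).
Hypothesis hH : is_rkhs k H ip.
Hypothesis hk : Cnb 4 (fun z : E * E => k z.1 z.2).

Definition stein_ker (x y : E) : R := \sum_j stein_ker1 k j (partial j V) x y.

Lemma steinE phi x :
  stein V phi x = \sum_j stein1 j (partial j V) (component phi j) x.
Proof.
rewrite /stein /dot /divergence -sumrN -big_split/=; apply: eq_bigr => j _.
by rewrite /stein1 mxE mulNr.
Qed.

Lemma sum_stein_ker n (c : 'I_n -> R) (x : 'I_n -> E) :
  \sum_i \sum_l c i * c l * stein_ker (x i) (x l) =
  \sum_j \sum_i \sum_l c i * c l * stein_ker1 k j (partial j V) (x i) (x l).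
Proof.
rewrite [RHS]exchange_big/=; apply: eq_bigr => i _; rewrite [RHS]exchange_big/=.
by apply: eq_bigr => l _; rewrite mulr_sumr.
Qed.

Lemma stein_ker_ge0 n (c : 'I_n -> R) (x : 'I_n -> E) :
  0 <= \sum_i \sum_l c i * c l * stein_ker (x i) (x l).
Proof.
rewrite sum_stein_ker.
by apply: sumr_ge0 => j _; have [] := rkhs_stein_bound hH hk j (partial j V) c x (rkhs0 hH).
Qed.

(** The directions are bounded separately by [rkhs_stein_bound] and recombined by Cauchy-Schwarz,
    the norms adding up to at most 1. *)
Lemma stein_bound phi n (c : 'I_n -> R) (x : 'I_n -> E) : product_ball H ip phi ->
  (\sum_i c i * stein V phi (x i)) ^+ 2 <=
  \sum_i \sum_l c i * c l * stein_ker (x i) (x l).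
Proof.
move=> [Hphi ball].
have -> : \sum_i c i * stein V phi (x i) =
    \sum_j \sum_i c i * stein1 j (partial j V) (component phi j) (x i).
  by rewrite [RHS]exchange_big/=; apply: eq_bigr => i _; rewrite steinE mulr_sumr.
have := stein_ker_ge0 c x; rewrite sum_stein_ker => k0.
pose Pj j := ip (component phi j) (component phi j).
apply: (@le_trans _ _ ((\sum_j Pj j) * (\sum_j \sum_i \sum_l
    c i * c l * stein_ker1 k j (partial j V) (x i) (x l)))).
  apply: sum_cauchy_schwarz => j; first exact: (rkhs_ip_ge0 hH (Hphi j)).
    by have [] := rkhs_stein_bound hH hk j (partial j V) c x (Hphi j).
  by have [] := rkhs_stein_bound hH hk j (partial j V) c x (Hphi j).
by rewrite -[leRHS]mul1r ler_wpM2r.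
Qed.

Lemma stein_sqr_le phi x : product_ball H ip phi ->
  stein V phi x ^+ 2 <= stein_ker x x.
Proof.
move=> /(@stein_bound _ 1 (fun _ => 1) (fun _ => x)).
by rewrite !big_ord1 !mul1r.
Qed.

Lemma dist_sqr_le (w : E -> R) (K : E -> E -> R) x y :
  (forall n (c : 'I_n -> R) (z : 'I_n -> E), (\sum_i c i * w (z i)) ^+ 2 <=
     \sum_i \sum_l c i * c l * K (z i) (z l)) ->
  (w x - w y) ^+ 2 <= K x x - K x y - K y x + K y y.
Proof.
move=> /(_ 2%N (fun i => if val i == 0%N then 1 else -1)
  (fun i => if val i == 0%N then x else y)).
rewrite !big_ord_recl !big_ord0 /= => /le_trans h.
rewrite (_ : w x - w y = 1 * w x + (-1 * w y + 0)); last by ring.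
by apply: h; rewrite le_eqVlt; apply/predU1P; left; ring.
Qed.

Lemma stein_dist_le phi x y : product_ball H ip phi ->
  (stein V phi x - stein V phi y) ^+ 2 <=
  stein_ker x x - stein_ker x y - stein_ker y x + stein_ker y y.
Proof.
by move=> phiB; apply: dist_sqr_le => n c z; exact: stein_bound.
Qed.

Hypothesis cV : forall j, continuous (partial j V).

Lemma stein_ker_continuous : continuous (fun z : E * E => stein_ker z.1 z.2).
Proof.
have c1 j : continuous (fun z : E * E => partial j V z.1).
  by move=> z; apply: (@cvg_comp _ _ _ fst (partial j V)); [exact: cvg_fst|exact: cV].
have c2 j : continuous (fun z : E * E => partial j V z.2).
  by move=> z; apply: (@cvg_comp _ _ _ snd (partial j V)); [exact: cvg_snd|exact: cV].
apply: cont_sum => j; apply: contD; last exact: ker12_continuous.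
apply: contB; first apply: contB.
- by apply: contM; [exact: contM|exact: (Cnb_continuous hk)].
- apply: contM => //; rewrite (_ : (fun _ => _) = 'D_((0, delta_mx 0 j) : E * E) (fun z => k z.1 z.2)).
    exact: Cnb_continuous (Cnb_derive _ hk).
  by apply/funext => -[].
- apply: contM => //; rewrite (_ : (fun _ => _) = 'D_((delta_mx 0 j, 0) : E * E) (fun z => k z.1 z.2)).
    exact: Cnb_continuous (Cnb_derive _ hk).
  by apply/funext => -[].
Qed.

(** The modulus is that of the Stein kernel near the diagonal, the same for the whole unit ball;
    this is what lets a countable subfamily compute the KSD. *)
Lemma stein_equicontinuous (x : E) (ep : R) : 0 < ep -> exists2 de : R, 0 < de &
  forall (phi : E -> E) (y : E), product_ball H ip phi -> `|y - x| < de ->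
    `|stein V phi y - stein V phi x| < ep.
Proof.
move=> ep0.
have c1 : continuous (fun y : E => stein_ker y y - stein_ker y x - stein_ker x y + stein_ker x x).
  have pc (f g : E -> E) : continuous f -> continuous g ->
      continuous (fun y => stein_ker (f y) (g y)).
    move=> cf cg; exact: (cont_comp (cont_pair cf cg) stein_ker_continuous).
  have ci : continuous (@id E) by move=> z; exact: cvg_id.
  have cc : continuous (fun _ : E => x) := @cst_continuous E E x.
  by apply: contD; [apply: contB; [apply: contB|]|]; apply: pc.
have ep2 : 0 < ep ^+ 2 by rewrite exprn_gt0.
have /cvgrPdist_lt/(_ _ ep2)/nbhs_ballP[de /= de0 kde] := c1 x.
exists de => // phi y phiB yx.
have := kde y; rewrite mx_norm_ball /ball_/= distrC => /(_ yx).
have := stein_dist_le y x phiB.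
move: (stein_ker x x) (stein_ker y y) (stein_ker x y) (stein_ker y x) => a b c e h1.
rewrite (_ : a - a - a + a - (b - e - c + a) = - (b - e - c + a)); last by ring.
rewrite normrN => h.
rewrite -ltr_sqr ?nnegrE ?(ltW ep0)// real_normK ?num_real//.
apply: le_lt_trans h1 _.
exact: le_lt_trans (ler_norm _) h.
Qed.

Lemma stein_continuous phi : product_ball H ip phi -> continuous (stein V phi).
Proof.
move=> phiB x; apply/(@cvgrPdist_lt R R^o E (nbhs (x : E))) => ep ep0.
have [de de0 h] := stein_equicontinuous x ep0.
apply/nbhs_ballP; exists de => //= y; rewrite mx_norm_ball /ball_/= => xy.
by rewrite distrC; apply: h => //; rewrite distrC.
Qed.

Lemma product_ball0 : product_ball H ip (fun _ => 0).
Proof.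
have cE j : component (fun _ : E => 0 : E) j = (fun _ => 0).
  by apply/funext => x; rewrite /component mxE.
split=> [j|]; first by rewrite cE; exact: rkhs0 hH.
by rewrite big1 ?ler01// => j _; rewrite cE (ip0 hH)//; exact: rkhs0 hH.
Qed.

Lemma stein0 x : stein V (fun _ => 0) x = 0.
Proof.
have /stein_sqr_le := product_ball0.
rewrite steinE big1 // => j _.
rewrite /stein1 (_ : component _ _ = cst 0); last by apply/funext => y; rewrite /component mxE.
by rewrite derive_cst mulr0 addr0.
Qed.

(** The ball is symmetric, so one-sided bounds over it are two-sided; used to bound the mean-field
    average through [- phi]. *)
Lemma product_ballN phi : product_ball H ip phi ->
  product_ball H ip (fun x => - phi x).
Proof.
move=> [Hphi ball].
have cE j : component (fun x => - phi x) j = (fun x => -1 * component phi j x + 0).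
  by apply/funext => x; rewrite /component mxE addr0 mulN1r.
have Hn j := rkhs_lin hH (-1) (Hphi j) (rkhs0 hH).
split=> [j|]; first by rewrite cE.
rewrite (eq_bigr (fun j => ip (component phi j) (component phi j)))// => j _.
rewrite cE (rkhs_ip_lin hH _ (Hphi j) (rkhs0 hH) (Hn j)) (ip0 hH (Hn j)) addr0.
rewrite (rkhs_ipC hH (Hphi j) (Hn j)).
rewrite (rkhs_ip_lin hH _ (Hphi j) (rkhs0 hH) (Hphi j)) (ip0 hH (Hphi j)) addr0.
by rewrite mulrA mulrNN !mul1r.
Qed.

Lemma steinN phi x : product_ball H ip phi ->
  stein V (fun x => - phi x) x = - stein V phi x.
Proof.
move=> [Hphi _]; rewrite !steinE -sumrN; apply: eq_bigr => j _; rewrite /stein1.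
rewrite (_ : component _ _ = - component phi j); last first.
  by apply/funext => y; rewrite /component mxE.
by rewrite deriveN ?opprD ?mulrN//; exact: (rkhs_derivable hH hk).
Qed.

End stein_class.

(** * The SVGD velocity field *)

Section kernel_regularity.
Context {R : realType} {d : nat}.
Local Notation E := 'rV[R]_d.
Local Notation e j := (delta_mx 0 j : E).

Lemma ler_sum_term (I : finType) (B : I -> R) i : (forall i, 0 <= B i) ->
  B i <= \sum_i B i.
Proof. by move=> B0; rewrite (bigD1 i)//= lerDl sumr_ge0. Qed.

(** Since [Q] is monotone in the bound, the sum of the individual bounds serves every index, an
    empty index type included. *)
Lemma fin_uniform (I : finType) (Q : I -> R -> Prop) :
  (forall i a b, a <= b -> Q i a -> Q i b) ->
  (forall i, exists2 B, 0 <= B & Q i B) -> exists2 B, 0 <= B & forall i, Q i B.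
Proof.
move=> Qm QB.
have [B hB] : {B : I -> R & forall i, 0 <= B i /\ Q i (B i)}.
  by apply: (@choice _ _ (fun i b => 0 <= b /\ Q i b)) => i; have [b] := QB i; exists b.
exists (\sum_i B i) => [|i]; first by apply: sumr_ge0 => i _; case: (hB i).
by apply: Qm (hB i).2; apply: ler_sum_term => l; case: (hB l).
Qed.

Lemma derive_sum_dir (W : normedModType R) (f : W -> R) (I : Type) (r : seq I)
    (c : I -> R) (v : I -> W) x : differentiable f x ->
  'D_(\sum_(i <- r) c i *: v i) f x = \sum_(i <- r) c i * 'D_(v i) f x.
Proof.
move=> df; rewrite deriveE// linear_sum; apply: eq_bigr => i _.
by rewrite linearZ/= deriveE.
Qed.

Lemma sum_pairl (I : Type) (r : seq I) (c : I -> R) (v : I -> E) :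
  \sum_(i <- r) c i *: ((v i, 0) : E * E) = (\sum_(i <- r) c i *: v i, 0).
Proof.
elim: r => [|i r IH]; rewrite ?big_nil// !big_cons IH.
by congr pair; rewrite /= scaler0 addr0.
Qed.

Lemma sum_pairr (I : Type) (r : seq I) (c : I -> R) (v : I -> E) :
  \sum_(i <- r) c i *: ((0, v i) : E * E) = (0, \sum_(i <- r) c i *: v i).
Proof.
elim: r => [|i r IH]; rewrite ?big_nil// !big_cons IH.
by congr pair; rewrite /= scaler0 addr0.
Qed.

Lemma Cnb_lipschitz n (f : E * E -> R) : Cnb n.+1 f -> exists2 L : R, 0 <= L &
  forall x y x' y' (r : R), `|x - x'| <= r -> `|y - y'| <= r ->
    `|f (x, y) - f (x', y')| <= L * r.
Proof.
move=> cf.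
pose v (p : bool * 'I_d) : E * E := if p.1 then (e p.2, 0) else (0, e p.2).
have [B B0 fB] : exists2 B, 0 <= B & forall p z, `|'D_(v p) f z| <= B.
  apply: (fin_uniform (Q := fun p B => forall z, `|'D_(v p) f z| <= B)).
    by move=> p a b ab h z; exact: le_trans (h z) ab.
  by move=> p; exact: (Cnb_bounded (Cnb_derive (v p) cf)).
exists (\sum_(p : bool * 'I_d) B) => [|x y x' y' r xr yr]; first exact: sumr_ge0.
have r0 : 0 <= r by exact: le_trans xr.
have [c _] := @mean_value_path R _ f (x', y') ((x, y) - (x', y')) (fun z => Cnb_derivable cf (v:=_)).
rewrite [(x', y') + (_ - _)]addrC subrK => ->.
pose w (p : bool * 'I_d) := if p.1 then (x - x') 0 p.2 else (y - y') 0 p.2.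
have -> : (x, y) - (x', y') = (x - x', y - y') by [].
have -> : (x - x', y - y') = \sum_(p : bool * 'I_d) w p *: v p.
  rewrite -(pair_bigA _ (fun b i => w (b, i) *: v (b, i)))/= big_bool /w /v/=.
  rewrite sum_pairl sum_pairr -!row_sum_delta.
  by congr pair; rewrite /= ?addr0 ?add0r.
rewrite derive_sum_dir; last exact: Cnb_diff cf _.
rewrite mulr_suml; apply: (le_trans (ler_norm_sum _ _ _)); apply: ler_sum => p _.
rewrite normrM mulrC; apply: ler_pM => //; rewrite /w; case: p.1.
  by apply: le_trans xr; exact: ler_mx_entry.
by apply: le_trans yr; exact: ler_mx_entry.
Qed.

Lemma ler_norm_enorm m n (A : 'M[R]_(m, n)) i j : `|A i j| <= enorm A.
Proof.
rewrite -ler_sqr ?nnegrE ?sqrtr_ge0// sqr_sqrtr; last first.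
  by apply: sumr_ge0 => k _; apply: sumr_ge0 => l _; exact: sqr_ge0.
rewrite real_normK ?num_real//.
apply: le_trans (ler_sum_term i _); last first.
  by move=> k; apply: sumr_ge0 => l _; exact: sqr_ge0.
by apply: (ler_sum_term (B := fun j => A i j ^+ 2)) => l; exact: sqr_ge0.
Qed.

Lemma enormE (x : E) : enorm x ^+ 2 = \sum_j x 0 j ^+ 2.
Proof.
rewrite sqr_sqrtr ?big_ord1//.
by apply: sumr_ge0 => l _; exact: sqr_ge0.
Qed.

Lemma enorm_ge0 m n (A : 'M[R]_(m, n)) : 0 <= enorm A.
Proof. exact: sqrtr_ge0. Qed.

Lemma enorm_le (x : E) : enorm x <= d.+1%:R * `|x|.
Proof.
rewrite -ler_sqr ?nnegrE ?enorm_ge0 ?mulr_ge0// enormE exprMn.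
apply: (@le_trans _ _ (d%:R * `|x| ^+ 2)).
  have -> : d%:R * `|x| ^+ 2 = \sum_(j < d) `|x| ^+ 2.
    by rewrite sumr_const card_ord mulr_natl.
  apply: ler_sum => j _; rewrite -real_normK ?num_real// ler_sqr ?nnegrE//; exact: ler_mx_entry.
rewrite ler_wpM2r ?sqr_ge0// -natrX ler_nat expnS expn1.
by rewrite (leq_trans (leqnSn d))// leq_pmulr.
Qed.

Lemma norm_le_enorm (x : E) : `|x| <= enorm x.
Proof. by apply/mx_norm_le; [exact: enorm_ge0|move=> i j; exact: ler_norm_enorm]. Qed.

End kernel_regularity.

Section target_regularity.
Context {R : realType} {d : nat}.
Local Notation E := 'rV[R]_d.
Variables (V : E -> R) (pi : probability E R).
Hypothesis hV : target_assumption V pi.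

Lemma target_continuous : continuous V.
Proof. exact: (target_smooth hV 0). Qed.

Lemma partial_differentiable j x : differentiable (partial j V) x.
Proof. by case: (target_smooth hV 2) => _ /(_ (delta_mx 0 j))[]. Qed.

Lemma partial_continuous j : continuous (partial j V).
Proof. by move=> x; exact: differentiable_continuous (partial_differentiable j x). Qed.

Lemma partial2_continuous i j : continuous (partial i (partial j V)).
Proof.
by case: (target_smooth hV 2) => _ /(_ (delta_mx 0 j))[_]; exact.
Qed.

Lemma partial_lipschitz : exists2 L : R, 0 <= L &
  forall j (x y : E), `|partial j V x - partial j V y| <= L * `|x - y|.
Proof.
have [L hL] := score_lipschitz hV.
exists (`|L| * d.+1%:R) => [|j x y]; first by rewrite mulr_ge0.
have := ler_norm_enorm (grad V x - grad V y) 0 j; rewrite !mxE => /le_trans; apply.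
apply: (le_trans (hL x y)); apply: (@le_trans _ _ (`|L| * enorm (x - y))).
  by rewrite ler_wpM2r ?enorm_ge0 ?ler_norm.
by rewrite -mulrA ler_wpM2l ?enorm_le.
Qed.

Lemma partial_growth : exists2 L : R, 0 <= L &
  forall j (x : E), `|partial j V x| <= L * (1 + `|x|).
Proof.
have [L L0 hL] := partial_lipschitz.
exists (L + \sum_j `|partial j V 0|) => [|j x].
  by rewrite addr_ge0// sumr_ge0.
have := hL j x 0; rewrite subr0 => h.
have h0 : `|partial j V 0| <= \sum_j `|partial j V 0|.
  exact: (ler_sum_term (B := fun j => `|partial j V 0|)).
rewrite -[partial j V x](subrK (partial j V 0)).
apply: (le_trans (ler_normD _ _)); apply: (le_trans (lerD h h0)).
set S := \sum_j _ in h0 *; have S0 : 0 <= S by exact: le_trans h0.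
have := normr_ge0 x; move: `|x| => t t0; nra.
Qed.

End target_regularity.

Lemma bounded_on_ball {R : realType} {d} (f : 'rV[R]_d -> R) (r : R) :
  continuous f -> exists2 B : R, 0 <= B & forall x : 'rV[R]_d, `|x| <= r -> `|f x| <= B.
Proof.
move=> cf.
have cA : compact [set x : 'rV[R]_d | `|x| <= r].
  apply: bounded_closed_compact.
    by exists r; split => [|M rM x /= xr]; rewrite ?num_real// (le_trans xr)// ltW.
  apply: (@preimage_closed _ _ (fun x : 'rV[R]_d => `|x|) [set t | t <= r]); last exact: closed_le.
  by move=> x _; exact: norm_continuous.
have [[x0 x0r]|/forallNP A0] := pselect (exists x : 'rV[R]_d, `|x| <= r); last first.
  by exists 0 => // x xr; case: (A0 x).
have cn : continuous (fun x => `|f x|).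
  by move=> x; apply: continuous_comp; [exact: cf|exact: norm_continuous].
have A0 : [set x : 'rV[R]_d | `|x| <= r] !=set0 by exists x0.
have [c _ hc] := EVT_max_rV A0 cA (continuous_subspaceT cn).
by exists `|f c| => // x xr; apply: hc; rewrite inE.
Qed.

Lemma average_cst {R : realType} (N : nat) (c : R) : 0 <= c ->
  N%:R^-1 * (\sum_(l < N) c) <= c.
Proof.
move=> c0; rewrite sumr_const card_ord -[c *+ N]mulr_natl mulrA.
have [->|N0] := eqVneq N 0%N; first by rewrite mulr0 mul0r.
by rewrite mulVf ?mul1r// pnatr_eq0.
Qed.

Lemma affine_dist {R : realType} (k1 k2 g1 g2 a1 a2 B C u v w : R) :
  `|k2| <= B -> `|g1| <= C -> `|k1 - k2| <= u -> `|g1 - g2| <= v -> `|a1 - a2| <= w ->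
  `|- k1 * g1 + a1 - (- k2 * g2 + a2)| <= u * C + B * v + w.
Proof.
move=> h1 h2 h3 h4 h5.
have -> : - k1 * g1 + a1 - (- k2 * g2 + a2) = - ((k1 - k2) * g1) + - (k2 * (g1 - g2)) + (a1 - a2).
  by ring.
apply: (le_trans (ler_normD _ _)); apply: lerD => //.
apply: (le_trans (ler_normD _ _)); rewrite !normrN !normrM.
by apply: lerD; apply: ler_pM.
Qed.

Section svgd_field.
Context {R : realType} {N d : nat}.
Local Notation M := 'M[R]_(N, d).
Local Notation E := 'rV[R]_d.
Local Notation I := ('I_N * 'I_d)%type.
Local Notation e j := (delta_mx 0 j : E).
Variables (V : E -> R) (k : E -> E -> R) (pi : probability E R).
Hypotheses (hV : target_assumption V pi) (hk : Cnb 4 (fun z : E * E => k z.1 z.2)).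
Local Notation K := (fun z : E * E => k z.1 z.2).
Local Notation G j := (partial j V).

Definition ker22 (j : 'I_d) (x y : E) : R :=
  'D_((0, e j) : E * E) ('D_((0, e j) : E * E) K) (x, y).

Definition svgd_term (j : 'I_d) (x y : E) : R := - k x y * G j y + ker2 k j x y.

Definition svgd_field (c : I) (x : M) : R :=
  N%:R^-1 * \sum_l svgd_term c.2 (row c.1 x) (row l x).

Definition svgd_term_div1 (j : 'I_d) (x y : E) : R :=
  - ker1 k j x y * G j y + ker12 k j x y.

Definition svgd_term_div2 (j : 'I_d) (x : E) : R :=
  - ker2 k j x x * G j x - k x x * partial j (G j) x + ker22 j x x.

(** The derivative of [svgd_field c] in its own coordinate. Particle [c.1] is the first argument of
    every term, and also the second one in its self-interaction, whence the single extra term. *)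
Definition svgd_div (c : I) (x : M) : R :=
  N%:R^-1 * (\sum_l svgd_term_div1 c.2 (row c.1 x) (row l x)
    + svgd_term_div2 c.2 (row c.1 x)).

Lemma ker_bounds : exists2 B : R, 0 <= B & forall j x y,
  [/\ `|k x y| <= B, `|ker1 k j x y| <= B, `|ker2 k j x y| <= B,
   `|ker12 k j x y| <= B & `|ker22 j x y| <= B].
Proof.
have [B0 B00 h0] := Cnb_bounded hk.
apply: (fin_uniform (Q := fun j B => forall x y, [/\ `|k x y| <= B, `|ker1 k j x y| <= B,
  `|ker2 k j x y| <= B, `|ker12 k j x y| <= B & `|ker22 j x y| <= B])).
  move=> j a b ab h x y; case: (h x y) => h1 h2 h3 h4 h5.
  by split; [exact: le_trans h1 ab|exact: le_trans h2 ab|exact: le_trans h3 ab|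
    exact: le_trans h4 ab|exact: le_trans h5 ab].
move=> j.
have [B1 B10 h1] := Cnb_bounded (Cnb_derive ((e j, 0) : E * E) hk).
have hk2 := Cnb_derive ((0, e j) : E * E) hk.
have [B2 B20 h2] := Cnb_bounded hk2.
have [B3 B30 h3] := Cnb_bounded (Cnb_derive ((e j, 0) : E * E) hk2).
have [B4 B40 h4] := Cnb_bounded (Cnb_derive ((0, e j) : E * E) hk2).
have [b0 b1 b2 b3 b4] : let B := B0 + B1 + B2 + B3 + B4 in
  [/\ B0 <= B, B1 <= B, B2 <= B, B3 <= B & B4 <= B] by split; lra.
exists (B0 + B1 + B2 + B3 + B4); first by rewrite !addr_ge0.
move=> x y; split; [exact: le_trans (h0 (x, y)) b0|exact: le_trans (h1 (x, y)) b1|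
  exact: le_trans (h2 (x, y)) b2|exact: le_trans (h3 (x, y)) b3|exact: le_trans (h4 (x, y)) b4].
Qed.

Lemma svgd_term_growth : exists2 B : R, 0 <= B & forall j x y,
  `|svgd_term j x y| <= B * (1 + `|y|).
Proof.
have [B B0 hB] := ker_bounds; have [L L0 hL] := partial_growth hV.
exists (B * L + B) => [|j x y]; first by rewrite addr_ge0// mulr_ge0.
have [h1 _ h2 _ _] := hB j x y; have := hL j y => h3.
apply: (le_trans (ler_normD _ _)); rewrite mulrDl lerD//.
  by rewrite mulNr normrN normrM -mulrA ler_pM.
by apply: (le_trans h2); rewrite ler_peMr// lerDl.
Qed.

Lemma svgd_field_growth : exists2 B : R, 0 <= B & forall c x,
  `|svgd_field c x| <= B * (N%:R^-1 * \sum_l (1 + `|row l x|)).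
Proof.
have [B B0 hB] := svgd_term_growth; exists B => // c x.
rewrite /svgd_field normrM ger0_norm ?invr_ge0// mulrCA ler_wpM2l ?invr_ge0//.
rewrite mulr_sumr; apply: (le_trans (ler_norm_sum _ _ _)).
by apply: ler_sum => l _; exact: hB.
Qed.

Lemma svgd_field_linear_growth : exists2 B : R, 0 <= B & forall c x,
  `|svgd_field c x| <= B * (1 + `|x|).
Proof.
have [B B0 hB] := svgd_field_growth; exists B => // c x.
apply: (le_trans (hB c x)); rewrite ler_wpM2l//.
apply: (@le_trans _ _ (N%:R^-1 * \sum_(l < N) (1 + `|x|))).
  by rewrite ler_wpM2l ?invr_ge0//; apply: ler_sum => l _; rewrite lerD2l row_norm_le.
by rewrite average_cst// addr_ge0.
Qed.

(** Only locally Lipschitz: the Lipschitz kernel is multiplied by a score of linear growth. *)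
Lemma svgd_field_lipschitz (r : R) : exists2 L : R, 0 <= L &
  forall c x y, `|x| <= r -> `|y| <= r ->
    `|svgd_field c x - svgd_field c y| <= L * `|x - y|.
Proof.
have [B B0 hB] := ker_bounds; have [L L0 hL] := partial_growth hV.
have [LG LG0 hLG] := partial_lipschitz hV.
have [Lk Lk0 hLk] := Cnb_lipschitz hk.
have [L2 L20 hL2] : exists2 L, 0 <= L & forall (j : 'I_d) x y x' y' (r : R), `|x - x'| <= r -> `|y - y'| <= r ->
    `|ker2 k j x y - ker2 k j x' y'| <= L * r.
  apply: (fin_uniform (Q := fun j L => forall x y x' y' (r : R), `|x - x'| <= r -> `|y - y'| <= r ->
    `|ker2 k j x y - ker2 k j x' y'| <= L * r)).
    move=> j a b ab h x y x' y' s xs ys; apply: (le_trans (h _ _ _ _ _ xs ys)).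
    by rewrite ler_wpM2r// (le_trans _ xs).
  by move=> j; exact: (Cnb_lipschitz (Cnb_derive ((0, e j) : E * E) hk)).
exists (Lk * (L * (1 + `|r|)) + B * LG + L2) => [|c x y xr yr].
  by rewrite !addr_ge0// !mulr_ge0// addr_ge0.
rewrite /svgd_field -mulrBr normrM ger0_norm ?invr_ge0// -sumrB.
have rowB (l : 'I_N) : `|row l x - row l y| <= `|x - y|.
  by rewrite -linearB; exact: row_norm_le.
apply: (@le_trans _ _ (N%:R^-1 * \sum_(l < N) ((Lk * (L * (1 + `|r|)) + B * LG + L2) * `|x - y|))).
  rewrite ler_wpM2l ?invr_ge0//; apply: (le_trans (ler_norm_sum _ _ _)).
  apply: ler_sum => l _; rewrite /svgd_term.
  have [h1 _ _ _ _] := hB c.2 (row c.1 y) (row l y).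
  have h2 := hL c.2 (row l x); have h3 := hLG c.2 (row l x) (row l y).
  have h4 := hLk _ _ _ _ _ (rowB c.1) (rowB l).
  have h5 := hL2 c.2 _ _ _ _ _ (rowB c.1) (rowB l).
  have h6 : `|row l x| <= `|r|.
    by apply: (le_trans (row_norm_le x l)); apply: (le_trans xr); exact: ler_norm.
  have h7 : `|G c.2 (row l x)| <= L * (1 + `|r|).
    by apply: (le_trans h2); rewrite ler_wpM2l// lerD2l.
  have h8 : `|G c.2 (row l x) - G c.2 (row l y)| <= LG * `|x - y|.
    by apply: (le_trans h3); rewrite ler_wpM2l.
  apply: (le_trans (affine_dist h1 h7 h4 h8 h5)).
  by rewrite le_eqVlt; apply/predU1P; left; ring.
by rewrite average_cst// !mulr_ge0// !addr_ge0// !mulr_ge0// addr_ge0.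
Qed.

End svgd_field.

Section empirical_integral.
Context {R : realType} {N d : nat}.
Local Notation M := 'M[R]_(N, d).
Local Notation E := 'rV[R]_d.

Lemma ge0_integral_empirical (X : M) (f : E -> R) : measurable_fun setT f ->
  (forall x, 0 <= f x) ->
  (\int[empirical X]_x (f x)%:E)%E = (N%:R^-1 * \sum_l f (row l X))%:E.
Proof.
move=> mf f0; have Ni : 0 <= N%:R^-1 :> R by rewrite invr_ge0.
pose m_ (i : nat) : {measure set E -> \bar R} :=
  if insub i is Some l then \d_(row (l : 'I_N) X) else \d_(0 : E).
rewrite (@eq_measure_integral _ _ _ setT (mscale (NngNum Ni) (msum m_ N))); last first.
  move=> A mA _; rewrite /empirical /mscale /msum/=; congr (_ * _)%E.
  by apply: eq_bigr => i _; rewrite /m_ valK.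
have mf' : measurable_fun setT (fun x => (f x)%:E) by exact/measurable_EFinP.
have f0' x : setT x -> (0 <= (f x)%:E)%E by move=> _; rewrite lee_fin.
have e1 := ge0_integral_mscale (msum m_ N) measurableT (NngNum Ni) mf' f0'.
have e2 := ge0_integral_measure_sum m_ measurableT f0' mf' N.
rewrite e1 e2 /= (eq_bigr (fun i => (f (row i X))%:E)) ?sumEFin// => i _.
by rewrite /m_ valK integral_dirac// diracT mul1e.
Qed.

Lemma integral_empirical (X : M) (f : E -> R) : measurable_fun setT f ->
  (\int[empirical X]_x (f x)%:E)%E = (N%:R^-1 * \sum_l f (row l X))%:E.
Proof.
move=> mf; rewrite integralE (funerpos f) (funerneg f).
rewrite ge0_integral_empirical//; last exact: measurable_funrpos.
rewrite ge0_integral_empirical//; last exact: measurable_funrneg.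
rewrite -EFinB -mulrBr -sumrB; congr (_ * _)%:E; apply: eq_bigr => l _.
by rewrite -[in RHS](funrposBneg f).
Qed.

End empirical_integral.

Lemma is_derive_along {R : realType} (U : normedModType R) (f : U -> R) (g : R -> U) (t : R) (v : U) :
  differentiable f (g t) -> is_derive t (1 : R) g v ->
  is_derive t (1 : R) (f \o g) ('D_v f (g t)).
Proof.
move=> df [dg gv].
have dg' : differentiable g t by apply/derivable1_diffP.
have dfg : differentiable (f \o g) t by exact: differentiable_comp.
apply: DeriveDef; first by apply/derivable1_diffP.
rewrite deriveE// diff_comp//= [in RHS]deriveE//; congr ('d f (g t) _).
by rewrite -gv deriveE.
Qed.

Lemma is_derive_fsum {R : realType} (I : Type) (r : seq I) (h : I -> R -> R) (dh : I -> R) (t : R) :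
  (forall i, is_derive t (1 : R) (h i) (dh i)) ->
  is_derive t (1 : R) (fun s => \sum_(i <- r) h i s) (\sum_(i <- r) dh i).
Proof.
move=> dhi; elim: r => [|i r IH].
  rewrite big_nil; under eq_fun do rewrite big_nil; exact: is_derive_cst.
rewrite big_cons; under eq_fun do rewrite big_cons.
exact: is_deriveD.
Qed.

Lemma is_derive_affine {R : realType} (f g h : R -> R) (s df dg dh : R) :
  is_derive s (1 : R) f df -> is_derive s (1 : R) g dg -> is_derive s (1 : R) h dh ->
  is_derive s (1 : R) (fun s => - f s * g s + h s) (- df * g s - f s * dg + dh).
Proof.
move=> Df Dg Dh.
apply: (is_derive_eq (is_deriveD (is_deriveM (is_deriveN Df) Dg) Dh)).
rewrite /GRing.scale/= (_ : (- f) s = - f s)//.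
by ring.
Qed.

Lemma derive_coord {R : realType} {d} (v x : 'rV[R]_d) j :
  'D_v (fun y : 'rV[R]_d => y 0 j) x = v 0 j.
Proof.
rewrite /derive; apply/cvg_lim => //; apply: cvg_near_cst.
have n0 : (0 : R)^' [set t | t != 0] := @nbhs_dnbhs_neq R 0.
apply: filterS n0 => h h0.
by rewrite /= /shift/= !mxE addrK /GRing.scale/= mulrA mulVf ?mul1r.
Qed.

Section svgd_divergence.
Context {R : realType} {N d : nat}.
Local Notation M := 'M[R]_(N, d).
Local Notation E := 'rV[R]_d.
Local Notation I := ('I_N * 'I_d)%type.
Local Notation e j := (delta_mx 0 j : E).
Variables (V : E -> R) (k : E -> E -> R) (pi : probability E R).
Hypotheses (hV : target_assumption V pi) (hk : Cnb 4 (fun z : E * E => k z.1 z.2)).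
Local Notation K := (fun z : E * E => k z.1 z.2).
Local Notation G j := (partial j V).
Local Notation F := (@svgd_field R N d V k).
Local Notation D := (@svgd_div R N d V k).

Lemma ker1_continuous j : continuous (fun z : E * E => ker1 k j z.1 z.2).
Proof.
rewrite (_ : (fun _ => _) = 'D_((e j, 0) : E * E) K); last by apply/funext => -[].
exact: Cnb_continuous (Cnb_derive _ hk).
Qed.

Lemma ker2_continuous j : continuous (fun z : E * E => ker2 k j z.1 z.2).
Proof.
rewrite (_ : (fun _ => _) = 'D_((0, e j) : E * E) K); last by apply/funext => -[].
exact: Cnb_continuous (Cnb_derive _ hk).
Qed.

Lemma ker22_continuous j : continuous (fun z : E * E => ker22 k j z.1 z.2).
Proof.
rewrite (_ : (fun _ => _) = 'D_((0, e j) : E * E) ('D_((0, e j) : E * E) K)).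
  exact: Cnb_continuous (Cnb_derive _ (Cnb_derive _ hk)).
by apply/funext => -[].
Qed.

Lemma continuous_snd_partial j : continuous (fun z : E * E => G j z.2).
Proof.
by move=> z; apply: (@cvg_comp _ _ _ snd (G j)); [exact: cvg_snd|exact: partial_continuous hV j _].
Qed.

Lemma svgd_term_continuous j : continuous (fun z : E * E => svgd_term V k j z.1 z.2).
Proof.
apply: contD; last exact: ker2_continuous.
apply: contM; last exact: continuous_snd_partial.
exact: contN (Cnb_continuous hk).
Qed.

Lemma svgd_term_div1_continuous j :
  continuous (fun z : E * E => svgd_term_div1 V k j z.1 z.2).
Proof.
apply: contD; last exact: ker12_continuous.
apply: contM; last exact: continuous_snd_partial.
exact: contN (@ker1_continuous j).
Qed.

Lemma svgd_term_div2_continuous j : continuous (svgd_term_div2 V k j).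
Proof.
have ci : continuous (@id E) by move=> z; exact: cvg_id.
have cd := cont_pair ci ci.
apply: contD; last exact: (cont_comp cd (@ker22_continuous j)).
apply: contB.
  apply: contM; last exact: partial_continuous hV j.
  exact: contN (cont_comp cd (@ker2_continuous j)).
apply: contM; last exact: (partial2_continuous hV).
exact: cont_comp cd (Cnb_continuous hk).
Qed.

Lemma continuous_rows (i l : 'I_N) : continuous (fun x : M => (row i x, row l x)).
Proof. by apply: cont_pair; exact: continuous_row. Qed.

Lemma svgd_field_continuous c : continuous (F c).
Proof.
apply: contM; first exact: contC.
by apply: cont_sum => l; exact: (cont_comp (@continuous_rows c.1 l) (@svgd_term_continuous c.2)).
Qed.

Lemma svgd_div_continuous c : continuous (D c).
Proof.
apply: contM; first exact: contC.
apply: contD; last first.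
  by apply: cont_comp; [exact: continuous_row|exact: svgd_term_div2_continuous].
by apply: cont_sum => l; exact: (cont_comp (@continuous_rows c.1 l) (@svgd_term_div1_continuous c.2)).
Qed.

Lemma svgd_div_bounded (r : R) : exists B : R, forall c x, `|x| <= r -> `|D c x| <= B.
Proof.
have [B B0 hB] := ker_bounds hk; have [L L0 hL] := partial_growth hV.
have [B2 B20 hB2] : exists2 B, 0 <= B & forall j x, `|x| <= r -> `|svgd_term_div2 V k j x| <= B.
  apply: (fin_uniform (Q := fun j B => forall x, `|x| <= r -> `|svgd_term_div2 V k j x| <= B)).
    by move=> j a b ab h x xr; exact: le_trans (h x xr) ab.
  move=> j; exact: bounded_on_ball (@svgd_term_div2_continuous j).
exists (N%:R^-1 * (\sum_(l < N) (B * (L * (1 + `|r|)) + B) + B2)) => c x xr.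
rewrite /svgd_div normrM ger0_norm ?invr_ge0// ler_wpM2l ?invr_ge0//.
apply: (le_trans (ler_normD _ _)); apply: lerD; last first.
  by apply: hB2; apply: le_trans xr; exact: row_norm_le.
apply: (le_trans (ler_norm_sum _ _ _)); apply: ler_sum => l _.
have [_ h1 _ h2 _] := hB c.2 (row c.1 x) (row l x).
have h3 := hL c.2 (row l x).
have h4 : `|row l x| <= `|r|.
  by apply: (le_trans (row_norm_le x l)); apply: (le_trans xr); exact: ler_norm.
apply: (le_trans (ler_normD _ _)); apply: lerD => //.
rewrite normrM normrN; apply: ler_pM => //; apply: (le_trans h3).
by rewrite ler_wpM2l// lerD2l.
Qed.

Lemma row_mset (x : M) (c : I) (s : R) l :
  row l (mset x c.1 c.2 s) =
  if l == c.1 then row c.1 x - x c.1 c.2 *: e c.2 + s *: e c.2 else row l x.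
Proof.
apply/rowP => m; rewrite !mxE; case: (eqVneq l c.1) => [->|lc]/=; last by rewrite mxE.
by rewrite !mxE/=; case: (eqVneq m c.2) => [->|]; rewrite /= ?mulr1 ?mulr0 ?subrr ?subr0 ?add0r ?addr0.
Qed.

Lemma derive_diag (W : E * E -> R) (j : 'I_d) n : Cnb n.+1 W -> forall z,
  'D_((e j, e j) : E * E) W z = 'D_((e j, 0) : E * E) W z + 'D_((0, e j) : E * E) W z.
Proof.
move=> cW z; rewrite -[X in _ = X + _]mul1r -derive_linear; last exact: Cnb_diff cW z.
congr ('D__ W z); rewrite scale1r; congr pair; rewrite /= ?addr0 ?add0r//.
Qed.

Lemma is_derive_fst (W : E * E -> R) (p y : E) (j : 'I_d) (s : R) n : Cnb n.+1 W ->
  is_derive s (1 : R) (fun s => W (p + s *: e j, y))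
    ('D_((e j, 0) : E * E) W (p + s *: e j, y)).
Proof.
move=> cW; rewrite -pairDl.
under eq_fun do rewrite -pairDl.
by apply: is_derive_path; exact: (Cnb_derivable cW).
Qed.

Lemma is_derive_diag (W : E * E -> R) (p : E) (j : 'I_d) (s : R) n : Cnb n.+1 W ->
  is_derive s (1 : R) (fun s => W (p + s *: e j, p + s *: e j))
    ('D_((e j, 0) : E * E) W (p + s *: e j, p + s *: e j) +
     'D_((0, e j) : E * E) W (p + s *: e j, p + s *: e j)).
Proof.
move=> cW; rewrite -(derive_diag _ cW).
have pE (t : R) : (p + t *: e j, p + t *: e j) = (p, p) + t *: ((e j, e j) : E * E) by [].
rewrite pE; under eq_fun do rewrite pE.
by apply: is_derive_path; exact: (Cnb_derivable cW).
Qed.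

Lemma is_derive_svgd_field (c : I) (x : M) (s : R) :
  is_derive s (1 : R) (fun s => F c (mset x c.1 c.2 s)) (D c (mset x c.1 c.2 s)).
Proof.
set j := c.2; set p := row c.1 x - x c.1 c.2 *: e j.
pose q (t : R) := p + t *: e j.
have cK2 := Cnb_derive ((0, e j) : E * E) hk.
pose dT l := (if l == c.1 then svgd_term_div1 V k j (q s) (q s) + svgd_term_div2 V k j (q s)
  else svgd_term_div1 V k j (q s) (row l x)).
have -> : (fun s => F c (mset x c.1 j s)) = (fun s => N%:R^-1 * \sum_l
    svgd_term V k j (q s) (if l == c.1 then q s else row l x)).
  apply/funext => t; rewrite /svgd_field; congr (_ * _); apply: eq_bigr => l _.
  by rewrite !row_mset eqxx.
have -> : D c (mset x c.1 j s) = N%:R^-1 * \sum_l dT l.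
  rewrite /svgd_div; congr (_ * _).
  rewrite [RHS](bigD1 c.1)//= [in LHS](bigD1 c.1)//= /dT eqxx !row_mset eqxx -/p -/j -/(q s).
  rewrite [RHS]addrAC; congr (_ + _ + _); apply: eq_bigr => l lc.
  by rewrite row_mset (negbTE lc).
have dG : is_derive s (1 : R) (fun s => G j (q s)) (partial j (G j) (q s)).
  by apply: is_derive_path; apply: diff_derivable; exact: partial_differentiable hV j _.
rewrite -[X in is_derive _ _ _ X]/(N%:R^-1 *: _); apply: is_deriveZ.
apply: is_derive_fsum => l; rewrite /dT; case: (l == c.1).
  apply: (is_derive_eq (is_derive_affine (is_derive_diag p j s hk) dG
    (is_derive_diag p j s cK2))).
  have alg (a b m n g dg u : R) : - (a + b) * g - u * dg + (m + n) =
      - a * g + m + (- b * g - u * dg + n) by ring.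
  exact: alg.
apply: (is_derive_eq (is_derive_affine (is_derive_fst p (row l x) j s hk)
  (is_derive_cst (G j (row l x)) s 1) (is_derive_fst p (row l x) j s cK2))).
have alg (a m g u : R) : - a * g - u * 0 + m = - a * g + m by ring.
exact: alg.
Qed.

End svgd_divergence.

Section svgd_velocity_field.
Context {R : realType} {N d : nat}.
Local Notation M := 'M[R]_(N, d).
Local Notation E := 'rV[R]_d.
Local Notation I := ('I_N * 'I_d)%type.
Local Notation e j := (delta_mx 0 j : E).
Variables (V : E -> R) (k : E -> E -> R) (pi : probability E R).
Hypotheses (hV : target_assumption V pi) (hk : Cnb 4 (fun z : E * E => k z.1 z.2)).
Local Notation K := (fun z : E * E => k z.1 z.2).
Local Notation G j := (partial j V).
Local Notation F := (@svgd_field R N d V k).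
Local Notation D := (@svgd_div R N d V k).

Lemma derive_section (W : E * E -> R) (x y v : E) :
  'D_v (fun y => W (x, y)) y = 'D_((0, v) : E * E) W (x, y).
Proof.
have sE (h : R) : h *: ((0, v) : E * E) + (x, y) = (x, h *: v + y).
  by rewrite addrC pairDr addrC.
rewrite /derive (_ : (fun h => _) = (fun h : R => h^-1 *: ((W \o shift (x, y))
  (h *: ((0, v) : E * E)) - W (x, y))))//.
by apply/funext => h; rewrite /comp /shift sE.
Qed.

Lemma partial_ker (j : 'I_d) x : partial j (k x) = ker2 k j x.
Proof. by apply/funext => y; exact: (derive_section K). Qed.

Lemma partial2_ker (j : 'I_d) x y : partial j (partial j (k x)) y = ker22 k j x y.
Proof.
rewrite partial_ker; exact: (derive_section ('D_((0, e j) : E * E) K)).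
Qed.

(** Identifies the self-interaction part of the divergence with the function that is assumed bounded
    above. *)
Lemma CstarE (z : E) : Cstar V k z = - \sum_j svgd_term_div2 V k j z.
Proof.
rewrite /Cstar /dot /laplacian mulr_sumr -big_split/= -sumrB -sumrN.
apply: eq_bigr => j _; rewrite !mxE partial2_ker partial_ker.
have alg (a b g u dg : R) : a * g + u * dg - b = - (- a * g - u * dg + b) by ring.
exact: alg.
Qed.

Lemma svgd_velocityE (X : M) (i : 'I_N) (j : 'I_d) :
  svgd_velocity V k (empirical X) (row i X) 0 j = F (i, j) X.
Proof.
rewrite mxE /Rintegral.
rewrite (_ : (fun _ => _) = (fun y => (svgd_term V k j (row i X) y)%:E)); last first.
  by apply/funext => y; rewrite !mxE partial_ker.
rewrite integral_empirical//; apply: continuous_mx_measurable.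
have c1 : continuous (fun _ : E => row i X) := @cst_continuous E E (row i X).
have ci : continuous (@id E) by move=> z; exact: cvg_id.
exact: (cont_comp (cont_pair c1 ci) (svgd_term_continuous hV hk (j := j))).
Qed.

Lemma particle_flow_derive (X : R -> M) (x0 : M) (t : R) (c : I) :
  particle_flow V k X x0 -> 0 < t ->
  is_derive t (1 : R) (fun s => X s c.1 c.2) (F c (X t)).
Proof.
move=> [_ _ dX] t0; have h := dX t c.1 t0.
have dc := differentiable_coord (row c.1 (X t)) 0 c.2.
have := is_derive_along (dc : differentiable (fun y : E => y 0 c.2) _) h.
rewrite derive_coord svgd_velocityE -surjective_pairing.
rewrite (_ : _ \o _ = (fun s => X s c.1 c.2))//.
by apply/funext => s; rewrite /= mxE.
Qed.

(** Formally the squared KSD from the empirical measure of the rows to [pi]. *)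
Definition stein_mean (x : M) : R :=
  N%:R^-1 * (N%:R^-1 * \sum_i \sum_l stein_ker V k (row i x) (row l x)).

Lemma stein_mean_continuous : continuous stein_mean.
Proof.
apply: contM; first exact: contC.
apply: contM; first exact: contC.
apply: cont_sum => i; apply: cont_sum => l.
exact: (cont_comp (continuous_rows (i := i) (l := l))
  (stein_ker_continuous hk (partial_continuous hV))).
Qed.

(** The entropy production of the flow: divergence minus the drift against the gradient of the
    potential. Pairs of particles assemble into the Stein kernel, and self-interaction leaves
    [Cstar]. *)
Lemma svgd_production (x : M) :
  \sum_(c : I) (D c x - G c.2 (row c.1 x) * F c x) =
  N%:R * stein_mean x - N%:R^-1 * \sum_i Cstar V k (row i x).
Proof.
(* For [N = 0] both sides vanish, the inverse of 0 being 0. *)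
have [N0|N0] := eqVneq (N%:R : R) 0.
  by rewrite N0 invr0 !mul0r subr0 big1// => c _; rewrite /svgd_div /svgd_field N0 invr0 !mul0r mulr0 subr0.
rewrite /stein_mean mulVKf// -mulrBr.
rewrite -(pair_bigA _ (fun i j => D (i, j) x - G j (row i x) * F (i, j) x))/=.
transitivity (N%:R^-1 * \sum_i \sum_j ((\sum_l svgd_term_div1 V k j (row i x) (row l x)
    + svgd_term_div2 V k j (row i x)) - G j (row i x) * \sum_l svgd_term V k j (row i x) (row l x))).
  rewrite mulr_sumr; apply: eq_bigr => i _; rewrite mulr_sumr; apply: eq_bigr => j _.
  have alg (n a b g c : R) : n * (a + b) - g * (n * c) = n * (a + b - g * c) by ring.
  exact: alg.
congr (_ * _); rewrite -sumrB; apply: eq_bigr => i _.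
rewrite CstarE opprK exchange_big/= -big_split/=; apply: eq_bigr => j _.
rewrite addrAC; congr (_ + _); rewrite mulr_sumr -sumrB; apply: eq_bigr => l _.
have alg (b1 b2 u a1 a2 a12 : R) :
    - a1 * b2 + a12 - b1 * (- u * b2 + a2) = b1 * b2 * u - b1 * a2 - b2 * a1 + a12 by ring.
exact: alg.
Qed.

End svgd_velocity_field.

(** * Energy balance and moment growth along the particle flow *)

Lemma derive_ge0_le {R : realType} (h dh : R -> R) (T : R) : 0 < T ->
  (forall t : R, 0 < t -> is_derive t (1 : R) h (dh t)) ->
  (forall t : R, 0 < t -> 0 <= dh t) ->
  {within `[0, T], continuous h} -> h 0 <= h T.
Proof.
move=> T0 hd dh0 hc.
have [t|t] := MVT T0 _ hc (df := dh); first by rewrite in_itv/= => /andP[t0 _]; exact: hd.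
rewrite in_itv/= => /andP[t0 _] e; rewrite -subr_ge0 e subr0 mulr_ge0//; last exact: ltW.
exact: dh0.
Qed.

Lemma continuous_Xext {R : realType} {N d} (X : R -> 'M[R]_(N, d)) (g : 'M[R]_(N, d) -> R) (T : R) :
  {within [set t | 0 <= t], continuous X} -> continuous g ->
  {within `[0, T], continuous (g \o X)}.
Proof.
move=> cX cg.
have cgX : continuous (g \o Xext X) by exact: (cont_comp (Xext_continuous cX) cg).
apply: (subspace_eq_continuous _ (continuous_subspaceT cgX)) => t.
by rewrite inE /= in_itv/= => /andP[t0 _]; congr (g _); exact: XextE.
Qed.

Lemma sum_affine {R : realType} N (u b : R) (w : 'I_N -> R) :
  \sum_l (u + b * (1 + w l)) = N%:R * u + b * (N%:R + \sum_l w l).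
Proof.
rewrite big_split/= -mulr_sumr big_split/= !sumr_const card_ord.
by rewrite -[u *+ N]mulr_natl.
Qed.

(** Young's inequality in the form [2 * y * (1 + v) <= y ^+ 2 + 2 * (1 + v ^+ 2)]: the difference of
    the sides is a sum of squares. *)
Lemma cross_term_le {R : realType} (B u v w z : R) : 0 <= B -> 0 <= v -> v ^+ 2 <= w ->
  `|u| <= B * (1 + v) -> 2 * (z * u) <= B * z ^+ 2 + 2 * B * (1 + w).
Proof.
move=> B0 v0 vw uB.
apply: (@le_trans _ _ (2 * (`|z| * (B * (1 + v))))).
  rewrite ler_wpM2l//; apply: (le_trans (ler_norm _)); rewrite normrM.
  by rewrite ler_wpM2l.
rewrite -[z ^+ 2]real_normK ?num_real//; move: `|z| => y.
rewrite (_ : 2 * (y * (B * (1 + v))) = B * (2 * y * (1 + v))); last by ring.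
rewrite (_ : B * y ^+ 2 + _ = B * (y ^+ 2 + 2 * (1 + w))); last by ring.
rewrite ler_wpM2l// -subr_ge0.
rewrite (_ : _ - _ = (y - (1 + v)) ^+ 2 + (1 - v) ^+ 2 + 2 * (w - v ^+ 2)); last by ring.
by rewrite !addr_ge0 ?sqr_ge0// mulr_ge0// subr_ge0.
Qed.

Section flow_growth.
Context {R : realType} {N d : nat}.
Local Notation M := 'M[R]_(N, d).
Local Notation E := 'rV[R]_d.
Local Notation I := ('I_N * 'I_d)%type.
Variables (V : E -> R) (k : E -> E -> R) (pi : probability E R).
Hypotheses (hV : target_assumption V pi) (hk : Cnb 4 (fun z : E * E => k z.1 z.2)).
Local Notation G j := (partial j V).
Local Notation F := (@svgd_field R N d V k).
Local Notation D := (@svgd_div R N d V k).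
Variables (X : R -> M) (x0 : M).
Hypotheses (N0 : (0 < N)%N) (hX : particle_flow V k X x0).

Let NR0 : (N%:R : R) != 0. Proof. by rewrite pnatr_eq0 -lt0n. Qed.
Let Ni0 : 0 <= (N%:R^-1 : R). Proof. by rewrite invr_ge0. Qed.

Lemma is_derive_total (t : R) : 0 < t ->
  is_derive t (1 : R) (fun s => total V (X s))
    (\sum_(c : I) G c.2 (row c.1 (X t)) * F c (X t)).
Proof.
move=> t0; have [_ _ dX] := hX.
rewrite -(pair_bigA _ (fun i j => G j (row i (X t)) * F (i, j) (X t)))/=.
apply: is_derive_fsum => i.
have dV : differentiable V (row i (X t)) by case: (target_smooth hV 1).
apply: (is_derive_eq (is_derive_along dV (dX t i t0))).
rewrite [svgd_velocity _ _ _ _]row_sum_delta derive_sum_dir//.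
by apply: eq_bigr => j _; rewrite (svgd_velocityE hV hk) mulrC.
Qed.

(** The right side minus the left vanishes at time 0, and by [svgd_production] its derivative is [C]
    minus the mean of [Cstar] over the particles. *)
Lemma action_ge (C T : R) : 0 < T -> 0 <= C -> (forall z, Cstar V k z <= C) ->
  N%:R * prim (stein_mean V k \o Xext X) T <=
  total V (X 0) - total V (X T) + \sum_(c : I) prim (D c \o Xext X) T + C * T.
Proof.
move=> T0 C0 hC; have [_ cX _] := hX.
have cE := Xext_continuous cX.
have cD c : continuous (D c \o Xext X) by exact: (cont_comp cE (svgd_div_continuous hV hk (c := c))).
have cq : continuous (stein_mean V k \o Xext X).
  exact: (cont_comp cE (stein_mean_continuous hV hk)).
pose h t := - total V (X t) + \sum_(c : I) prim (D c \o Xext X) t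
  - N%:R * prim (stein_mean V k \o Xext X) t + C * t.
pose dh t := - (\sum_(c : I) G c.2 (row c.1 (X t)) * F c (X t)) + \sum_(c : I) D c (X t)
  - N%:R * stein_mean V k (X t) + C.
have hd (t : R) : 0 < t -> is_derive t (1 : R) h (dh t).
  move=> t0; apply: is_deriveD; last first.
    by apply: (is_derive_eq (is_deriveZ C (is_derive_id t 1))); rewrite /GRing.scale/= mulr1.
  apply: is_deriveB; last first.
    apply: is_deriveZ; rewrite -(XextE X (ltW t0)); exact: prim_derive cq _ t0.
  apply: is_deriveD; first by apply: is_deriveN; exact: is_derive_total.
  apply: is_derive_fsum => c; rewrite -(XextE X (ltW t0)); exact: prim_derive (cD c) _ t0.
have dh0 (t : R) : 0 < t -> 0 <= dh t.
  move=> _; rewrite /dh [- _ + _]addrC -sumrB svgd_production.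
  have alg (a b c : R) : a - b - a + c = c - b by ring.
  rewrite alg subr_ge0.
  apply: le_trans (average_cst N C0); rewrite ler_wpM2l//; apply: ler_sum => i _; exact: hC.
have hc : {within `[0, T], continuous h}.
  apply: contD; last first.
    by apply: contM; [exact: contC|apply: continuous_subspaceT => z; exact: cvg_id].
  apply: contB; last first.
    by apply: contM; [exact: contC|exact: (prim_continuous cq (ltW T0))].
  apply: contD; last by apply: cont_sum => c; exact: (prim_continuous (cD c) (ltW T0)).
  by apply: contN; exact: (continuous_Xext cX (continuous_total (target_continuous hV))).
have := derive_ge0_le T0 hd dh0 hc.
rewrite /h prim0 big1; last by move=> c _; rewrite prim0.
move: (total V (X 0)) (total V (X T)) (\sum_c _) (N%:R * prim _ T) => a b s u.
by rewrite !mulr0 => hh; lra.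
Qed.

Definition mean_square (x : M) : R := N%:R^-1 * \sum_(c : I) x c.1 c.2 ^+ 2.

Lemma mean_square_ge0 x : 0 <= mean_square x.
Proof. by rewrite mulr_ge0// sumr_ge0// => c _; exact: sqr_ge0. Qed.

Lemma mean_square_continuous : continuous mean_square.
Proof.
apply: contM; first exact: contC.
apply: cont_sum => c.
rewrite (_ : (fun _ => _) = (fun x : M => x c.1 c.2 * x c.1 c.2)).
  by apply: contM; exact: continuous_mx_entry.
by apply/funext => x; rewrite expr2.
Qed.

(** Gronwall for [1 + mean_square]. By [cross_term_le] every coordinate contributes [B] times its
    square and [2 * B] times the whole quantity; averaged over the particles this gives [B] once and
    [2 * B] for each of the [d] directions. *)
Lemma mean_square_growth (B T : R) : 0 <= B ->
  (forall j x y, `|svgd_term V k j x y| <= B * (1 + `|y|)) -> 0 <= T ->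
  1 + mean_square (X T) <= expR (B * (1 + 2 * d%:R) * T) * (1 + mean_square (X 0)).
Proof.
move=> B0 hB; rewrite le_eqVlt => /predU1P[<-|T0].
  by rewrite mulr0 expR0 mul1r.
have [_ cX _] := hX; set K := B * _.
pose dm t := N%:R^-1 * \sum_(c : I) (2 * (X t c.1 c.2 * F c (X t))).
have dms (t : R) : 0 < t -> is_derive t (1 : R) (fun s => mean_square (X s)) (dm t).
  move=> t0; apply: is_deriveZ; apply: is_derive_fsum => c.
  have h := particle_flow_derive hV hk c hX t0.
  rewrite (_ : (fun s => _) = (fun s => X s c.1 c.2) * (fun s => X s c.1 c.2)).
    by apply: (is_derive_eq (is_deriveM h h)); rewrite /GRing.scale/=; ring.
  by apply/funext => s; rewrite expr2.
have dmK (t : R) : dm t <= K * (1 + mean_square (X t)).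
  set x := X t.
  have tb (c : I) : 2 * (x c.1 c.2 * F c x) <= B * x c.1 c.2 ^+ 2 + 2 * B * (1 + mean_square x).
    have e1 : 2 * (x c.1 c.2 * F c x) = N%:R^-1 * \sum_(l < N)
        (2 * (x c.1 c.2 * svgd_term V k c.2 (row c.1 x) (row l x))).
      by rewrite /svgd_field -!mulr_sumr; ring.
    have e2 : B * x c.1 c.2 ^+ 2 + 2 * B * (1 + mean_square x) = N%:R^-1 * \sum_(l < N)
        (B * x c.1 c.2 ^+ 2 + 2 * B * (1 + \sum_j x l j ^+ 2)).
      rewrite sum_affine /mean_square -(pair_bigA _ (fun i j => x i j ^+ 2))/=.
      by field.
    rewrite e1 e2 ler_wpM2l//; apply: ler_sum => l _.
    have r1 : `|row l x| ^+ 2 <= \sum_j x l j ^+ 2.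
      apply: (@le_trans _ _ (enorm (row l x) ^+ 2)).
        by rewrite ler_sqr ?nnegrE ?enorm_ge0// norm_le_enorm.
      by rewrite enormE le_eqVlt; apply/predU1P; left; apply: eq_bigr => j _; rewrite mxE.
    have := hB c.2 (row c.1 x) (row l x).
    move: r1 (normr_ge0 (row l x)); move: (svgd_term _ _ _ _ _) `|row l x| => u v.
    move: (\sum_j _) (x c.1 c.2) => w z hw v0 hu.
    exact: cross_term_le B0 v0 hw hu.
  apply: (@le_trans _ _ (N%:R^-1 * \sum_(c : I) (B * x c.1 c.2 ^+ 2 + 2 * B * (1 + mean_square x)))).
    by rewrite ler_wpM2l//; apply: ler_sum => c _; exact: tb.
  rewrite big_split/= -mulr_sumr mulrDr [N%:R^-1 * (B * _)]mulrCA -/(mean_square x).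
  rewrite sumr_const card_prod !card_ord -[(_ * _) *+ _]mulr_natl natrM.
  have := mean_square_ge0 x; move: (mean_square x) => m m0.
  have -> : N%:R^-1 * (N%:R * d%:R * (2 * B * (1 + m))) = d%:R * (2 * B * (1 + m)) :> R by field.
  rewrite /K -subr_ge0 (_ : _ - _ = B); first by [].
  by ring.
pose h t := - (expR (- K * t) * (1 + mean_square (X t))).
pose dh t := - (expR (- K * t) * dm t - K * expR (- K * t) * (1 + mean_square (X t))).
have hd (t : R) : 0 < t -> is_derive t (1 : R) h (dh t).
  move=> t0; apply: is_deriveN.
  have d1 : is_derive t (1 : R) (fun s => expR (- K * s)) (- K * expR (- K * t)).
    have h1 : is_derive t (1 : R) (fun s => - K * s) (- K).
      by apply: (is_derive_eq (is_deriveZ (- K) (is_derive_id t 1))); rewrite /GRing.scale/= mulr1.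
    by apply: (is_derive_eq (is_derive1_comp (is_derive_expR _) h1)); rewrite mulrC.
  have d2 : is_derive t (1 : R) (fun s => 1 + mean_square (X s)) (dm t).
    by rewrite -[dm t]add0r; apply: is_deriveD; exact: dms.
  apply: (is_derive_eq (is_deriveM d1 d2)); rewrite /GRing.scale/=; ring.
have dh0 (t : R) : 0 < t -> 0 <= dh t.
  move=> _; rewrite /dh oppr_ge0 subr_le0 [K * _]mulrC -mulrA.
  by rewrite ler_wpM2l ?expR_ge0.
have hc : {within `[0, T], continuous h}.
  apply: contN; apply: contM; last first.
    by apply: contD; [exact: contC|exact: (continuous_Xext cX mean_square_continuous)].
  apply: continuous_subspaceT; apply: cont_comp; last exact: continuous_expR.
  by apply: contM; [exact: contC|move=> z; exact: cvg_id].
have := derive_ge0_le T0 hd dh0 hc.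
rewrite /h lerN2 mulr0 expR0 mul1r => hh.
rewrite -ler_pdivrMl ?expR_gt0// -expRN -mulNr; exact: hh.
Qed.

End flow_growth.

Lemma prim_ge0 {R : realType} (f : R -> R) (T : R) : (forall t, 0 <= f t) -> 0 <= prim f T.
Proof. by move=> f0; apply: Rintegral_ge0. Qed.

(** * The entropy estimate for the particle system *)

Section particles.
Context {R : realType} {d : nat}.
Local Notation E := 'rV[R]_d.
Variables (V : E -> R) (k : E -> E -> R) (pi : probability E R).
Variables (H : set (E -> R)) (ip : (E -> R) -> (E -> R) -> R).
Context {dO : measure_display} {Om : measurableType dO} (P : probability Om R).
Variables (x0 : forall N, {RV P >-> 'M[R]_(N, d)}) (X : forall N, Om -> R -> 'M[R]_(N, d)).
Variables (mu0 : probability E R) (beta : R).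
Hypotheses (hV : target_assumption V pi) (hk : Cnb 4 (fun z : E * E => k z.1 z.2))
  (hH : is_rkhs k H ip) (hinit : initial_assumption pi mu0 x0 beta)
  (hCstar : exists M : R, forall z, Cstar V k z <= M)
  (hX : forall (N : nat) (w : Om), (0 < N)%N -> particle_flow V k (X N w) (x0 N w)).

Definition time_mean N (g : 'M[R]_(N, d) -> R) (T : R) (w : Om) : R :=
  T^-1 * prim (g \o Xext (X N w)) T.

Lemma measurable_time_mean N (g : 'M[R]_(N, d) -> R) T : (0 < N)%N -> 0 < T ->
  continuous g -> measurable_fun setT (time_mean g T).
Proof.
move=> N0 T0 cg; apply: measurable_funM => //.
have [a a0 aF] := @svgd_field_linear_growth _ N _ _ _ _ hV hk.
apply: (measurable_prim (x0 := x0 N) a0 aF (svgd_field_lipschitz hV hk) (svgd_field_continuous hV hk)) => //.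
- by move=> w; have [] := hX w N0.
- by move=> w; have [] := hX w N0.
- by move=> w t c t0; exact: (particle_flow_derive hV hk c (hX w N0) t0).
Qed.

Lemma KL_bound : exists2 c : R, 0 <= c & forall N, (0 < N)%N ->
  (KL (distribution P (x0 N)) (row_product N pi) <= (N%:R * c)%:E)%E.
Proof.
have := init_KL hinit; set s := ereal_sup _ => soo.
exists (Num.max 0 (fine s)); first by rewrite le_max lexx.
move=> N N0.
have : ((N%:R^-1)%:E * KL (distribution P (x0 N)) (row_product N pi) <= s)%E.
  by apply: ereal_sup_ubound; exists N.
have NR : 0 < N%:R :> R by rewrite ltr0n.
move=> /le_trans/(_ (_ : (s <= (Num.max 0 (fine s))%:E)%E)) h.
rewrite EFinM -lee_pdivrMl// h//.
case: s soo {h} => [r|//|] _; first by rewrite lee_fin le_max lexx orbT.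
by rewrite leNye.
Qed.

Lemma stein_mean_ge0 N (x : 'M[R]_(N, d)) : 0 <= stein_mean V k x.
Proof.
rewrite /stein_mean !mulr_ge0 ?invr_ge0//.
have := stein_ker_ge0 V hH hk (fun _ : 'I_N => 1) (fun i => row i x).
by under eq_bigr do under eq_bigr do rewrite !mul1r.
Qed.

(** [action_ge] bounds the time integral of [stein_mean] by the action sample by sample, and
    [action_le] bounds the mean of the action by the initial entropy, of order [N]. Division by
    [T * N] leaves [1/T] from the entropy and [1/N] from [Cstar]. *)
Lemma entropy_bound : exists2 c : R, 0 <= c & forall N T, (0 < N)%N -> 0 < T ->
  (\int[P]_w (time_mean (@stein_mean R N d V k) T w)%:E <= (c / T + c / N%:R)%:E)%E.
Proof.
have [c1 c10 hc1] := KL_bound; have [M hM] := hCstar.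
pose c2 := Num.max 0 M.
have c20 : 0 <= c2 by rewrite le_max lexx.
have hc2 z : Cstar V k z <= c2 by rewrite le_max hM orbT.
exists (c1 + c2) => [|N T N0 T0]; first by rewrite addr_ge0.
have [Z Z0 piV] := target_density hV.
have [a a0 aF] := @svgd_field_linear_growth _ N _ _ _ _ hV hk.
have VB (r : R) : exists B : R, forall x : E, `|x| <= r -> `|V x| <= B.
  by have [B _ hB] := bounded_on_ball r (target_continuous hV); exists B.
have X0 w : X N w 0 = x0 N w by have [] := hX w N0.
have cX w : {within [set t | 0 <= t], continuous (X N w)} by have [] := hX w N0.
have dX w (t : R) (c : 'I_N * 'I_d) : 0 < t ->
    is_derive t (1 : R) (fun s => X N w s c.1 c.2) (svgd_field V k c (X N w t)).
  by move=> t0; exact: (particle_flow_derive hV hk c (hX w N0) t0).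
have NR : 0 < N%:R :> R by rewrite ltr0n.
have le_action w : N%:R * prim (@stein_mean R N d V k \o Xext (X N w)) T <=
    action (svgd_div V k) V (x0 N) (X N) T w + c2 * T.
  by have := action_ge hV hk (hX w N0) T0 c20 hc2; rewrite X0.
have q0 w : 0 <= prim (@stein_mean R N d V k \o Xext (X N w)) T.
  by apply: prim_ge0 => t /=; exact: stein_mean_ge0.
have act0 w : 0 <= action (svgd_div V k) V (x0 N) (X N) T w + c2 * T.
  by apply: le_trans (le_action w); rewrite mulr_ge0.
have K0 : 0 <= c2 * T by rewrite mulr_ge0// ltW.
have hle := action_le a0 aF (svgd_field_lipschitz hV hk) (svgd_field_continuous hV hk)
  (svgd_div_continuous hV hk) (svgd_div_bounded hV hk) Z0 (target_continuous hV) piV VB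
  (is_derive_svgd_field hV hk) X0 cX dX T0 (hc1 N N0) K0 act0.
have mact : measurable_fun setT (action (svgd_div V k) V (x0 N) (X N) T).
  exact: (action_measurable a0 aF (svgd_field_lipschitz hV hk) (svgd_field_continuous hV hk)
    (svgd_div_continuous hV hk) (target_continuous hV) X0 cX dX T0).
have mtm := measurable_time_mean N0 T0 (stein_mean_continuous hV hk (N := N)).
apply: (@le_trans _ _ (\int[P]_w ((T * N%:R)^-1 *
    (action (svgd_div V k) V (x0 N) (X N) T w + c2 * T))%:E)%E).
  apply: ge0_le_integral => //.
  - by move=> w _; rewrite lee_fin /time_mean mulr_ge0 ?invr_ge0 ?(ltW T0).
  - exact/measurable_EFinP.
  - by apply/measurable_EFinP; apply: measurable_funM => //; apply: measurable_funD.
  - move=> w _; rewrite lee_fin /time_mean invfM -mulrA ler_wpM2l ?invr_ge0 ?(ltW T0)//.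
    by rewrite ler_pdivlMl.
under eq_integral do rewrite EFinM.
rewrite ge0_integralZl_EFin//; first last.
- by rewrite invr_ge0 mulr_ge0// ltW.
- by apply/measurable_EFinP; apply: measurable_funD.
- by move=> w _; rewrite lee_fin.
apply: (@le_trans _ _ (((T * N%:R)^-1)%:E * (N%:R * c1 + c2 * T)%:E)%E).
  by rewrite lee_wpmul2l ?lee_fin ?invr_ge0 ?mulr_ge0// ltW.
rewrite -EFinM lee_fin.
have -> : (T * N%:R)^-1 * (N%:R * c1 + c2 * T) = c1 / T + c2 / N%:R.
  by field; rewrite !gt_eqF.
by apply: lerD; apply: ler_wpM2r; rewrite ?invr_ge0 ?lerDl ?lerDr// ltW.
Qed.

End particles.

Lemma ge0_integral_mrestr {dT} {T : measurableType dT} {R : realType}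
    (mu : {measure set T -> \bar R}) (D : set T) (mD : measurable D) (f : T -> \bar R) :
  (forall t, (0 <= f t)%E) -> measurable_fun setT f ->
  (\int[mrestr mu mD]_x f x = \int[mu]_(x in D) f x)%E.
Proof.
move=> f0 mf; have mfD A : measurable_fun A f by exact: measurable_funTS.
have mDC : measurable (~` D) by exact: measurableC.
rewrite -(setUv D) (ge0_integral_setU (mrestr mu mD))//; last exact/disj_setPCl.
rewrite [X in (_ + X)%E](null_set_integral (mu := mrestr mu mD))//; last first.
  by rewrite /= /mrestr setICl measure0.
rewrite adde0; apply: (@eq_measure_integral _ _ _ D mu (mrestr mu mD)) => A mA AD.
by rewrite /= /mrestr setIidl.
Qed.

(** * Time averages of measures *)

Section time_average_measure.
Context {R : realType} {d : nat}.
Local Notation E := 'rV[R]_d.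
Local Notation leb := (@lebesgue_measure R).

Section kernels.
Variables (nu : R -> {measure set E -> \bar R}) (T : R).
Hypotheses (T0 : 0 < T)
  (mnu : forall A, measurable A -> measurable_fun [set: measurableTypeR R] (fun t => nu t A))
  (nu1 : forall t, (nu t setT <= 1)%E).

Let Ti0 : 0 <= T^-1. Proof. by rewrite invr_ge0 ltW. Qed.

(** A time average is the uniform law on [[0, T]] composed with the curve of measures, both seen as
    kernels over a point; Fubini for time averages is then the integral formula for composed
    kernels. Hypotheses are taken as arguments so that the kernel instances attach to the terms. *)
Definition uniform_kernel of 0 < T : unit -> {measure set (measurableTypeR R) -> \bar R} :=
  fun _ => mscale (NngNum Ti0) (mrestr leb (measurable_itv `[0, T])).

Definition curve_kernel of (forall A, measurable A -> measurable_fun [set: measurableTypeR R] (fun t => nu t A))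
    & (forall t, (nu t setT <= 1)%E) :
  unit * measurableTypeR R -> {measure set E -> \bar R} := fun p => nu p.2.

Let l := uniform_kernel T0.
Let c := curve_kernel mnu nu1.

Let ml U : measurable U -> measurable_fun [set: unit] (l ^~ U).
Proof. by move=> _; exact: measurable_cst. Qed.

HB.instance Definition _ := isKernel.Build _ _ _ _ R l ml.

Let lT x : l x setT = 1%E.
Proof.
transitivity ((T^-1)%:E * leb (setT `&` `[0%R, T]))%E; first by [].
rewrite setTI lebesgue_measure_itv/= lte_fin T0.
by rewrite -EFinD -EFinM subr0 mulVf// gt_eqF.
Qed.

Let l_uub : measure_fam_uub l.
Proof. by exists 2 => x; rewrite lT lte_fin ltr1n. Qed.

HB.instance Definition _ := Kernel_isFinite.Build _ _ _ _ R l l_uub.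

Let mc U : measurable U -> measurable_fun [set: unit * measurableTypeR R] (c ^~ U).
Proof. by move=> mU; exact: (measurableT_comp (mnu mU) measurable_snd). Qed.

HB.instance Definition _ := isKernel.Build _ _ _ _ R c mc.

Let c_uub : measure_fam_uub c.
Proof. by exists 2 => x; apply: (le_lt_trans (nu1 _)); rewrite lte_fin ltr1n. Qed.

HB.instance Definition _ := Kernel_isFinite.Build _ _ _ _ R c c_uub.

Lemma integral_uniform_kernel (f : R -> \bar R) : (forall t, (0 <= f t)%E) ->
  measurable_fun [set: measurableTypeR R] f ->
  (\int[l tt]_t f t = (T^-1)%:E * \int[leb]_(t in `[0%R, T]) f t)%E.
Proof.
move=> f0 mf; rewrite /l /uniform_kernel ge0_integral_mscale//; congr (_ * _)%E.
exact: ge0_integral_mrestr.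
Qed.

Lemma time_average_kcomp A : measurable A -> time_average nu T A = kcomp l c tt A.
Proof.
by move=> mA; rewrite /kcomp integral_uniform_kernel//; exact: mnu.
Qed.

Definition time_average_measure of 0 < T &
   (forall A, measurable A -> measurable_fun [set: measurableTypeR R] (fun t => nu t A)) &
   (forall t, (nu t setT <= 1)%E) : set E -> \bar R := time_average nu T.

Let m := time_average_measure T0 mnu nu1.

Let m0 : m set0 = 0%E.
Proof. by rewrite /m /time_average_measure time_average_kcomp// measure0. Qed.

Let m_ge0 A : (0 <= m A)%E.
Proof.
rewrite mule_ge0 ?lee_fin//; exact: integral_ge0.
Qed.

Let m_sigma_additive : semi_sigma_additive m.
Proof.
move=> F mF tF mUF; rewrite /m /time_average_measure time_average_kcomp//.
rewrite (_ : (fun n => _) = (fun n => (\sum_(0 <= i < n) kcomp l c tt (F i))%E)); last first.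
  by apply/funext => n; apply: eq_bigr => i _; exact: time_average_kcomp.
exact: (@measure_semi_sigma_additive _ _ _ (mkcomp l c tt)).
Qed.

HB.instance Definition _ := isMeasure.Build _ _ _ m m0 m_ge0 m_sigma_additive.

Lemma time_average_is_measure : exists m' : {measure set E -> \bar R},
  m' = time_average nu T :> (set E -> \bar R).
Proof. by exists m. Qed.

Lemma ge0_integral_time_average (f : E -> \bar R) : (forall x, (0 <= f x)%E) ->
  measurable_fun setT f ->
  (\int[time_average nu T]_x f x =
   (T^-1)%:E * \int[leb]_(t in `[0%R, T]) \int[nu t]_x f x)%E.
Proof.
move=> f0 mf.
rewrite -[time_average nu T]/(m : set E -> \bar R).
rewrite (@eq_measure_integral _ _ _ setT (mkcomp l c tt)); last first.
  by move=> A mA _; exact: time_average_kcomp.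
rewrite integral_kcomp// integral_uniform_kernel//.
- by move=> t; exact: integral_ge0.
- exact: measurable_fun_integral_kernel.
Qed.

Lemma time_average_integrable (F : R -> \bar R) (B : R) :
  measurable_fun [set: measurableTypeR R] F ->
  (forall t, 0 <= t <= T -> (`|F t| <= B%:E)%E) -> leb.-integrable `[0, T] F.
Proof.
move=> mF FB.
have iB : leb.-integrable `[0, T] (EFin \o (fun _ : R => B)).
  by apply: continuous_itv_integrable => t; exact: cvg_cst.
apply: (le_integrable _ _ _ iB) => //; first exact: measurable_funTS.
move=> t; rewrite /= in_itv/= => tT; apply: (le_trans (FB t tT)).
by rewrite lee_fin ler_norm.
Qed.

(** Positive and negative parts are averaged separately by the nonnegative case; the uniform bound
    on absolute moments makes both finite, so that they can be subtracted. *)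
Lemma integral_time_average (f : E -> R) (B : R) : measurable_fun setT f ->
  (forall t, 0 <= t <= T -> (\int[nu t]_x `|f x|%:E <= B%:E)%E) ->
  leb.-integrable `[0, T] (fun t => (\int[nu t]_x f x)%:E) /\
  (\int[time_average nu T]_x (f x)%:E =
   (T^-1 * \int[leb]_(t in `[0%R, T]) (\int[nu t]_x f x)%R)%R%:E)%E.
Proof.
move=> mf fB.
have mp : measurable_fun setT (EFin \o (f^\+)%R) by apply/measurable_EFinP; exact: measurable_funrpos.
have mn : measurable_fun setT (EFin \o (f^\-)%R) by apply/measurable_EFinP; exact: measurable_funrneg.
have p0 x : (0 <= (EFin \o (f^\+)%R) x)%E by rewrite lee_fin.
have n0 x : (0 <= (EFin \o (f^\-)%R) x)%E by rewrite lee_fin.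
pose Fp t := (\int[nu t]_x (EFin \o (f^\+)%R) x)%E.
pose Fn t := (\int[nu t]_x (EFin \o (f^\-)%R) x)%E.
have mFp : measurable_fun [set: measurableTypeR R] Fp by exact: measurable_fun_integral_kernel.
have mFn : measurable_fun [set: measurableTypeR R] Fn by exact: measurable_fun_integral_kernel.
have mabs : measurable_fun setT (fun x => `|f x|%:E).
  by apply/measurable_EFinP; exact: measurableT_comp.
have FpB t : 0 <= t <= T -> (`|Fp t| <= B%:E)%E.
  move=> tT; rewrite gee0_abs; last exact: integral_ge0.
  apply: le_trans (fB t tT); apply: ge0_le_integral => // x _; rewrite lee_fin /=.
  by rewrite /funrpos ge_max ler_norm normr_ge0.
have FnB t : 0 <= t <= T -> (`|Fn t| <= B%:E)%E.
  move=> tT; rewrite gee0_abs; last exact: integral_ge0.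
  apply: le_trans (fB t tT); apply: ge0_le_integral => // x _; rewrite lee_fin /=.
  by rewrite /funrneg ge_max -normrN ler_norm normr_ge0.
have iFp := time_average_integrable mFp FpB.
have iFn := time_average_integrable mFn FnB.
have FE t : 0 <= t <= T -> (Fp t - Fn t = (\int[nu t]_x f x)%:E)%E.
  move=> tT; rewrite /Rintegral integralE (funerpos f) (funerneg f) fineK//.
  have fin (u : \bar R) : (`|u| <= B%:E)%E -> u \is a fin_num.
    by move=> uB; rewrite fin_num_abs; apply: le_lt_trans uB _; rewrite ltry.
  by rewrite fin_numB !fin ?FpB ?FnB.
have ig : leb.-integrable `[0, T] (fun t => (\int[nu t]_x f x)%:E).
  apply: (eq_integrable _ _ _ _ (integrableB _ iFp iFn)) => // t.
  by rewrite inE /= in_itv/= => tT; exact: FE.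
split=> //.
have -> : (\int[time_average nu T]_x (f x)%:E =
    \int[time_average nu T]_x (EFin \o (f^\+)%R) x -
    \int[time_average nu T]_x (EFin \o (f^\-)%R) x)%E.
  by have := integralE m setT (EFin \o f); rewrite (funerpos f) (funerneg f).
rewrite !ge0_integral_time_average//.
rewrite -muleBr//; last first.
  by rewrite fin_num_adde_defr// integrable_fin_num.
rewrite -integralB// EFinM; congr (_ * _)%E.
rewrite {2}/Rintegral fineK; last exact: integrable_fin_num.
by apply: eq_integral => t; rewrite inE /= in_itv/= => tT; exact: FE.
Qed.

End kernels.
End time_average_measure.

(** * Measurability of the mean-field curve *)

Section smooth_bumps.
Context {R : realType} {d : nat}.
Local Notation E := 'rV[R]_d.

Lemma Cn1_comp (f : E -> R) (h h' : R -> R) : Cn 1 f ->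
  (forall u, is_derive u (1 : R) h (h' u)) -> continuous h' -> Cn 1 (fun x => h (f x)).
Proof.
move=> [df cdf] dh ch'.
have dh' u : differentiable h u by apply/derivable1_diffP.
have cf : continuous f by move=> x; exact: differentiable_continuous (df x).
split=> [x|v]; first exact: (@differentiable_comp _ _ _ _ f h).
rewrite (_ : 'D_v _ = (fun x => h' (f x) * 'D_v f x)).
  by apply: contM; [exact: cont_comp cf ch'|exact: cdf].
apply/funext => x; have dhf : differentiable (fun x => h (f x)) x.
  exact: (@differentiable_comp _ _ _ _ f h).
rewrite deriveE// (@diff_comp _ _ _ _ f h)//= deriveE//.
have [_ hE] := dh (f x); rewrite -hE deriveE//.
by rewrite -[X in 'd h (f x) X]mulr1 -[X in 'd h (f x) X]/(_ *: (1 : R)) linearZ/= mulrC.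
Qed.

Lemma Cn1_mul (f g : E -> R) : Cn 1 f -> Cn 1 g -> Cn 1 (fun x => f x * g x).
Proof.
move=> [df cdf] [dg cdg].
have cf : continuous f by move=> x; exact: differentiable_continuous (df x).
have cg : continuous g by move=> x; exact: differentiable_continuous (dg x).
split=> [x|v]; first exact: differentiableM.
rewrite (_ : 'D_v _ = (fun x => f x * 'D_v g x + g x * 'D_v f x)).
  by apply: contD; apply: contM; [exact: cf|exact: cdg|exact: cg|exact: cdf].
by apply/funext => x; rewrite (@deriveM _ _ f g)//; exact: diff_derivable.
Qed.

Lemma Cn1_cst (c : R) : Cn 1 (fun _ : E => c).
Proof.
split=> [x|v]; first exact: differentiable_cst.
rewrite (_ : 'D_v _ = (fun _ => 0)); first exact: contC.
by apply/funext => x; rewrite derive_cst.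
Qed.

Lemma Cn1_coord j : Cn 1 (fun x : E => x 0 j).
Proof.
split=> [x|v]; first exact: differentiable_coord.
rewrite (_ : 'D_v _ = (fun _ => v 0 j)); first exact: contC.
by apply/funext => x; rewrite derive_coord.
Qed.

Lemma Cn1_prod (I : Type) (r : seq I) (f : I -> E -> R) : (forall i, Cn 1 (f i)) ->
  Cn 1 (fun x => \prod_(i <- r) f i x).
Proof.
move=> cf; elim: r => [|i r IH].
  by under eq_fun do rewrite big_nil; exact: Cn1_cst.
under eq_fun do rewrite big_cons; exact: Cn1_mul.
Qed.

(** A quadratic error bound determines the derivative. For [pos_sqr] this bound is polynomial
    arithmetic in each sign case, the point 0 included. *)
Lemma is_derive_quadratic (h : R -> R) (u c : R) :
  (forall t, `|h (u + t) - h u - c * t| <= t ^+ 2) -> is_derive u (1 : R) h c.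
Proof.
move=> hq.
have cv : t^-1 *: ((h \o shift u) (t *: (1 : R)) - h u) @[t --> 0^'] --> c.
  apply/cvgrPdist_lt => ep ep0.
  have n0 : (0 : R)^' [set t | t != 0] := @nbhs_dnbhs_neq R 0.
  have n1 : (0 : R)^' [set t | `|t| < ep] := @dnbhs0_lt R R _ ep0.
  apply: filterS (filterI n0 n1) => t [/= t0 te].
  rewrite /shift/= -[t *: 1]/(t * 1) mulr1 [t + u]addrC -[t^-1 *: _]/(t^-1 * _).
  have -> : c - t^-1 * (h (u + t) - h u) = - (t^-1 * (h (u + t) - h u - c * t)).
    by field.
  rewrite normrN normrM; apply: le_lt_trans te.
  rewrite normfV ler_pdivrMl ?normr_gt0//; apply: (le_trans (hq t)).
  by rewrite -expr2 real_normK ?num_real.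
by apply: DeriveDef; [apply/cvg_ex; exists c|apply/cvg_lim].
Qed.

(** Continuously differentiable and positive exactly on the positive half-line: enough for test
    functions, which are only required to be of class C^1. *)
Definition pos_sqr (u : R) : R := Num.max 0 u ^+ 2.

Lemma is_derive_pos_sqr u : is_derive u (1 : R) pos_sqr (2 * Num.max 0 u).
Proof.
apply: is_derive_quadratic => t; rewrite /pos_sqr.
have [ut|ut] := leP 0 (u + t); have [u0|u0] := leP 0 u; rewrite ler_norml; nra.
Qed.

Lemma pos_sqr_ge0 u : 0 <= pos_sqr u. Proof. exact: sqr_ge0. Qed.

Lemma pos_sqr_gt0 u : (0 < pos_sqr u) = (0 < u).
Proof.
rewrite /pos_sqr; have [u0|u0] := ltP 0 u; first by rewrite exprn_gt0.
by rewrite expr0n ltxx.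
Qed.

Definition bump (a b : E) (x : E) : R :=
  \prod_j (pos_sqr (x 0 j - a 0 j) * pos_sqr (b 0 j - x 0 j)).

Definition box (a b : E) : set E := [set x | forall j, a 0 j < x 0 j < b 0 j].

Lemma Cn1_pos_sqr (f : E -> R) : Cn 1 f -> Cn 1 (fun x => pos_sqr (f x)).
Proof.
move=> cf; apply: (@Cn1_comp f pos_sqr (fun u => 2 * Num.max 0 u) cf is_derive_pos_sqr).
apply: contM; first exact: contC.
by move=> u; apply: continuous_max; [exact: cvg_cst|exact: cvg_id].
Qed.

Lemma Cn1_affine (f : E -> R) (a b : R) : Cn 1 f -> Cn 1 (fun x => a * f x + b).
Proof.
move=> cf; apply: (@Cn1_comp f (fun u => a * u + b) (fun _ => a) cf); last exact: contC.
move=> u; rewrite -[X in is_derive _ _ _ X]addr0; apply: is_deriveD.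
by apply: (is_derive_eq (is_deriveZ a (is_derive_id u 1))); rewrite /GRing.scale/= mulr1.
Qed.

Lemma bump_Cn1 a b : Cn 1 (bump a b).
Proof.
apply: Cn1_prod => j; apply: Cn1_mul; apply: Cn1_pos_sqr.
  rewrite (_ : (fun _ => _) = (fun x : E => 1 * x 0 j + - a 0 j)).
    exact: Cn1_affine (Cn1_coord j).
  by apply/funext => x; rewrite mul1r.
rewrite (_ : (fun _ => _) = (fun x : E => -1 * x 0 j + b 0 j)).
  exact: Cn1_affine (Cn1_coord j).
by apply/funext => x; rewrite mulN1r addrC.
Qed.

Lemma bump_ge0 a b x : 0 <= bump a b x.
Proof. by apply: prodr_ge0 => j _; rewrite mulr_ge0// pos_sqr_ge0. Qed.

Lemma bump_gt0 a b x : (0 < bump a b x) <-> box a b x.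
Proof.
split=> [b0 j|bx].
  move: b0; rewrite /bump (bigD1 j)//= => b0.
  have : pos_sqr (x 0 j - a 0 j) * pos_sqr (b 0 j - x 0 j) != 0.
    by apply: contraTneq b0 => ->; rewrite mul0r ltxx.
  rewrite mulf_eq0 negb_or => /andP[h1 h2].
  by rewrite -subr_gt0 -pos_sqr_gt0 lt0r h1 pos_sqr_ge0 -subr_gt0 -pos_sqr_gt0 lt0r h2 pos_sqr_ge0.
apply: prodr_gt0 => j _; have /andP[h1 h2] := bx j.
by rewrite mulr_gt0// pos_sqr_gt0 subr_gt0.
Qed.

(* Increases to the indicator of the box [a, b]. *)
Definition bump_n (a b : E) (n : nat) (x : E) : R := 1 - expR (- n%:R * bump a b x).

Lemma bump_n_Cn1 a b n : Cn 1 (bump_n a b n).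
Proof.
have h1 : Cn 1 (fun x => expR (- n%:R * bump a b x + 0)).
  apply: (@Cn1_comp _ expR expR); last exact: continuous_expR.
  exact: Cn1_affine (@bump_Cn1 a b).
rewrite (_ : bump_n a b n = (fun x => -1 * expR (- n%:R * bump a b x + 0) + 1)).
  exact: Cn1_affine.
by apply/funext => x; rewrite mulN1r addr0 addrC.
Qed.

Lemma bump_n_ge0 a b n x : 0 <= bump_n a b n x.
Proof.
rewrite subr_ge0 -expR0 ler_expR mulNr oppr_le0 mulr_ge0//; exact: bump_ge0.
Qed.

Lemma bump_n_le1 a b n x : bump_n a b n x <= 1.
Proof. by rewrite gerBl expR_ge0. Qed.

Lemma bump_n_cvg a b x : bump_n a b n x @[n --> \oo] --> (\1_(box a b) x : R).
Proof.
have [bx|bx] := pselect (box a b x).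
  rewrite indicE mem_set//= -[X in _ --> X]subr0; apply: cvgB; first exact: cvg_cst.
  have b0 : 0 < bump a b x by apply/bump_gt0.
  rewrite (_ : (fun n => _) = (fun n => (expR (- bump a b x)) ^+ n)).
    by apply: cvg_expr; rewrite ger0_norm ?expR_ge0// -expR0 ltr_expR oppr_lt0.
  by apply/funext => n; rewrite -expRM_natl; congr expR; ring.
rewrite indicE memNset//= (_ : (fun n => _) = (fun _ => 0)); first exact: cvg_cst.
apply/funext => n; rewrite /bump_n (_ : bump a b x = 0) ?mulr0 ?expR0 ?subrr//.
by apply/eqP; rewrite eq_le bump_ge0 andbT leNgt; apply/negP => /bump_gt0.
Qed.

Lemma ball_compact (r : R) : compact [set x : E | `|x| <= r].
Proof.
apply: bounded_closed_compact.
  by exists r; split => [|M rM x /= xr]; rewrite ?num_real// (le_trans xr)// ltW.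
apply: (@preimage_closed _ _ (fun x : E => `|x|) [set t | t <= r]); last exact: closed_le.
by move=> x _; exact: norm_continuous.
Qed.

Lemma bump_n_test a b n : test_function (bump_n a b n).
Proof.
split; first exact: bump_n_Cn1.
pose r : R := `|a| + `|b|.
have cB : closed [set x : E | `|x| <= r].
  apply: (@preimage_closed _ _ (fun x : E => `|x|) [set t | t <= r]); last exact: closed_le.
  by move=> x _; exact: norm_continuous.
apply: (@subclosed_compact E _ _ (@closed_closure E _) (ball_compact (r := r))).
rewrite closureE; apply: bigcap_inf; split => // x /= nx.
have /bump_gt0 bx : 0 < bump a b x.
  rewrite lt0r bump_ge0 andbT; apply: contraNneq nx => bx0.
  by rewrite /bump_n bx0 mulr0 expR0 subrr.
apply/mx_norm_le => [|i j]; first by rewrite addr_ge0.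
rewrite ord1; have /andP[h1 h2] := bx j.
have := ler_mx_entry a 0 j; have := ler_mx_entry b 0 j.
rewrite /r !ler_norml => /andP[? ?] /andP[? ?].
have := normr_ge0 a; have := normr_ge0 b; lra.
Qed.

End smooth_bumps.

Section box_generation.
Context {R : realType} {d : nat}.
Local Notation E := 'rV[R]_d.

Definition boxes : set (set E) := [set A | exists a b, A = box a b].

Lemma boxes_setI : setI_closed boxes.
Proof.
move=> _ _ [a [b ->]] [a' [b' ->]].
exists (\row_j Num.max (a 0 j) (a' 0 j)), (\row_j Num.min (b 0 j) (b' 0 j)).
apply/seteqP; split => x /=.
  by move=> [h h'] j; rewrite !mxE gt_max lt_min; have /andP[-> ->] := h j; have /andP[-> ->] := h' j.
move=> h; split=> j; have := h j; rewrite !mxE gt_max lt_min;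
  by move=> /andP[/andP[? ?] /andP[? ?]]; apply/andP.
Qed.

Lemma box_open_measurable (a b : E) : measurable (box a b).
Proof.
have -> : box a b = \bigcap_(j in [set: 'I_d]) [set x : E | x 0 j \in `]a 0 j, b 0 j[ ].
  apply/seteqP; split => x /= h j; first by move=> _ /=; rewrite in_itv/=; exact: h.
  by have := h j I; rewrite /= in_itv.
apply: fin_bigcap_measurable => // j _.
rewrite (_ : [set x | _] = (fun x : E => x 0 j) @^-1` `]a 0 j, b 0 j[); last by [].
by rewrite -[X in measurable X]setTI; exact: measurable_mx_entry.
Qed.

(** The half-spaces [u < x j] generate the sigma-algebra, and each is a countable union of open
    boxes. *)
Lemma measurable_boxes : @measurable _ E = <<s boxes>>.
Proof.
apply/seteqP; split; last first.
  apply: smallest_sub; first exact: sigma_algebra_measurable.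
  by move=> _ [a [b ->]]; exact: box_open_measurable.
apply: smallest_sub; first exact: smallest_sigma_algebra.
rewrite -bigcup_seq/=; apply: bigcup_sub => k _ A [B mB <-].
case/mxvec_indexP: k => i j; rewrite ord1 {i}.
have mf : measurable_fun [set: g_sigma_algebraType boxes] (fun x : E => x 0 j).
  apply: (measurability _ (RGenOInfty.measurableE R)) => _ [_ [u ->] <-].
  rewrite setTI (_ : _ @^-1` _ = \bigcup_n box
      (\row_l if l == j then u else - n%:R) (\row_l n%:R)).
    apply: sigma_algebra_bigcup => n; apply: sub_sigma_algebra.
    by exists (\row_l if l == j then u else - n%:R), (\row_l n%:R).
  apply/seteqP; split => x /=.
    rewrite in_itv/= andbT => ux; pose n := Num.bound `|x|; exists n => // l.
    have h : `|x 0 l| < n%:R.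
      by apply: (le_lt_trans (ler_mx_entry x 0 l)); exact: archi_boundP.
    move: h; rewrite !mxE ltr_norml => /andP[h1 ->]; rewrite andbT.
    by case: eqP => [->|].
  by move=> [n _ /(_ j)]; rewrite !mxE eqxx in_itv/= andbT => /andP[].
have := mf measurableT B mB; congr (<<s boxes>> (_ `&` _)).
by apply/seteqP; split => x /=; rewrite /mx_entry mxvecE.
Qed.

End box_generation.

Section mean_field_measurability.
Context {R : realType} {d : nat}.
Local Notation E := 'rV[R]_d.
Variables (V : E -> R) (k : E -> E -> R) (mu : R -> probability E R) (mu0 : probability E R).
Hypothesis hmu : mean_field_flow V k mu mu0.

Lemma continuous_max0 (g : R -> R) : {within [set t | 0 <= t], continuous g} ->
  continuous (fun t : R => g (Num.max 0 t)).
Proof.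
move=> /subspace_continuousP cg t.
have h0 (s : R) : [set t | 0 <= t] (Num.max 0 s) by rewrite /= le_max lexx.
apply: cvg_comp; last exact: (cg _ (h0 t)).
have cm : {for t, continuous (fun s : R => Num.max 0 s)}.
  by apply: continuous_max; [exact: cvg_cst|exact: cvg_id].
move=> A wA.
have cmA : nbhs t [set s : R | 0 <= Num.max 0 s -> A (Num.max 0 s)] := cm _ wA.
suff : nbhs t [set s : R | A (Num.max 0 s)] by [].
by apply: filterS cmA => s /(_ (h0 s)).
Qed.

(** The weak solution is continuous in time only against test functions. Indicators of boxes are
    limits of the test functions [bump_n], and boxes are stable under intersection, so a Dynkin
    argument reaches all measurable sets. *)
Lemma mean_field_measurable A : measurable A ->
  measurable_fun [set: measurableTypeR R] (fun t => mu (Num.max 0 t) A).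
Proof.
move=> mA; have : <<s boxes>> A by rewrite -measurable_boxes.
pose Q (A : set E) := measurable_fun [set: measurableTypeR R] (fun t => mu (Num.max 0 t) A).
apply: (dynkin_induction (P := Q) measurable_boxes boxes_setI) => {A mA}.
- rewrite /Q (_ : (fun _ => _) = (fun _ => 1%E)); first exact: measurable_cst.
  by apply/funext => t; exact: probability_setT.
- move=> _ [a [b ->]]; rewrite /Q.
  have [_ _ ct _] := hmu.
  apply: (@emeasurable_fun_cvg _ (measurableTypeR R) R setT (fun n (t : measurableTypeR R) => (\int[mu (Num.max 0 t)]_x bump_n a b n x)%:E)).
    move=> n; apply/measurable_EFinP; apply: continuous_measurable_fun.
    exact: (continuous_max0 (ct _ (bump_n_test a b n))).
  move=> t _; set m := mu _.
  have mb n : measurable_fun setT (EFin \o bump_n a b n : E -> \bar R).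
    apply/measurable_EFinP; apply: continuous_mx_measurable.
    by have [db _] := bump_n_Cn1 a b n; move=> x; exact: differentiable_continuous (db x).
  have ibn n : m.-integrable setT (EFin \o bump_n a b n).
    have b1 x : `|bump_n a b n x| <= 1 by rewrite ger0_norm ?bump_n_ge0 ?bump_n_le1.
    by apply: (@probability_bounded_integrable _ E R m (bump_n a b n) 1) => //; exact/measurable_EFinP.
  rewrite (_ : (fun n => _) = (fun n => \int[m]_x (bump_n a b n x)%:E)%E); last first.
    apply/funext => n; rewrite /Rintegral fineK//.
    exact: (integrable_fin_num measurableT (ibn n)).
  have mbox := box_open_measurable a b.
  have -> : m (box a b) = (\int[m]_x (\1_(box a b) x)%:E)%E by rewrite integral_indic// setIT.
  have i1 : m.-integrable setT (EFin \o (fun _ : E => 1 : R)).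
    by apply: (@probability_bounded_integrable _ E R m (fun _ => 1) 1) => // x; rewrite normr1.
  apply: (dominated_cvg measurableT mb _ _ i1) => // [x _|n x _].
    by apply/cvg_EFin; [exact: nearW|exact: bump_n_cvg].
  by rewrite /= lee_fin ger0_norm ?bump_n_ge0 ?bump_n_le1.
- move=> S mS QS; rewrite /Q (_ : (fun _ => _) = (fun t => (1 - mu (Num.max 0 t)%R S)%E)).
    by apply: emeasurable_funB; [exact: measurable_cst|exact: QS].
  by apply/funext => t; exact: probability_setC.
- move=> F mF tF QF; rewrite /Q.
  apply: (@emeasurable_fun_cvg _ (measurableTypeR R) R setT (fun n (t : measurableTypeR R) => (\sum_(0 <= i < n) mu (Num.max 0 t)%R (F i))%E)).
    by move=> n; apply: emeasurable_sum => i; exact: QF.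
  by move=> t _; apply: measure_semi_sigma_additive => //; exact: bigcup_measurable.
Qed.

End mean_field_measurability.

(** The integral of a nonnegative function is a supremum over simple functions below it, so
    monotonicity holds without measurability. It is applied to the supremum in time of the KSD and
    to [W2], whose measurability in the sample is not established. *)
Lemma le_lower_integral {dT} {T : measurableType dT} {R : realType}
    (m : {measure set T -> \bar R}) (D : set T) (f g : T -> \bar R) :
  (forall x, D x -> (0 <= f x)%E) -> (forall x, D x -> (f x <= g x)%E) ->
  (\int[m]_(x in D) f x <= \int[m]_(x in D) g x)%E.
Proof.
move=> f0 fg; rewrite !ge0_integralE//; last first.
  by move=> x Dx; exact: le_trans (f0 x Dx) (fg x Dx).
apply: ereal_sup_le => _ [h /= hf <-]; exists h => //= x.
apply: le_trans (hf x) _; rewrite /patch; case: ifPn => // xD.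
by apply: fg; rewrite -inE.
Qed.

Lemma rat_approx {R : realType} (x e : R) : 0 < e -> exists q : rat, `|x - ratr q| < e.
Proof.
move=> e0; have /rat_in_itvoo[q] : x - e < x + e by lra.
by rewrite in_itv/= => /andP[a b]; exists q; rewrite ltr_norml; lra.
Qed.

(** * Countable reduction of the KSD *)

Section stein_countable.
Context {R : realType} {d : nat}.
Local Notation E := 'rV[R]_d.
Variables (V : E -> R) (k : E -> E -> R) (pi : probability E R).
Variables (H : set (E -> R)) (ip : (E -> R) -> (E -> R) -> R).
Hypotheses (hV : target_assumption V pi) (hk : Cnb 4 (fun z : E * E => k z.1 z.2))
  (hH : is_rkhs k H ip).
Local Notation ball := (product_ball H ip).

Lemma stein_ker_diag_le : exists2 K : R, 0 <= K & forall x : E,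
  stein_ker V k x x <= K * (1 + `|x|) ^+ 2.
Proof.
have [B B0 hB] := ker_bounds hk; have [L L0 hL] := partial_growth hV.
exists (\sum_(j < d) B * (L + 1) ^+ 2) => [|x].
  by apply: sumr_ge0 => j _; rewrite mulr_ge0 ?sqr_ge0.
rewrite /stein_ker mulr_suml; apply: ler_sum => j _; rewrite /stein_ker1.
have [h1 h2 h3 h4 _] := hB j x x; have h5 := hL j x.
move: h1 h2 h3 h4 h5; move: (partial j V x) (k x x) (ker1 k j x x) (ker2 k j x x) (ker12 k j x x).
move=> b c c1 c2 c12 h1 h2 h3 h4 h5.
apply: (@le_trans _ _ (B * (`|b| + 1) ^+ 2)).
  apply: le_trans (ler_norm _) _.
  rewrite (_ : B * _ = `|b| * `|b| * B + `|b| * B + `|b| * B + B); last by ring.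
  apply: (le_trans (ler_normD _ _)); apply: lerD => //.
  apply: (le_trans (ler_normB _ _)); apply: lerD; last by rewrite normrM ler_wpM2l.
  apply: (le_trans (ler_normB _ _)); apply: lerD; last by rewrite normrM ler_wpM2l.
  by rewrite !normrM ler_wpM2l// mulr_ge0.
rewrite -mulrA ler_wpM2l// -exprMn ler_sqr ?nnegrE ?addr_ge0 ?mulr_ge0 ?addr_ge0//.
by rewrite mulrDl mul1r lerD// lerDl.
Qed.

(** The proof gives linear growth in [x], weakened here to the form that second moments
    integrate. *)
Lemma stein_growth : exists2 C : R, 0 <= C & forall phi (x : E), ball phi ->
  `|stein V phi x| <= C * (1 + enorm x ^+ 2).
Proof.
have [K K0 hK] := stein_ker_diag_le.
exists (2 * (1 + K)) => [|phi x phiB]; first by rewrite mulr_ge0// addr_ge0.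
have x0 : 0 <= `|x| by [].
apply: (@le_trans _ _ ((1 + K) * (1 + `|x|))).
  rewrite -ler_sqr ?nnegrE ?mulr_ge0 ?addr_ge0// real_normK ?num_real//.
  apply: (le_trans (stein_sqr_le V hH hk x phiB)); apply: (le_trans (hK x)).
  rewrite exprMn ler_wpM2r ?sqr_ge0//; nra.
rewrite -mulrA mulrCA ler_wpM2l ?addr_ge0//.
have := norm_le_enorm x; have := enorm_ge0 x; move: (enorm x) `|x| x0 => e y; nra.
Qed.

Lemma measurable_stein phi : ball phi -> measurable_fun setT (stein V phi).
Proof.
move=> phiB; apply: continuous_mx_measurable.
exact: (stein_continuous hH hk (partial_continuous hV)).
Qed.

Lemma measurable_enorm2 : measurable_fun setT (fun x : E => enorm x ^+ 2).
Proof.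
apply: continuous_mx_measurable.
rewrite (_ : (fun _ => _) = (fun x : E => \sum_j x 0 j * x 0 j)).
  by apply: cont_sum => j; apply: contM; exact: continuous_mx_entry.
by apply/funext => x; rewrite enormE; apply: eq_bigr => j _; rewrite expr2.
Qed.

Definition rational_point (n : nat) : E :=
  map_mx ratr (odflt 0 (unpickle n : option 'rV[rat]_d)).

Lemma rational_point_dense (x : E) (de : R) : 0 < de -> exists n, `|rational_point n - x| < de.
Proof.
move=> de0; have [q qx] := dense_ratr_mx x de0.
by exists (pickle q); rewrite /rational_point pickleK distrC.
Qed.

Definition near_ball (v : seq rat) (phi : E -> E) : Prop :=
  ball phi /\ forall i, (i < size v)%N ->
    `|stein V phi (rational_point i) - ratr v`_i| < (size v).+1%:R^-1.

(** Separability of [H] is replaced by a choice indexed by target values: one element of the ball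
    for each finite rational sequence that some element nearly matches at the first rational points,
    and 0 for the other sequences. *)
Definition ball_enum (n : nat) : E -> E :=
  let v := odflt [::] (unpickle n : option (seq rat)) in
  if pselect (exists phi, near_ball v phi) is left e then sval (cid e) else fun _ => 0.

Lemma ball_enum_ball n : ball (ball_enum n).
Proof.
rewrite /ball_enum; case: pselect => [e|_]; last exact: (product_ball0 hH).
by case: cid => phi /= [].
Qed.

Lemma ball_enum_dense phi : ball phi -> exists s : nat -> nat, forall i (e : R), 0 < e ->
  \forall n \near \oo, `|stein V (ball_enum (s n)) (rational_point i) -
    stein V phi (rational_point i)| < e.
Proof.
move=> phiB.
have hv (n : nat) : exists v : seq rat, size v = n /\ near_ball v phi.
  have hq (i : nat) : exists q : rat, `|stein V phi (rational_point i) - ratr q| < n.+1%:R^-1.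
    by apply: rat_approx; rewrite invr_gt0 ltr0n.
  exists (mkseq (fun i => sval (cid (hq i))) n); rewrite size_mkseq; split=> //.
  split=> // i; rewrite size_mkseq => im; rewrite nth_mkseq//.
  by case: cid.
pose v n := sval (cid (hv n)).
have vP n : size (v n) = n /\ near_ball (v n) phi by exact: svalP (cid (hv n)).
exists (fun n => pickle (v n)) => i e e0.
have e20 : 0 < e / 2 by rewrite divr_gt0.
have := near_infty_natSinv_lt (PosNum e20) => -[n0 _ hn0].
exists (maxn n0 i.+1) => // n /=; rewrite geq_max => /andP[n0n im].
have [sv nbv] := vP n.
rewrite /ball_enum pickleK/=; case: pselect => [ex|]; last by case; exists phi.
case: cid => psi /= [_ hpsi].
have := hpsi i; rewrite sv => /(_ im) h1.
have := nbv.2 i; rewrite sv => /(_ im) h2.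
have := hn0 n n0n => /= h3.
rewrite -(subrKA (ratr (v n)`_i)); apply: (le_lt_trans (ler_normD _ _)).
rewrite [X in _ + X]distrC [ltRHS]splitr; apply: ltrD.
  exact: lt_trans h1 h3.
exact: lt_trans h2 h3.
Qed.

(** Convergence at the rational points spreads to every point by equicontinuity over the ball, with
    one third of [e] for each of the three comparisons. *)
Lemma ball_enum_cvg phi : ball phi -> exists s : nat -> nat, forall x : E,
  stein V (ball_enum (s n)) x @[n --> \oo] --> stein V phi x.
Proof.
move=> phiB; have [s hs] := ball_enum_dense phiB; exists s => x.
apply/cvgrPdist_lt => e e0.
have e3 : 0 < e / 3 by rewrite divr_gt0.
have [de de0 hde] := stein_equicontinuous hH hk (partial_continuous hV) x e3.
have [i hi] := rational_point_dense x de0.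
apply: filterS (hs i _ e3) => n hn.
have h1 := hde _ _ phiB hi; have h2 := hde _ _ (ball_enum_ball (s n)) hi.
move: h1 h2 hn.
move: (stein V phi x) (stein V phi _) (stein V (ball_enum (s n)) x) (stein V (ball_enum (s n)) _).
by move=> a b c e'; rewrite !ltr_norml => /andP[? ?] /andP[? ?] /andP[? ?]; lra.
Qed.

Lemma stein_integrable (m : {measure set E -> \bar R}) phi :
  m.-integrable setT (fun x => (1 + enorm x ^+ 2)%:E) -> ball phi ->
  m.-integrable setT (EFin \o stein V phi).
Proof.
move=> im phiB; have [C C0 hC] := stein_growth.
have iC := integrableZl measurableT C im.
apply: (le_integrable measurableT _ _ iC); first by apply/measurable_EFinP; exact: measurable_stein.
by move=> x _; rewrite /= lee_fin [leRHS]ger0_norm ?hC// mulr_ge0// addr_ge0// sqr_ge0.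
Qed.

Lemma stein_integral_cvg (m : {measure set E -> \bar R}) phi s :
  m.-integrable setT (fun x => (1 + enorm x ^+ 2)%:E) -> ball phi ->
  (forall x : E, stein V (ball_enum (s n)) x @[n --> \oo] --> stein V phi x) ->
  (\int[m]_x (stein V (ball_enum (s n)) x)%:E @[n --> \oo] --> \int[m]_x (stein V phi x)%:E)%E.
Proof.
move=> im phiB hs; have [C C0 hC] := stein_growth.
have iC := integrableZl measurableT C im.
apply: (dominated_cvg measurableT _ _ _ iC) => [n|x _|//|n x _].
- by apply/measurable_EFinP; apply: measurable_stein; exact: ball_enum_ball.
- by apply/cvg_EFin; [exact: nearW|exact: hs].
- by rewrite /= lee_fin hC//; exact: ball_enum_ball.
Qed.

(** Pointwise convergence along [ball_enum] passes to both integrals by dominated convergence under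
    [stein_growth]. Measurability of the KSD in the sample rests on this. *)
Lemma KSD_countable (m1 m2 : {measure set E -> \bar R}) :
  m1.-integrable setT (fun x => (1 + enorm x ^+ 2)%:E) ->
  m2.-integrable setT (fun x => (1 + enorm x ^+ 2)%:E) ->
  KSD V H ip m1 m2 = ereal_sup (range (fun n : nat =>
    (\int[m1]_x (stein V (ball_enum n) x)%:E - \int[m2]_x (stein V (ball_enum n) x)%:E)%E)).
Proof.
move=> i1 i2; apply/eqP; rewrite eq_le; apply/andP; split; last first.
  apply: ereal_sup_le => _ [n _ <-]; exists (ball_enum n) => //; exact: ball_enum_ball.
apply: ge_ereal_sup => _ [phi phiB <-].
have [s hs] := ball_enum_cvg phiB.
have c1 := stein_integral_cvg i1 phiB hs; have c2 := stein_integral_cvg i2 phiB hs.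
have f1 := integrable_fin_num measurableT (stein_integrable i1 phiB).
have f2 := integrable_fin_num measurableT (stein_integrable i2 phiB).
have adef : (\int[m1]_x (stein V phi x)%:E +? - \int[m2]_x (stein V phi x)%:E)%E.
  by rewrite fin_num_adde_defr.
apply: (cvge_le _ (cvgeB adef c1 c2)).
by apply: nearW => n; apply: ereal_sup_ubound; exists (s n).
Qed.

End stein_countable.

(** * Second moments and the Wasserstein distance *)

Section wasserstein_moment.
Context {R : realType} {d : nat}.
Local Notation E := 'rV[R]_d.

Lemma coupling_fst (m1 m2 : {measure set E -> \bar R}) (g : probability (E * E)%type R) (f : E -> \bar R) :
  coupling m1 m2 g -> measurable_fun setT f -> (forall x, (0 <= f x)%E) ->
  (\int[g]_z f z.1 = \int[m1]_x f x)%E.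
Proof.
move=> cg mf f0.
transitivity (\int[pushforward g (fst : E * E -> E)]_x f x)%E.
  by rewrite (ge0_integral_pushforward measurable_fst).
apply: eq_measure_integral => A mA _; rewrite -(cg A mA).1.
by congr (g _); apply/seteqP; split => -[x y] //= [].
Qed.

Lemma coupling_snd (m1 m2 : {measure set E -> \bar R}) (g : probability (E * E)%type R) (f : E -> \bar R) :
  coupling m1 m2 g -> measurable_fun setT f -> (forall x, (0 <= f x)%E) ->
  (\int[g]_z f z.2 = \int[m2]_x f x)%E.
Proof.
move=> cg mf f0.
transitivity (\int[pushforward g (snd : E * E -> E)]_x f x)%E.
  by rewrite (ge0_integral_pushforward measurable_snd).
apply: eq_measure_integral => A mA _; rewrite -(cg A mA).2.
by congr (g _); apply/seteqP; split => -[x y] //= [].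
Qed.

Lemma enorm2_le (x y : E) : enorm x ^+ 2 <= 2 * enorm (x - y) ^+ 2 + 2 * enorm y ^+ 2.
Proof.
rewrite !enormE !mulr_sumr -big_split/=; apply: ler_sum => j _; rewrite !mxE.
have := sqr_ge0 (x 0 j - y 0 j - y 0 j); rewrite -subr_ge0 => h; rewrite -subr_ge0.
by apply: le_trans h _; rewrite le_eqVlt; apply/predU1P; left; ring.
Qed.

(** By [enorm2_le], a large second moment of [m1] forces every coupling with [m2] to cost at least
    1. Hence [W2] dominates the indicator of a large moment, and its mean bounds the probability of
    one. *)
Lemma W2_ge1 (m1 : {measure set E -> \bar R}) (m2 : probability E R) (c : R) :
  (second_moment m2 <= c%:E)%E -> ((2 + 2 * c)%:E < second_moment m1)%E ->
  (1 <= W2 m1 m2)%E.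
Proof.
move=> m2c m1c; rewrite /W2.
have : (1 <= ereal_inf [set \int[gamma]_z (enorm (z.1 - z.2) ^+ 2)%:E
    | gamma in coupling m1 m2])%E.
  apply: le_ereal_inf_tmp => _ [g cg <-].
  have mz : measurable_fun setT (fun z : E * E => enorm (z.1 - z.2) ^+ 2).
    rewrite (_ : (fun _ => _) = (fun z : E * E => \sum_j (z.1 0 j - z.2 0 j) * (z.1 0 j - z.2 0 j))).
      apply: measurable_sum => j; have m1j : measurable_fun setT (fun z : E * E => z.1 0 j).
        by apply: (@measurableT_comp _ _ _ _ E _ (fun x : E => x 0 j)); [exact: measurable_mx_entry|exact: measurable_fst].
      have m2j : measurable_fun setT (fun z : E * E => z.2 0 j).
        by apply: (@measurableT_comp _ _ _ _ E _ (fun x : E => x 0 j)); [exact: measurable_mx_entry|exact: measurable_snd].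
      by apply: measurable_funM; apply: measurable_funB.
    by apply/funext => z; rewrite enormE; apply: eq_bigr => j _; rewrite !mxE expr2.
  have me := @measurable_enorm2 R d.
  have mE : measurable_fun setT (fun x : E => (enorm x ^+ 2)%:E) by exact/measurable_EFinP.
  have pE (x : E) : (0 <= (enorm x ^+ 2)%:E)%E by rewrite lee_fin sqr_ge0.
  have e1 : second_moment m1 = (\int[g]_z (enorm z.1 ^+ 2)%:E)%E.
    by rewrite (coupling_fst cg mE pE).
  have e2 : second_moment m2 = (\int[g]_z (enorm z.2 ^+ 2)%:E)%E.
    by rewrite (coupling_snd cg mE pE).
  have le12 : (second_moment m1 <= 2%:E * \int[g]_z (enorm (z.1 - z.2) ^+ 2)%:E
      + 2%:E * second_moment m2)%E.
    have mA : measurable_fun setT (fun z : E * E => (enorm (z.1 - z.2) ^+ 2)%:E).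
      exact/measurable_EFinP.
    have mB : measurable_fun setT (fun z : E * E => (enorm z.2 ^+ 2)%:E).
      by apply: (@measurableT_comp _ _ _ _ E _ (fun x : E => (enorm x ^+ 2)%:E)); [exact: mE|exact: measurable_snd].
    have p2 (u : R) : (0 <= 2%:E * (u ^+ 2)%:E)%E by rewrite -EFinM lee_fin mulr_ge0// sqr_ge0.
    rewrite e1 e2.
    have pA (z : E * E) : setT z -> (0 <= (enorm (z.1 - z.2) ^+ 2)%:E)%E by rewrite lee_fin sqr_ge0.
    have pB (z : E * E) : setT z -> (0 <= (enorm z.2 ^+ 2)%:E)%E by rewrite lee_fin sqr_ge0.
    rewrite -(ge0_integralZl_EFin g measurableT pA mA (ler0n R 2)).
    rewrite -(ge0_integralZl_EFin g measurableT pB mB (ler0n R 2)).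
    rewrite -(ge0_integralD g measurableT (fun z _ => p2 (enorm (z.1 - z.2))) (measurable_funeM _ mA)
      (fun z _ => p2 (enorm z.2)) (measurable_funeM _ mB)).
    by apply: le_lower_integral => z _; rewrite -?EFinM -?EFinD lee_fin ?sqr_ge0// enorm2_le.
  move: (lt_le_trans m1c le12) m2c.
  have : (0 <= second_moment m2)%E by apply: integral_ge0 => x _; rewrite lee_fin sqr_ge0.
  case: (second_moment m2) => [q| |]//; rewrite lee_fin => q0.
  have : (0 <= \int[g]_z (enorm (z.1 - z.2) ^+ 2)%:E)%E.
    by apply: integral_ge0 => z _; rewrite lee_fin sqr_ge0.
  case: (\int[g]_z _)%E => [s| |] s0//; rewrite ?leey//.
  by rewrite -!EFinM -EFinD lte_fin !lee_fin => h1 h2; lra.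
case: ereal_inf => [s| |]//=; rewrite ?leey// lee_fin => s1.
by rewrite lee_fin -sqrtr1 ler_wsqrtr.
Qed.

End wasserstein_moment.

Lemma Rintegral_itv_cst {R : realType} (T b : R) : 0 < T ->
  \int[@lebesgue_measure R]_(_ in `[0, T]) b = b * T.
Proof.
move=> T0; have leb0T : @lebesgue_measure R `[0, T] = T%:E.
  by rewrite lebesgue_measure_itv/= lte_fin T0 -EFinD subr0.
by rewrite Rintegral_cst//= leb0T.
Qed.

(** * KSD of time averages *)

Section time_averages.
Context {R : realType} {d : nat}.
Local Notation E := 'rV[R]_d.
Local Notation leb := (@lebesgue_measure R).
Variables (V : E -> R) (k : E -> E -> R) (pi : probability E R).
Variables (H : set (E -> R)) (ip : (E -> R) -> (E -> R) -> R).
Hypotheses (hV : target_assumption V pi) (hk : Cnb 4 (fun z : E * E => k z.1 z.2))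
  (hH : is_rkhs k H ip).
Local Notation ball := (product_ball H ip).

Section generic.
Variables (nu : R -> {measure set E -> \bar R}) (T B : R).
Hypotheses (T0 : 0 < T)
  (mnu : forall A, measurable A -> measurable_fun [set: measurableTypeR R] (fun t => nu t A))
  (nu1 : forall t, (nu t setT <= 1)%E)
  (nuB : forall t, 0 <= t <= T -> (\int[nu t]_x (1 + enorm x ^+ 2)%:E <= B%:E)%E).

Let mE : measurable_fun setT (fun x : E => (1 + enorm x ^+ 2)%:E).
Proof.
apply/measurable_EFinP; apply: measurable_funD => //; exact: measurable_enorm2.
Qed.

Lemma stein_abs_integral_le (t C : R) phi : 0 <= t <= T -> ball phi -> 0 <= C ->
  (forall x : E, `|stein V phi x| <= C * (1 + enorm x ^+ 2)) ->
  (\int[nu t]_x `|stein V phi x|%:E <= (C * B)%:E)%E.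
Proof.
move=> tT phiB C0 hC.
apply: (@le_trans _ _ (\int[nu t]_x (C%:E * (1 + enorm x ^+ 2)%:E))%E).
  by apply: le_lower_integral => x _; rewrite -?EFinM lee_fin.
rewrite ge0_integralZl_EFin//; last first.
  by move=> x _; rewrite lee_fin addr_ge0// sqr_ge0.
by rewrite EFinM lee_wpmul2l ?lee_fin// nuB.
Qed.

Lemma stein_time_average phi : ball phi ->
  leb.-integrable `[0, T] (fun t => (\int[nu t]_x stein V phi x)%:E) /\
  (\int[time_average nu T]_x (stein V phi x)%:E =
   (T^-1 * \int[leb]_(t in `[0%R, T]) (\int[nu t]_x stein V phi x)%R)%R%:E)%E.
Proof.
move=> phiB; have [C C0 hC] := stein_growth hV hk hH.
apply: (integral_time_average T0 mnu nu1 (B := C * B)).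
  exact: (measurable_stein hV hk hH).
by move=> t tT; apply: stein_abs_integral_le => // x; exact: hC.
Qed.

Lemma time_average_moment : exists2 m : {measure set E -> \bar R},
  m = time_average nu T :> (set E -> \bar R) &
  m.-integrable setT (fun x => (1 + enorm x ^+ 2)%:E).
Proof.
have [m mE'] := time_average_is_measure T0 mnu nu1; exists m => //.
apply/integrableP; split=> //.
under eq_integral do rewrite gee0_abs ?lee_fin ?addr_ge0 ?sqr_ge0//.
have p0 (x : E) : (0 <= (1 + enorm x ^+ 2)%:E)%E by rewrite lee_fin addr_ge0// sqr_ge0.
rewrite mE' (ge0_integral_time_average T0 mnu nu1 p0 mE).
apply: (@le_lt_trans _ _ ((T^-1)%:E * \int[leb]_(t in `[0%R, T]) B%:E)%E).
  rewrite lee_wpmul2l ?lee_fin ?invr_ge0 ?(ltW T0)//.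
  apply: le_lower_integral => t /=; first by move=> _; exact: integral_ge0.
  by rewrite in_itv/=; exact: nuB.
rewrite integral_cst//= lebesgue_measure_itv/= lte_fin T0.
by rewrite -EFinD -!EFinM ltry.
Qed.

End generic.

Variables (mu : R -> probability E R) (mu0 : probability E R).
Hypothesis hmu : mean_field_flow V k mu mu0.

(** Constant before time 0, where nothing is assumed about [mu]. *)
Definition mean_field_curve (t : R) : {measure set E -> \bar R} := mu (Num.max 0 t).

Lemma mean_field_curve_moment (T : R) : exists B : R, forall t, 0 <= t <= T ->
  (\int[mean_field_curve t]_x (1 + enorm x ^+ 2)%:E <= B%:E)%E.
Proof.
have [_ /(_ T)[M hM] _ _] := hmu; exists (1 + M) => t /[dup] /andP[t0 _] tT.
rewrite /mean_field_curve max_r//.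
under eq_integral do rewrite EFinD.
rewrite ge0_integralD//; last 2 first.
- by move=> x _; rewrite lee_fin sqr_ge0.
- apply/measurable_EFinP; exact: measurable_enorm2.
rewrite probability_integral_cst EFinD leeD2l//; exact: hM.
Qed.

Lemma mean_field_time_average (T : R) :
  time_average (fun t => mu t) T = time_average mean_field_curve T.
Proof.
apply/funext => A; congr (_ * _)%E; apply: eq_integral => t.
by rewrite inE /= in_itv/= => /andP[t0 _]; rewrite /mean_field_curve max_r.
Qed.

Definition stein_limit (phi : E -> E) (T : R) : R :=
  T^-1 * \int[leb]_(t in `[0, T]) (\int[mean_field_curve t]_x stein V phi x).

Lemma mean_field_curve_measurable A : measurable A ->
  measurable_fun [set: measurableTypeR R] (fun t => mean_field_curve t A).
Proof. exact: (mean_field_measurable hmu). Qed.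

Lemma mean_field_curve_le1 t : (mean_field_curve t setT <= 1)%E.
Proof. exact: probability_le1. Qed.

Lemma stein_limitE phi T : 0 < T -> ball phi ->
  leb.-integrable `[0, T] (fun t => (\int[mean_field_curve t]_x stein V phi x)%:E) /\
  (\int[time_average (fun t => mu t) T]_x (stein V phi x)%:E = (stein_limit phi T)%:E)%E.
Proof.
move=> T0 phiB; have [B hB] := mean_field_curve_moment T.
rewrite mean_field_time_average.
exact: (stein_time_average T0 mean_field_curve_measurable mean_field_curve_le1 hB phiB).
Qed.

Lemma stein_limitN phi T : 0 < T -> ball phi ->
  stein_limit (fun x => - phi x) T = - stein_limit phi T.
Proof.
move=> T0 phiB; have [_ e1] := stein_limitE T0 phiB.
have [_ e2] := stein_limitE T0 (product_ballN hH phiB).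
apply: EFin_inj; rewrite -e2 EFinN -e1.
have [B hB] := mean_field_curve_moment T.
have [m mE im] := time_average_moment T0 mean_field_curve_measurable mean_field_curve_le1 hB.
rewrite mean_field_time_average -mE.
under eq_integral do rewrite (steinN V hH hk _ phiB) EFinN.
rewrite integralN//; apply: (integrable_add_def measurableT).
exact: (stein_integrable hV hk hH im phiB).
Qed.

Context {N : nat} (N0 : (0 < N)%N).
Local Notation M := 'M[R]_(N, d).
Variables (Y : R -> M) (y0 : M).
Hypothesis hY : particle_flow V k Y y0.

Lemma second_moment_empirical (x : M) : second_moment (empirical x) = (mean_square x)%:E.
Proof.
rewrite /second_moment integral_empirical; last exact: measurable_enorm2.
congr (_ * _)%:E; rewrite -(pair_bigA _ (fun i j => x i j ^+ 2))/=.
by apply: eq_bigr => l _; rewrite enormE; apply: eq_bigr => j _; rewrite mxE.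
Qed.

Definition stein_average (phi : E -> E) (x : M) : R := N%:R^-1 * \sum_l stein V phi (row l x).

Lemma stein_average_continuous phi : ball phi -> continuous (stein_average phi).
Proof.
move=> phiB; apply: contM; first exact: contC.
apply: cont_sum => l; apply: cont_comp; first exact: continuous_row.
exact: (stein_continuous hH hk (partial_continuous hV)).
Qed.

Lemma stein_average_sqr phi x : ball phi ->
  stein_average phi x ^+ 2 <= stein_mean V k x.
Proof.
move=> phiB; have := stein_bound V hH hk (fun _ => N%:R^-1) (fun l => row l x) phiB.
rewrite -mulr_sumr => /le_trans; apply; rewrite le_eqVlt; apply/predU1P; left.
rewrite /stein_mean mulrA mulr_sumr; apply: eq_bigr => i _.
by rewrite mulr_sumr.
Qed.

(** Young's inequality. Being linear in [stein_mean], the bound passes through time averages and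
    expectations as it stands, whereas a square root would call for Jensen at each stage. *)
Lemma stein_average_le phi x (e : R) : ball phi -> 0 < e ->
  stein_average phi x <= e / 2 * stein_mean V k x + e^-1 / 2.
Proof.
move=> phiB e0; have := stein_average_sqr x phiB.
move: (stein_average phi x) (stein_mean V k x) => u q uq.
have h : 0 <= e / 2 * (u - e^-1) ^+ 2 by rewrite mulr_ge0 ?sqr_ge0 ?divr_ge0// ltW.
have h2 : e / 2 * u ^+ 2 <= e / 2 * q by rewrite ler_wpM2l ?divr_ge0// ltW.
rewrite -(lerD2r (e / 2 * (u - e^-1) ^+ 2)).
have -> : u + e / 2 * (u - e^-1) ^+ 2 = e / 2 * u ^+ 2 + e^-1 / 2.
  by field; rewrite gt_eqF.
by apply: le_trans (_ : e / 2 * q + e^-1 / 2 <= _); rewrite ?lerD2r// lerDl.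
Qed.

Definition empirical_curve (t : R) : {measure set E -> \bar R} := empirical (Xext Y t).

Let cY : continuous (Xext Y).
Proof. by have [_ cX _] := hY; exact: Xext_continuous cX. Qed.

Lemma empirical_curve_measurable A : measurable A ->
  measurable_fun [set: measurableTypeR R] (fun t => empirical_curve t A).
Proof.
move=> mA; apply: measurable_funeM; apply: emeasurable_sum => i.
rewrite (_ : (fun t => _) = (EFin \o (\1_A : E -> R)) \o (fun t => row i (Xext Y t))); last first.
  by apply/funext => t; rewrite /= diracE indicE.
apply: (@measurableT_comp _ _ _ _ E); first by apply/measurable_EFinP; exact: measurable_indic.
apply/measurable_fun_mxP => a j; apply: continuous_measurable_fun.
rewrite (_ : (fun t => _) = (fun t => (Xext Y t) i j)); last by apply/funext => t; rewrite mxE.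
exact: (@cont_comp R M R _ (fun x : M => x i j) cY (@continuous_mx_entry R N d i j)).
Qed.

Lemma empirical_curve_le1 t : (empirical_curve t setT <= 1)%E.
Proof.
have -> : empirical_curve t setT =
    ((N%:R^-1)%:E * \sum_(i < N) \d_(row i (Xext Y t)) (setT : set E))%E by [].
rewrite (eq_bigr (fun _ => 1%:E)); last by move=> i _; rewrite diracT.
rewrite sumEFin sumr_const card_ord -EFinM lee_fin mulVf// pnatr_eq0.
by rewrite -lt0n.
Qed.

Lemma empirical_moment (x : M) :
  (\int[empirical x]_y (1 + enorm y ^+ 2)%:E)%E = (1 + mean_square x)%:E.
Proof.
rewrite integral_empirical; last by apply: measurable_funD => //; exact: measurable_enorm2.
rewrite big_split/= sumr_const card_ord mulrDr mulVf ?pnatr_eq0 -?lt0n//.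
rewrite EFinD [RHS]EFinD; congr (_ + _)%E.
by rewrite -second_moment_empirical /second_moment integral_empirical//; exact: measurable_enorm2.
Qed.

Lemma empirical_curve_moment (T : R) : exists B : R, forall t, 0 <= t <= T ->
  (\int[empirical_curve t]_x (1 + enorm x ^+ 2)%:E <= B%:E)%E.
Proof.
have cm : continuous (fun t => 1 + mean_square (Xext Y t)).
  by apply: contD; [exact: contC|exact: (cont_comp cY (@mean_square_continuous R N d))].
have [T0|T0] := leP 0 T; last first.
  by exists 0 => t /andP[t0 tT]; have := le_lt_trans (le_trans t0 tT) T0; rewrite ltxx.
have [c _ hc] := EVT_max T0 (continuous_subspaceT cm).
exists (1 + mean_square (Xext Y c)) => t tT.
by rewrite empirical_moment lee_fin; apply: hc; rewrite in_itv.
Qed.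

Lemma empirical_time_average (T : R) :
  time_average (fun t => empirical (Y t)) T = time_average empirical_curve T.
Proof.
apply/funext => A; congr (_ * _)%E; apply: eq_integral => t.
by rewrite inE /= in_itv/= => /andP[t0 _]; rewrite /empirical_curve XextE.
Qed.

Lemma Rintegral_stein_empirical phi x : ball phi ->
  \int[empirical x]_y stein V phi y = stein_average phi x.
Proof.
move=> phiB; rewrite /Rintegral integral_empirical//.
exact: (measurable_stein hV hk hH).
Qed.

Lemma stein_empiricalE phi T : 0 < T -> ball phi ->
  (\int[time_average (fun t => empirical (Y t)) T]_x (stein V phi x)%:E =
   (T^-1 * prim (stein_average phi \o Xext Y) T)%:E)%E.
Proof.
move=> T0 phiB; have [B hB] := empirical_curve_moment T.
rewrite empirical_time_average.
have [_ ->] := stein_time_average T0 empirical_curve_measurable empirical_curve_le1 hB phiB.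
congr (_ * _)%:E; rewrite /prim /Rintegral; congr fine; apply: eq_integral => t _.
by congr EFin; exact: Rintegral_stein_empirical.
Qed.

Local Notation ksd T := (KSD V H ip (time_average (fun t => empirical (Y t)) T)
  (time_average (fun t => mu t) T)).

Definition stein_gap phi T : R := T^-1 * prim (stein_average phi \o Xext Y) T - stein_limit phi T.

Lemma ksd_ub phi T : 0 < T -> ball phi -> ((stein_gap phi T)%:E <= ksd T)%E.
Proof.
move=> T0 phiB; apply: ereal_sup_ubound; exists phi => //.
by have [_ ->] := stein_limitE T0 phiB; rewrite stein_empiricalE.
Qed.

Lemma ksd_le T (b : \bar R) : 0 < T ->
  (forall phi, ball phi -> ((stein_gap phi T)%:E <= b)%E) -> (ksd T <= b)%E.
Proof.
move=> T0 hb; apply: ge_ereal_sup => _ [phi phiB <-].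
by have [_ ->] := stein_limitE T0 phiB; rewrite stein_empiricalE// -EFinB; exact: hb.
Qed.

Lemma ksd_ge0 T : 0 < T -> (0 <= ksd T)%E.
Proof.
move=> T0; apply: le_trans (ksd_ub T0 (product_ball0 hH)).
have s0 : stein V (fun _ : E => 0 : E) = (fun _ => 0).
  by apply/funext => x; exact: (stein0 V hH hk).
have rint0 (m : {measure set E -> \bar R}) : \int[m]_x (0 : R) = 0 by rewrite /Rintegral integral0.
have lint0 : \int[leb]_(t in `[0, T]) (0 : R) = 0 by rewrite /Rintegral integral0.
have l0 : stein_limit (fun _ : E => 0 : E) T = 0.
  rewrite /stein_limit s0 (_ : (fun t => _) = (fun _ => 0)) ?lint0 ?mulr0//.
  by apply/funext => t; exact: rint0.
have p0 : prim (stein_average (fun _ : E => 0 : E) \o Xext Y) T = 0.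
  rewrite /prim (_ : _ \o _ = (fun _ => 0)) ?lint0//.
  by apply/funext => t; rewrite /stein_average /= s0 big1 ?mulr0.
by rewrite lee_fin /stein_gap l0 p0 mulr0 subr0.
Qed.

Lemma ksd_countable T : 0 < T -> ksd T = ereal_sup (range (fun n =>
  (stein_gap (ball_enum V H ip n) T)%:E)).
Proof.
move=> T0; have [B1 hB1] := empirical_curve_moment T.
have [B2 hB2] := mean_field_curve_moment T.
have [m1 m1E im1] := time_average_moment T0 empirical_curve_measurable empirical_curve_le1 hB1.
have [m2 m2E im2] := time_average_moment T0 mean_field_curve_measurable mean_field_curve_le1 hB2.
rewrite empirical_time_average mean_field_time_average -m1E -m2E.
rewrite (KSD_countable hV hk hH im1 im2) m1E m2E -empirical_time_average -mean_field_time_average.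
congr ereal_sup; apply: eq_imagel => n _.
have nB := ball_enum_ball V hH n.
by have [_ ->] := stein_limitE T0 nB; rewrite stein_empiricalE.
Qed.

Lemma stein_gap_le phi T (b : R) : 0 < T -> ball phi ->
  (forall t, 0 <= t <= T -> ((\int[empirical (Y t)]_x (stein V phi x)%:E -
     \int[mu t]_x (stein V phi x)%:E) <= b%:E)%E) -> stein_gap phi T <= b.
Proof.
move=> T0 phiB hb; have [iL _] := stein_limitE T0 phiB.
have cA : continuous (stein_average phi \o Xext Y).
  exact: (cont_comp cY (stein_average_continuous phiB)).
have iA := continuous_itv_integrable cA 0 T.
rewrite /stein_gap /stein_limit -mulrBr ler_pdivrMl//.
rewrite -RintegralB//.
apply: (@le_trans _ _ (\int[leb]_(t in `[0, T]) b)); last first.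
  by rewrite Rintegral_itv_cst// mulrC.
apply: le_Rintegral => //.
- by apply: (eq_integrable _ _ _ _ (integrableB _ iA iL)) => // t _; rewrite /= EFinB.
- by apply: continuous_itv_integrable; exact: contC.
move=> t; rewrite /= in_itv/= => /[dup] /andP[t0 _] tT.
have := hb t tT.
rewrite integral_empirical; last exact: (measurable_stein hV hk hH).
have [B hB] := mean_field_curve_moment T; have [C C0 hC] := stein_growth hV hk hH.
have mfin : (\int[mu t]_x (stein V phi x)%:E)%E \is a fin_num.
  apply: (@integrable_fin_num _ _ _ (mu t)) => //.
  apply/integrableP; split.
    by apply/measurable_EFinP; exact: (measurable_stein hV hk hH).
  have -> : mu t = mean_field_curve t :> {measure set E -> \bar R}.
    by rewrite /mean_field_curve max_r.
  apply: le_lt_trans (stein_abs_integral_le hB tT phiB C0 (hC phi ^~ phiB)) _.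
  by rewrite ltry.
rewrite -(fineK mfin) -EFinB lee_fin XextE// /mean_field_curve max_r//.
Qed.

(** For a fixed test function the gap of the time averages is the average of the gaps, each at most
    the KSD at its own time. *)
Lemma ksd_le_sup T S : 0 < T -> T <= S ->
  (ksd T <= ereal_sup [set KSD V H ip (empirical (Y s)) (mu s) | s in `[0%R, S]])%E.
Proof.
move=> T0 TS; apply: ksd_le => // phi phiB; set s := ereal_sup _.
have hs t : 0 <= t <= T -> ((\int[empirical (Y t)]_x (stein V phi x)%:E -
     \int[mu t]_x (stein V phi x)%:E) <= s)%E.
  move=> /andP[t0 tT]; apply: (@le_trans _ _ (KSD V H ip (empirical (Y t)) (mu t))).
    by apply: ereal_sup_ubound; exists phi.
  by apply: ereal_sup_ubound; exists t => //; rewrite /= in_itv/= t0 (le_trans tT).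
(* If the supremum were minus infinity, the gap would lie below every real, in particular below
   itself minus 1. *)
move: s hs => [b| |] hb; last 2 first.
- by rewrite leey.
- have : stein_gap phi T <= stein_gap phi T - 1.
    by apply: stein_gap_le => // t /hb; rewrite leeNy_eq => /eqP ->; rewrite leNye.
  by move: (stein_gap phi T) => u; rewrite lerBrDr gerDl ler10.
by rewrite lee_fin; exact: stein_gap_le.
Qed.

Lemma prim_affine_le (f q : R -> R) (al be T : R) : 0 < T -> continuous f -> continuous q ->
  (forall t, f t <= al * q t + be) -> T^-1 * prim f T <= al * (T^-1 * prim q T) + be.
Proof.
move=> T0 cf cq h.
have ic (g : R -> R) : continuous g -> leb.-integrable `[0, T] (EFin \o g).
  by move=> cg; exact: continuous_itv_integrable.
have cb : continuous (fun _ : R => be) by exact: contC.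
have cal : continuous (fun t => al * q t) by apply: contM => //; exact: contC.
rewrite ler_pdivrMl// mulrDr mulrCA mulVKf ?gt_eqF//.
apply: (@le_trans _ _ (prim (fun t => al * q t + be) T)).
  by apply: le_Rintegral => //; apply: ic => //; exact: contD.
rewrite /prim (RintegralD _ (ic _ cal) (ic _ cb))// RintegralZl//; last exact: ic.
by rewrite Rintegral_itv_cst// [be * _]mulrC.
Qed.

Lemma stein_gap_entropy phi T (e : R) : 0 < T -> 0 < e -> ball phi ->
  T^-1 * prim (stein_average phi \o Xext Y) T <=
  e / 2 * (T^-1 * prim (@stein_mean R N d V k \o Xext Y) T) + e^-1 / 2.
Proof.
move=> T0 e0 phiB; apply: prim_affine_le => //.
- exact: (cont_comp cY (stein_average_continuous phiB)).
- exact: (cont_comp cY (stein_mean_continuous hV hk (N := N))).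
- by move=> t; exact: stein_average_le.
Qed.

End time_averages.

(** * Rates *)

Section rates.
Context {R : realType}.

Lemma rsqrt_gt0 (T : R) : 0 < T -> 0 < T `^ (- 2^-1). Proof. exact: powR_gt0. Qed.

Lemma rsqrt_sqr (T : R) : 0 < T -> T `^ (- 2^-1) * T `^ (- 2^-1) = T^-1.
Proof.
move=> T0; rewrite -powRD; last by rewrite (gt_eqF T0) implybT.
rewrite (_ : - 2^-1 + - 2^-1 = -1); last by field.
by rewrite powR_inv1// ltW.
Qed.

Lemma rsqrt_le (S T : R) : 0 < S -> S <= T -> T `^ (- 2^-1) <= S `^ (- 2^-1).
Proof.
move=> S0 ST; have T0 : 0 < T by exact: lt_le_trans ST.
rewrite -ler_sqr ?nnegrE ?powR_ge0// !expr2 !rsqrt_sqr//.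
by rewrite lef_pV2 ?posrE.
Qed.

Lemma near_ln_ge (A : R) : \forall N \near \oo, A <= ln (N%:R : R).
Proof.
apply: filterS (nbhs_infty_ger (expR A)) => N AN.
rewrite -[A]expRK ler_ln ?posrE ?expR_gt0//.
by apply: lt_le_trans AN; exact: expR_gt0.
Qed.

Lemma near_natr_ge (A : R) : \forall N \near \oo, A <= (N%:R : R).
Proof. exact: nbhs_infty_ger. Qed.

Lemma near_powR_le (b e : R) : 0 < b -> 0 < e -> \forall N \near \oo, (N%:R : R) `^ (- b) <= e.
Proof.
move=> b0 e0; near=> N.
have N0 : 0 < N%:R :> R by rewrite ltr0n; near: N; exists 1%N.
rewrite /powR gt_eqF// -[e]lnK ?posrE// ler_expR mulNr -[leRHS]opprK lerN2.
rewrite -ler_pdivrMl//.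
by near: N; exact: near_ln_ge.
Unshelve. all: by end_near.
Qed.

Lemma ln_le_id (u : R) : 0 < u -> ln u <= u.
Proof. by move=> u0; exact: ltW (ln_sublinear u0). Qed.

(** With [v = expR (ln N / 2)] the square root of [N]: [ln N / 2 <= v], and [v] eventually exceeds
    [4 * de]. *)
Lemma near_delta_ln (de : R) : 0 < de -> \forall N \near \oo, de * ln (N%:R : R) <= N%:R.
Proof.
move=> de0; near=> N.
have N0 : 0 < N%:R :> R by rewrite ltr0n; near: N; exists 1%N.
have hN : 4 * de <= expR (ln (N%:R : R) / 2).
  have h : 2 * ln (4 * de) <= ln (N%:R : R) by near: N; exact: near_ln_ge.
  by rewrite -[leLHS]lnK ?posrE ?mulr_gt0// ler_expR ler_pdivlMr// mulrC.
have e1 : N%:R = expR (ln (N%:R : R) / 2) * expR (ln (N%:R : R) / 2) :> R.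
  by rewrite -expRD -splitr lnK ?posrE.
have h2 : ln (N%:R : R) / 2 <= expR (ln (N%:R : R) / 2).
  by apply: le_trans (expR_ge1Dx _); rewrite lerDr.
rewrite [leRHS]e1 (_ : de * _ = 2 * (de * (ln (N%:R : R) / 2))); last by field.
move: hN h2 (expR_gt0 (ln (N%:R : R) / 2)).
move: (ln _ / 2) (expR _) => u v hv uv v0.
have p1 : de * u <= de * v by rewrite ler_wpM2l// ltW.
have p2 : 4 * de * v <= v * v by rewrite ler_wpM2r// ltW.
have p3 : 0 <= de * v by rewrite mulr_ge0// ltW.
by move: p1 p2 p3; rewrite -mulrA; move: (de * u) (de * v) (v * v) => *; lra.
Unshelve. all: by end_near.
Qed.

End rates.

(** * Passage to the mean field and the estimate on the moment event *)

Section concentration.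
Context {R : realType} {d : nat}.
Local Notation E := 'rV[R]_d.
Variables (V : E -> R) (k : E -> E -> R) (pi : probability E R).
Variables (H : set (E -> R)) (ip : (E -> R) -> (E -> R) -> R).
Context {dO : measure_display} {Om : measurableType dO} (P : probability Om R).
Variables (x0 : forall N, {RV P >-> 'M[R]_(N, d)}) (X : forall N, Om -> R -> 'M[R]_(N, d)).
Variables (mu0 : probability E R) (mu : R -> probability E R) (beta C0 c0 : R).
Hypotheses (hK : kernel_assumption k) (hH : is_rkhs k H ip) (hV : target_assumption V pi)
  (hinit : initial_assumption pi mu0 x0 beta)
  (hCstar : exists M : R, forall z, Cstar V k z <= M)
  (hX : forall (N : nat) (w : Om), (0 < N)%N -> particle_flow V k (X N w) (x0 N w))
  (hmu : mean_field_flow V k mu mu0).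
Hypothesis hC0 : forall (r : R) (N : nat) (t : R), 0 < r -> (3 <= N)%N -> 0 <= t ->
    (\int[P]_(w in moment_event (x0 N) r)
       ereal_sup [set KSD V H ip (empirical (X N w s)) (mu s) | s in `[0%R, t]]
     <= (C0 * N%:R `^ (- (beta / 2))
         * expR (c0 * (1 + r) * expR (c0 * t)))%:E)%E.
Let hk := kernel_Cb4 hK.
Local Notation ball := (product_ball H ip).
Local Notation ksd N T w := (KSD V H ip (time_average (fun t => empirical (X N w t)) T)
  (time_average (fun t => mu t) T)).
Local Notation W N T w := (time_mean X (@stein_mean R N d V k) T w).

Lemma measurable_moment N : measurable_fun setT (fun w => mean_square (x0 N w)).
Proof.
apply: (@measurableT_comp _ _ _ _ 'M[R]_(N, d)); last exact: measurable_funPT.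
apply: continuous_mx_measurable; exact: mean_square_continuous.
Qed.

Lemma measurable_moment_event N r : measurable (moment_event (x0 N) r).
Proof.
rewrite (_ : moment_event _ _ = (fun w => mean_square (x0 N w)) @^-1` [set t | t <= r]).
  rewrite -[X in measurable X]setTI; apply: measurable_moment => //.
  by rewrite (_ : [set t | t <= r] = `]-oo, r]%classic)//; apply/seteqP; split=> t; rewrite /= in_itv.
by apply/seteqP; split => w; rewrite /moment_event /= second_moment_empirical lee_fin.
Qed.

(** Markov's inequality for [W2], which is at least 1 off the event by [W2_ge1]; the radius
    [2 + 2 * c] is the threshold there, with [c] the second moment of [mu0]. *)
Lemma moment_complement : exists r0 C : R, [/\ 0 < r0, 0 <= C & forall N, (0 < N)%N ->
  (P (~` moment_event (x0 N) r0) <= (C * N%:R `^ (- beta))%:E)%E].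
Proof.
have [C hC] := init_W2 hinit; have m2 := init_limit_moment hinit.
have m20 : (0 <= second_moment mu0)%E by apply: integral_ge0 => x _; rewrite lee_fin sqr_ge0.
pose c := fine (second_moment mu0).
have cE : (second_moment mu0 <= c%:E)%E.
  by rewrite /c fineK// ge0_fin_numE.
have c0' : 0 <= c by rewrite fine_ge0.
exists (2 + 2 * c), `|C|; split=> // [|N N0]; first by rewrite ltr_wpDr// mulr_ge0.
have mA : measurable (~` moment_event (x0 N) (2 + 2 * c)).
  by apply: measurableC; exact: measurable_moment_event.
rewrite -(setIT (~` _)) -integral_indic//.
apply: (@le_trans _ _ (\int[P]_w W2 (empirical (x0 N w)) mu0)%E).
  apply: le_lower_integral => w _; first by rewrite lee_fin.
  rewrite indicE; case: (w \in _) / idP => [|_]; last by rewrite /W2 sqrte_ge0.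
  rewrite inE /moment_event /= => /negP; rewrite -ltNge => wE.
  exact: (W2_ge1 cE wE).
by apply: (le_trans (hC N N0)); rewrite lee_fin ler_wpM2r ?powR_ge0// ler_norm.
Qed.

(** By [ksd_countable] the KSD is a countable supremum of time means, each measurable through the
    splitting scheme. *)
Lemma measurable_ksd N T : (0 < N)%N -> 0 < T -> measurable_fun setT (fun w => ksd N T w).
Proof.
move=> N0 T0.
have e : (fun w => ksd N T w) = (fun w => ereal_sup (range (fun n =>
    (time_mean X (@stein_average R d V N (ball_enum V H ip n)) T w - stein_limit V mu (ball_enum V H ip n) T)%:E))).
  by apply/funext => w; exact: (ksd_countable hV hk hH hmu N0 (hX w N0) T0).
rewrite e; pose f n w := (time_mean X (@stein_average R d V N (ball_enum V H ip n)) T w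
  - stein_limit V mu (ball_enum V H ip n) T)%:E.
have mf n : measurable_fun setT (f n).
  apply/measurable_EFinP; apply: measurable_funB => //.
  apply: (measurable_time_mean hV hk hX N0 T0).
  exact: (stein_average_continuous hV hk hH (ball_enum_ball V hH n)).
have := measurable_fun_esups mf 0.
rewrite (_ : (fun w => esups (f^~ w) 0) = (fun w => ereal_sup (range (f^~ w))))//.
apply/funext => w; rewrite /esups /sdrop; congr ereal_sup.
by apply/seteqP; split => _ [n _ <-]; exists n.
Qed.

Lemma ksd_event_le r N T S : 0 < r -> (3 <= N)%N -> 0 < T -> T <= S ->
  (\int[P]_(w in moment_event (x0 N) r) ksd N T w <=
   (C0 * N%:R `^ (- (beta / 2)) * expR (c0 * (1 + r) * expR (c0 * S)))%:E)%E.
Proof.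
move=> r0 N3 T0 TS; have N0 : (0 < N)%N by exact: leq_trans N3.
apply: le_trans (hC0 r0 N3 (le_trans (ltW T0) TS)).
apply: le_lower_integral => w _; first exact: (ksd_ge0 hV hk hH hmu N0 (hX w N0) T0).
exact: (ksd_le_sup hV hk hH hmu N0 (hX w N0) T0 TS).
Qed.

Lemma stein_gapN N (w : Om) phi T : (0 < N)%N -> 0 < T -> ball phi ->
  stein_gap V mu (X N w) (fun x => - phi x) T = - stein_gap V mu (X N w) phi T.
Proof.
move=> N0 T0 phiB; rewrite /stein_gap (stein_limitN hV hk hH hmu T0 phiB).
have cY : continuous (Xext (X N w)) by have [_ cX _] := hX w N0; exact: Xext_continuous cX.
have cA := cont_comp cY (stein_average_continuous hV hk hH phiB (N := N)).
have -> : prim (stein_average V (fun x => - phi x) \o Xext (X N w)) T =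
    - prim (stein_average V phi \o Xext (X N w)) T.
  rewrite -mulN1r /prim -RintegralZl//; last exact: continuous_itv_integrable.
  congr Rintegral; apply/funext => t; rewrite /stein_average /= mulrCA.
  congr (_ * _); rewrite mulN1r -sumrN.
  by apply: eq_bigr => l _; rewrite (steinN V hH hk _ phiB).
ring.
Qed.

(** The mean-field average is the particle average minus the gap: the first is bounded through
    [stein_mean], the second, tested with [- phi], by the KSD. *)
Lemma stein_limit_le N (w : Om) phi T e : (0 < N)%N -> 0 < T -> 0 < e -> ball phi ->
  ((stein_limit V mu phi T)%:E <= (e / 2 * W N T w + e^-1 / 2)%:E + ksd N T w)%E.
Proof.
move=> N0 T0 e0 phiB.
have h1 := stein_gap_entropy hV hk hH (hX w N0) T0 e0 phiB.
have h2 := ksd_ub hV hk hH hmu N0 (hX w N0) T0 (product_ballN hH phiB).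
rewrite stein_gapN// in h2.
apply: le_trans (leeD2l _ h2); rewrite -EFinD lee_fin /stein_gap.
rewrite -/(time_mean X _ T w) in h1 *.
by move: h1; rewrite /time_mean; lra.
Qed.

Lemma W_ge0 N T w : 0 < T -> 0 <= W N T w.
Proof.
move=> T0; rewrite mulr_ge0 ?invr_ge0 ?(ltW T0)//; apply: prim_ge0 => t.
exact: (stein_mean_ge0 V hk hH).
Qed.

Lemma measurable_W N T : (0 < N)%N -> 0 < T -> measurable_fun setT (fun w => W N T w).
Proof.
move=> N0 T0; apply: (measurable_time_mean hV hk hX N0 T0).
exact: (stein_mean_continuous hV hk).
Qed.

Lemma W_affine_le c N T (A : set Om) (p e b : R) : (0 < N)%N -> 0 < T -> 0 <= e -> 0 <= b ->
  (\int[P]_w (W N T w)%:E <= c%:E)%E -> measurable A -> (P A <= p%:E)%E ->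
  (\int[P]_(w in A) (e * W N T w + b)%:E <= (e * c + b * p)%:E)%E.
Proof.
move=> N0 T0 e0 b0 Wc mA Ap.
have mW := measurable_W N0 T0.
have mWA : measurable_fun A (fun w => (W N T w)%:E).
  by apply: measurable_funTS; exact/measurable_EFinP.
under eq_integral do rewrite EFinD EFinM.
rewrite ge0_integralD//; last 2 first.
- by move=> w _; rewrite -EFinM lee_fin mulr_ge0// W_ge0.
- exact: measurable_funeM.
rewrite ge0_integralZl_EFin//; last by move=> w _; rewrite lee_fin W_ge0.
rewrite integral_cst// EFinD !EFinM; apply: leeD; last by rewrite lee_wpmul2l.
rewrite lee_wpmul2l//; apply: le_trans Wc.
apply: ge0_subset_integral => //; last by move=> w _; rewrite lee_fin W_ge0.
exact/measurable_EFinP.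
Qed.

(* The entropy estimate for the particles passes to the mean-field flow as N goes
   to infinity at fixed T, since the moment event has probability tending to 1. *)
Lemma limit_bound : exists2 CF : R, 0 <= CF & forall phi T, 0 < T -> ball phi ->
  stein_limit V mu phi T <= CF * T `^ (- 2^-1).
Proof.
have [c c_ge0 hc] := entropy_bound hV hk hH hinit hCstar hX.
have [r0 [C [r00 C_ge0 hC]]] := moment_complement.
exists (c + 1) => [|phi T T0 phiB]; first by rewrite addr_ge0.
(* Once [a] is positive, [a * P A] is bounded below by [a / 2]. *)
have [a0|a0] := leP (stein_limit V mu phi T) 0.
  by apply: (le_trans a0); rewrite mulr_ge0 ?addr_ge0 ?powR_ge0.
set a := stein_limit _ _ _ _ in a0 *; set s := T `^ (- 2^-1).
have s0 : 0 < s by exact: rsqrt_gt0.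
have ss : s * s = T^-1 by exact: rsqrt_sqr.
pose Kr := `|C0| * expR (c0 * (1 + r0) * expR (c0 * T)).
have Kr0 : 0 <= Kr by rewrite mulr_ge0// expR_ge0.
have b20 : 0 < beta / 2 by rewrite divr_gt0// (init_rate_gt0 hinit).
(* The factor 1/2 on [a] is the lower bound on the probability of the moment event; [eta] absorbs
   the terms that vanish as [N] grows. *)
suff main eta : 0 < eta -> a / 2 <= (c + 1) * s / 2 + eta.
  apply/ler_addgt0Pr => eta eta0.
  have := main (eta / 2) (divr_gt0 eta0 (ltr0n _ 2)); lra.
move=> eta0; have e3 : 0 < eta / 3 by rewrite divr_gt0.
have e3K : 0 < eta / 3 / (Kr + 1) by rewrite divr_gt0// ltr_wpDl.
have e3C : 0 < 2^-1 / (C + 1) by rewrite divr_gt0// ltr_wpDl.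
have sc0 : 0 <= s^-1 * c by rewrite mulr_ge0// invr_ge0 ltW.
near \oo => N.
have N3 : (3 <= N)%N by near: N; exists 3%N.
have N0 : (0 < N)%N by exact: leq_trans N3.
have NR : 0 < N%:R :> R by rewrite ltr0n.
have hN1 : N%:R `^ (- (beta / 2)) <= eta / 3 / (Kr + 1).
  by near: N; apply: near_powR_le.
have hN2 : N%:R `^ (- beta) <= 2^-1 / (C + 1).
  by near: N; apply: near_powR_le => //; exact: (init_rate_gt0 hinit).
have hN3 : s^-1 * c / (eta / 3) <= N%:R by near: N; exact: near_natr_ge.
pose A := moment_event (x0 N) r0.
have mA : measurable A by exact: measurable_moment_event.
have pA : (2^-1%:E <= P A)%E.
  have := hC N N0; rewrite -/A probability_setC// => h.
  have : (1 - P A <= (2^-1)%:E)%E.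
    apply: (le_trans h); rewrite lee_fin; apply: (@le_trans _ _ ((C + 1) * N%:R `^ (- beta))).
      by rewrite ler_wpM2r ?powR_ge0// lerDl.
    by rewrite mulrC -ler_pdivlMr// ltr_wpDl.
  have : P A \is a fin_num by exact: fin_num_measure.
  case: (P A) => [p| |]// _; rewrite -EFinB !lee_fin; lra.
have e1_ge0 : 0 <= s^-1 / 2 by rewrite divr_ge0// invr_ge0 ltW.
have e2_ge0 : 0 <= s^-1^-1 / 2 by rewrite invrK divr_ge0// ltW.
(* Young's parameter is [s^-1], the square root of [T], which balances [e * c / T] against
   [1 / e]. *)
have key : (a%:E * P A <= (s^-1 / 2 * (c / T + c / N%:R) + s^-1^-1 / 2 * 1)%:E
    + (C0 * N%:R `^ (- (beta / 2)) * expR (c0 * (1 + r0) * expR (c0 * T)))%:E)%E.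
  rewrite -integral_cst//.
  apply: (@le_trans _ _ (\int[P]_(w in A) ((s^-1 / 2 * W N T w + s^-1^-1 / 2)%:E + ksd N T w))%E).
    apply: le_lower_integral => w _ /=; first by rewrite lee_fin ltW.
    by apply: stein_limit_le => //; rewrite invr_gt0.
  rewrite ge0_integralD//; first last.
  - by apply: measurable_funTS; exact: measurable_ksd.
  - by move=> w _; exact: (ksd_ge0 hV hk hH hmu N0 (hX w N0) T0).
  - apply: measurable_funTS; apply/measurable_EFinP; apply: measurable_funD => //.
    by apply: measurable_funM => //; exact: measurable_W.
  - by move=> w _; rewrite lee_fin addr_ge0// mulr_ge0// W_ge0.
  apply: leeD; last exact: ksd_event_le.
  apply: W_affine_le => //.
  - exact: hc.
  - exact: probability_le1.
have h1 : a / 2 <= s^-1 / 2 * (c / T + c / N%:R) + s^-1^-1 / 2 * 1 +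
    C0 * N%:R `^ (- (beta / 2)) * expR (c0 * (1 + r0) * expR (c0 * T)).
  rewrite -lee_fin EFinD; apply: le_trans key.
  by rewrite EFinM lee_wpmul2l// lee_fin ltW.
apply: (le_trans h1); rewrite invrK mulr1.
have h2 : s^-1 / 2 * (c / T) = c * s / 2.
  by rewrite -ss; field; rewrite gt_eqF.
have h3 : s^-1 / 2 * (c / N%:R) <= eta / 3.
  move: hN3; rewrite ler_pdivrMr// => hN3.
  rewrite (_ : _ * (c / _) = s^-1 * c / N%:R / 2); last by field; rewrite !gt_eqF.
  have : s^-1 * c / N%:R <= eta / 3 by rewrite ler_pdivrMr// [eta / 3 * _]mulrC.
  have : 0 <= s^-1 * c / N%:R by rewrite divr_ge0// ltW.
  lra.
have h4 : C0 * N%:R `^ (- (beta / 2)) * expR (c0 * (1 + r0) * expR (c0 * T)) <= eta / 3.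
  apply: (@le_trans _ _ (Kr * N%:R `^ (- (beta / 2)))).
    rewrite mulrAC /Kr; apply: ler_wpM2r; first exact: powR_ge0.
    by apply: ler_wpM2r; [exact: expR_ge0|exact: ler_norm].
  apply: (@le_trans _ _ ((Kr + 1) * N%:R `^ (- (beta / 2)))).
    by rewrite ler_wpM2r ?powR_ge0// lerDl.
  by rewrite mulrC -ler_pdivlMr// ltr_wpDl.
rewrite mulrDr h2; move: h3 h4.
move: (s^-1 / 2 * (c / N%:R)) (C0 * _ * _) => u v hu hv.
rewrite mulrDl mul1r mulrDl; lra.
Unshelve. all: by end_near.
Qed.

(** The event is left free: the moment event serves long averaging times, its complement the bound
    in mean. Young's constant and the mean-field part do not depend on the sample, so they carry the
    factor [p]. *)
Lemma ksd_entropy_le : exists2 c : R, 0 <= c &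
  forall N T (A : set Om) (p e : R), (0 < N)%N -> 0 < T -> 0 < e -> measurable A ->
    (P A <= p%:E)%E ->
    (\int[P]_(w in A) ksd N T w <=
     (e * (c / T + c / N%:R) + (e^-1 + c * T `^ (- 2^-1)) * p)%:E)%E.
Proof.
have [c c_ge0 hc] := entropy_bound hV hk hH hinit hCstar hX.
have [CF CF0 hCF] := limit_bound.
exists (c + CF) => [|N T A p e N0 T0 e0 mA Ap]; first exact: addr_ge0.
have s0 := rsqrt_gt0 T0; set s := T `^ _ in s0 *.
have NR : 0 < N%:R :> R by rewrite ltr0n.
have p0 : 0 <= p by rewrite -lee_fin; apply: le_trans Ap.
have ei0 : 0 <= e^-1 by rewrite invr_ge0 ltW.
have ptw w : (ksd N T w <= (e * W N T w + (e^-1 + CF * s))%:E)%E.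
  apply: (ksd_le hV hk hH hmu N0 (hX w N0) T0) => phi phiB.
  have h1 := stein_gap_entropy hV hk hH (hX w N0) T0 e0 phiB.
  have h2 := hCF _ _ T0 (product_ballN hH phiB).
  rewrite (stein_limitN hV hk hH hmu T0 phiB) -/s in h2.
  rewrite -/(time_mean X _ T w) in h1.
  have w0 := W_ge0 N w T0; rewrite lee_fin /stein_gap.
  move: h1 h2 w0; rewrite /time_mean.
  move: (T^-1 * prim (stein_average _ _ \o _) T) (T^-1 * prim _ T) (stein_limit _ _ _ _) (CF * s).
  move=> u v l b hu hl v0.
  have := mulr_ge0 (ltW e0) v0; move: hu ei0; move: (e^-1) => ei.
  by rewrite mulrAC; move: (e * v) => ev hu ? ?; lra.
apply: (@le_trans _ _ (\int[P]_(w in A) (e * W N T w + (e^-1 + CF * s))%:E)%E).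
  apply: le_lower_integral => w _ //; exact: (ksd_ge0 hV hk hH hmu N0 (hX w N0) T0).
have b0 : 0 <= e^-1 + CF * s by rewrite addr_ge0// mulr_ge0// ltW.
apply: (le_trans (W_affine_le N0 T0 (ltW e0) b0 (hc N T N0 T0) mA Ap)).
rewrite lee_fin; apply: lerD.
  rewrite ler_wpM2l ?(ltW e0)//; apply: lerD; apply: ler_wpM2r; rewrite ?invr_ge0 ?lerDl// ltW//.
rewrite ler_wpM2r// lerD2l ler_wpM2r ?(ltW s0)// lerDr//.
Qed.

Lemma ksd_moment_event_le : exists2 C : R, 0 < C & forall delta : R, 0 < delta ->
  \forall N \near \oo, forall r T, 0 < r -> 0 < T ->
    (\int[P]_(w in moment_event (x0 N) r) ksd N T w <=
      (C * N%:R `^ (- (beta / 2)) * expR (c0 * (1 + r) * ln N%:R `^ (c0 * delta))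
       + C * (delta * ln (ln N%:R)) `^ (- 2^-1))%:E)%E.
Proof.
have [c c_ge0 hc] := ksd_entropy_le.
(* [C0] serves short times. On long ones, with Young's parameter the square root of [tau], [2 * c]
   comes from the two entropy terms, 1 from Young's constant and the last [c] from the mean-field
   bound. *)
exists (`|C0| + (2 * c + 1 + c)) => [|de de0].
  by rewrite ltr_wpDl// ltr_wpDr// ltr_wpDl// mulr_ge0.
near=> N => r T r0 T0.
have N3 : (3 <= N)%N by near: N; exists 3%N.
have N0 : (0 < N)%N by exact: leq_trans N3.
have NR : 0 < N%:R :> R by rewrite ltr0n.
have lnN : expR 1 <= ln (N%:R : R) by near: N; exact: near_ln_ge.
have lnN0 : 0 < ln (N%:R : R) by apply: lt_le_trans lnN; exact: expR_gt0.
have llN : 1 <= ln (ln (N%:R : R)).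
  by rewrite -[leLHS]expRK ler_ln ?posrE ?expR_gt0.
have deN : de * ln (N%:R : R) <= N%:R.
  near: N; exact: near_delta_ln.
set tau := de * ln (ln N%:R).
have tau0 : 0 < tau by rewrite mulr_gt0// (lt_le_trans ltr01).
(* This absorbs the term [c / N] of the entropy estimate, which does not decay in [T]. *)
have tauN : tau <= N%:R.
  by apply: le_trans deN; rewrite ler_pM2l// ln_le_id.
set C := `|C0| + _; set s := tau `^ (- 2^-1).
have s0 : 0 < s by exact: rsqrt_gt0.
have CC0 : C0 <= C by apply: (le_trans (ler_norm _)); rewrite /C lerDl !addr_ge0// mulr_ge0.
have C_ge0 : 0 <= C by rewrite /C !addr_ge0// mulr_ge0.
have Cc : 2 * c + 1 + c <= C by rewrite /C lerDr.
(* The origin of the double logarithm: at time [tau] the growth [expR (c0 * tau)] is only a power of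
   [ln N]. *)
have etau : expR (c0 * tau) = ln (N%:R : R) `^ (c0 * de).
  by rewrite /powR gt_eqF// /tau mulrA.
have exp0 := expR_ge0 (c0 * (1 + r) * ln (N%:R : R) `^ (c0 * de)).
have [Ttau|tauT] := leP T tau.
  apply: (le_trans (ksd_event_le r0 N3 T0 Ttau)); rewrite etau lee_fin.
  apply: (@le_trans _ _ (C * N%:R `^ (- (beta / 2)) * expR (c0 * (1 + r) * ln N%:R `^ (c0 * de)))).
    by rewrite ler_wpM2r// ler_wpM2r// powR_ge0.
  by rewrite lerDl mulr_ge0// ltW.
have si0 : 0 < s^-1 by rewrite invr_gt0.
have mA := measurable_moment_event N r.
have PA1 : (P (moment_event (x0 N) r) <= 1%:E)%E by exact: probability_le1.
apply: (le_trans (hc N T _ 1 s^-1 N0 T0 si0 mA PA1)); rewrite lee_fin mulr1 invrK.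
have ss : s * s = tau^-1 by exact: rsqrt_sqr.
have h1 : c / T <= c / tau by rewrite ler_wpM2l// lef_pV2 ?posrE// ltW.
have h2 : c / N%:R <= c / tau by rewrite ler_wpM2l// lef_pV2 ?posrE.
have h3 : s^-1 * (c / T + c / N%:R) <= 2 * c * s.
  apply: (@le_trans _ _ (s^-1 * (c / tau + c / tau))).
    by rewrite ler_wpM2l ?(ltW si0)// lerD.
  rewrite le_eqVlt; apply/predU1P; left.
  by rewrite -ss; field; rewrite gt_eqF.
have h4 : c * T `^ (- 2^-1) <= c * s by rewrite ler_wpM2l// rsqrt_le// ltW.
have h5 : (2 * c + 1 + c) * s <= C * s by rewrite ler_wpM2r// ltW.
apply: (@le_trans _ _ (C * s)).
  by apply: le_trans h5; move: h3 h4; rewrite !mulrDl mul1r; lra.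
by rewrite lerDr mulr_ge0// mulr_ge0// powR_ge0.
Unshelve. all: by end_near.
Qed.

End concentration.

(** With this value of [delta] the power of [ln N] is at most its fourth root [z], and a radius of
    order [ln (ln N)] costs another factor [z]. The exponent is then of the order of the square root
    of [ln N], too small to compete with the decay in [N]. *)
Lemma rate_bound {R : realType} (beta c0 r0 : R) : 0 < beta -> 0 <= r0 ->
  \forall N \near \oo, forall r : R, 0 <= r -> r <= r0 + ln (ln (N%:R : R)) ->
    N%:R `^ (- (beta / 2)) * expR (c0 * (1 + r) * ln N%:R `^ (c0 * (4 * (`|c0| + 1))^-1))
      <= 4 / beta * ln (ln N%:R) `^ (- 2^-1).
Proof.
(* Once the square root of [ln N] exceeds [A], the exponent is at most [beta * L / 4], half of the
   exponent of the decay. *)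
move=> beta0 r00; pose A := 4 * `|c0| * (5 + r0) / beta.
near=> N => r r_ge0 rN.
have NR : 0 < N%:R :> R by rewrite ltr0n; near: N; exists 1%N.
have L1 : expR 1 <= ln (N%:R : R) by near: N; exact: near_ln_ge.
have LA : A ^+ 2 <= ln (N%:R : R) by near: N; exact: near_ln_ge.
set L := ln (N%:R : R) in rN L1 LA *.
have L0 : 0 < L by apply: lt_le_trans L1; exact: expR_gt0.
have llN : 1 <= ln L by rewrite -[leLHS]expRK ler_ln ?posrE ?expR_gt0.
have L_ge1 : 1 <= L by apply: le_trans llN _; exact: ln_le_id.
have A_ge0 : 0 <= A by rewrite /A !mulr_ge0 ?invr_ge0 ?addr_ge0// ltW.
pose z := expR (ln L / 4).
have z0 : 0 < z by exact: expR_gt0.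
have z1 : 1 <= z by rewrite /z -expR0 ler_expR divr_ge0// (le_trans ler01).
have zL : L = z ^+ 4.
  by rewrite /z -expRM_natl -[LHS](lnK L0); congr expR; field.
have zA : A <= z ^+ 2.
  rewrite -ler_sqr ?nnegrE ?exprn_ge0 ?(ltW z0)//.
  by rewrite -exprM -zL.
have lnz : ln L <= 4 * z.
  have := expR_ge1Dx (ln L / 4); rewrite -/z; lra.
have pz : L `^ (c0 * (4 * (`|c0| + 1))^-1) <= z.
  rewrite (_ : z = L `^ (4^-1)); last by rewrite /powR gt_eqF// /z mulrC.
  rewrite ler_powR// invfM mulrA ler_pdivrMr ?ltr_wpDl//.
  by rewrite mulrC ler_wpM2l ?invr_ge0// (le_trans (ler_norm _))// lerDl.
have xle : c0 * (1 + r) * L `^ (c0 * (4 * (`|c0| + 1))^-1) <= beta * L / 4.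
  apply: (@le_trans _ _ (`|c0| * (1 + r) * z)).
    apply: le_trans (ler_wpM2l _ pz); last by rewrite mulr_ge0// addr_ge0.
    by rewrite ler_wpM2r ?powR_ge0// ler_wpM2r ?addr_ge0// ler_norm.
  have r1 : 1 + r <= (5 + r0) * z.
    have : r0 <= r0 * z by rewrite ler_peMr.
    by move: rN lnz z1; rewrite mulrDl; lra.
  apply: (@le_trans _ _ (`|c0| * ((5 + r0) * z) * z)).
    by rewrite ler_wpM2r ?(ltW z0)// ler_wpM2l.
  have -> : `|c0| * ((5 + r0) * z) * z = beta / 4 * (A * z ^+ 2).
    by rewrite /A; field; rewrite gt_eqF.
  rewrite [leRHS](_ : _ = beta / 4 * (z ^+ 2 * z ^+ 2)); last by rewrite -exprD -zL; field.
  by rewrite ler_wpM2l ?divr_ge0 ?(ltW beta0)// ler_wpM2r// exprn_ge0// ltW.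
have -> : N%:R `^ (- (beta / 2)) = expR (- (beta / 2) * L).
  by rewrite /powR gt_eqF.
rewrite -expRD.
apply: (@le_trans _ _ (expR (- (beta * L / 4)))).
  by rewrite ler_expR; move: xle; lra.
have bL : 0 < beta * L / 4 by rewrite divr_gt0// mulr_gt0.
rewrite expRN; apply: (@le_trans _ _ (beta * L / 4)^-1).
  rewrite lef_pV2 ?posrE ?expR_gt0//.
  by apply: le_trans (expR_ge1Dx _); rewrite lerDr.
have -> : (beta * L / 4)^-1 = 4 / beta * L^-1 by field; rewrite !gt_eqF.
rewrite ler_wpM2l ?divr_ge0 ?(ltW beta0)//.
have ln0 : 0 < ln L by exact: lt_le_trans llN.
rewrite -ler_sqr ?nnegrE ?powR_ge0 ?invr_ge0 ?(ltW L0)// !expr2 rsqrt_sqr//.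
apply: (@le_trans _ _ L^-1).
  by rewrite ler_piMl ?invr_ge0 ?(ltW L0)// invf_le1.
by rewrite lef_pV2 ?posrE// ln_le_id.
Unshelve. all: by end_near.
Qed.

(** * Tail bound and bound in mean at the double logarithmic rate *)

Section conclusions.
Context {R : realType} {d : nat}.
Local Notation E := 'rV[R]_d.
Variables (V : E -> R) (k : E -> E -> R) (pi : probability E R).
Variables (H : set (E -> R)) (ip : (E -> R) -> (E -> R) -> R).
Context {dO : measure_display} {Om : measurableType dO} (P : probability Om R).
Variables (x0 : forall N, {RV P >-> 'M[R]_(N, d)}) (X : forall N, Om -> R -> 'M[R]_(N, d)).
Variables (mu0 : probability E R) (mu : R -> probability E R) (beta C0 c0 : R).
Hypotheses (hK : kernel_assumption k) (hH : is_rkhs k H ip) (hV : target_assumption V pi)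
  (hinit : initial_assumption pi mu0 x0 beta)
  (hCstar : exists M : R, forall z, Cstar V k z <= M)
  (hX : forall (N : nat) (w : Om), (0 < N)%N -> particle_flow V k (X N w) (x0 N w))
  (hmu : mean_field_flow V k mu mu0).
Hypothesis hC0 : forall (r : R) (N : nat) (t : R), 0 < r -> (3 <= N)%N -> 0 <= t ->
    (\int[P]_(w in moment_event (x0 N) r)
       ereal_sup [set KSD V H ip (empirical (X N w s)) (mu s) | s in `[0%R, t]]
     <= (C0 * N%:R `^ (- (beta / 2))
         * expR (c0 * (1 + r) * expR (c0 * t)))%:E)%E.
Let hk := kernel_Cb4 hK.
Local Notation ball := (product_ball H ip).
Local Notation ksd N T w := (KSD V H ip (time_average (fun t => empirical (X N w t)) T)
  (time_average (fun t => mu t) T)).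
Local Notation rt N := (ln (ln (N%:R : R)) `^ (- 2^-1)).

(** The uniformity in the radius serves two ends: a fixed radius gives the tail bound, and the
    radius [ln (ln N)] the bound in mean. *)
Lemma ksd_event_rate : exists2 K : R, 0 <= K & forall r0 : R, 0 <= r0 ->
  \forall N \near \oo, forall r T, 0 < r -> r <= r0 + ln (ln (N%:R : R)) -> 0 < T ->
    (\int[P]_(w in moment_event (x0 N) r) ksd N T w <= (K * rt N)%:E)%E.
Proof.
have [C C_gt0 hC] := ksd_moment_event_le hK hH hV hinit hCstar hX hmu hC0.
have beta0 := init_rate_gt0 hinit.
pose de := (4 * (`|c0| + 1))^-1.
have de0 : 0 < de by rewrite invr_gt0 mulr_gt0// ltr_wpDl.
exists (C * (4 / beta) + C * de `^ (- 2^-1)) => [|r0 r00].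
  by rewrite addr_ge0// mulr_ge0 ?powR_ge0 ?divr_ge0 ?(ltW beta0)// ltW.
near=> N => r T r_gt0 rN T0.
have h1 : forall r T, 0 < r -> 0 < T ->
    (\int[P]_(w in moment_event (x0 N) r) ksd N T w <=
      (C * N%:R `^ (- (beta / 2)) * expR (c0 * (1 + r) * ln N%:R `^ (c0 * de))
       + C * (de * ln (ln N%:R)) `^ (- 2^-1))%:E)%E by near: N; exact: hC.
have h2 : forall r : R, 0 <= r -> r <= r0 + ln (ln (N%:R : R)) ->
    N%:R `^ (- (beta / 2)) * expR (c0 * (1 + r) * ln N%:R `^ (c0 * de))
      <= 4 / beta * rt N by near: N; exact: rate_bound.
have lnN : expR 1 <= ln (N%:R : R) by near: N; exact: near_ln_ge.
have llN : 1 <= ln (ln (N%:R : R)).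
  by rewrite -[leLHS]expRK ler_ln ?posrE ?expR_gt0// (lt_le_trans _ lnN)// expR_gt0.
apply: (le_trans (h1 r T r_gt0 T0)); rewrite lee_fin mulrDl.
have h3 := h2 r (ltW r_gt0) rN.
rewrite powRM ?(ltW de0) ?(le_trans ler01)//.
rewrite -[_ * _ * expR _]mulrA -[_ * (4 / _) * _]mulrA [C * (_ * _ `^ _)]mulrA; apply: lerD => //.
by apply: ler_wpM2l h3; exact: ltW.
Unshelve. all: by end_near.
Qed.

(** Markov's inequality on [A]; its complement is conceded entirely. *)
Lemma ksd_tail_le (M s : R) N T (A : set Om) (K : R) : (0 < N)%N -> 0 < T -> 0 < M -> 0 < s ->
  measurable A -> (\int[P]_(w in A) ksd N T w <= (K * s)%:E)%E ->
  (P [set w | ((M * s)%:E <= ksd N T w)%E] <= P (~` A) + (K / M)%:E)%E.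
Proof.
move=> N0 T0 M0 s0 mA hA; set S := [set w | _].
have mk := measurable_ksd hK hH hV hX hmu N0 T0.
have mS : measurable S.
  by rewrite -[S]setTI; apply: emeasurable_fun_c_infty.
have SE : S = (S `&` A) `|` (S `&` ~` A) by rewrite -setIUr setUv setIT.
have mSA : measurable (S `&` A) by exact: measurableI.
have mSAc : measurable (S `&` ~` A) by apply: measurableI => //; exact: measurableC.
rewrite SE; apply: (le_trans (measureU2 _ mSA mSAc)); rewrite addeC; apply: leeD.
  by apply: le_measure; rewrite ?inE//; exact: measurableC.
have : ((M * s)%:E * P (S `&` A) <= (K * s)%:E)%E.
  apply: le_trans hA; rewrite -integral_cst//.
  apply: (@le_trans _ _ (\int[P]_(w in S `&` A) ksd N T w)%E).
    by apply: le_lower_integral => w [] //= _ _; rewrite lee_fin mulr_ge0// ltW.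
  apply: ge0_subset_integral => //; first exact: measurable_funTS.
  by move=> w _; exact: (ksd_ge0 hV hk hH hmu N0 (hX w N0) T0).
move=> h; suff h2 : (P (S `&` A) <= (K / M)%:E)%E by exact: h2.
have : P (S `&` A) \is a fin_num by exact: fin_num_measure.
move: h; case: (P _) => [p| |]//; rewrite -EFinM !lee_fin mulrAC ler_pM2r// => h _.
by rewrite ler_pdivlMr// mulrC.
Qed.

(** At a fixed radius the moment event misses a mass of order [N ^ (- beta)], eventually below
    [1/M], and Markov's inequality on the event contributes [K/M]. *)
Lemma ksd_tail_cvg :
  limn_esup (fun N : nat => ereal_sup
    [set P [set w | ((M * rt N)%:E <= ksd N T w)%E] | T in [set T | 0 < T]])
    @[M --> (+oo : set_system R)] --> 0%E.
Proof.
have [r0 [C [r00 C_ge0 hC]]] := moment_complement hinit.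
have [K K0 hKr] := ksd_event_rate.
pose g (M : R) N : \bar R := ereal_sup
  [set P [set w | ((M * rt N)%:E <= ksd N T w)%E] | T in [set T | 0 < T]].
pose f M : \bar R := limn_esup (g M).
have f_ge0 M : (0 <= f M)%E.
  apply: le_ereal_inf_tmp => _ [A [n _ nA] <-].
  apply: le_ereal_sup_tmp; exists (g M n).
    by exists n => //; exact: (nA n (leqnn n)).
  by apply: le_ereal_sup_tmp; exists (P [set w | ((M * rt n)%:E <= ksd n 1 w)%E]) => //; exists 1 => //=.
have f_le M : 0 < M -> (f M <= ((K + 1) / M)%:E)%E.
  move=> M0; have Mi : 0 < M^-1 / (C + 1) by rewrite divr_gt0 ?invr_gt0// ltr_wpDl.
  have near_le : \forall N \near \oo, (g M N <= ((K + 1) / M)%:E)%E.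
    near=> N.
    have N0 : (0 < N)%N by near: N; exists 1%N.
    have NM : N%:R `^ (- beta) <= M^-1 / (C + 1).
      by near: N; apply: near_powR_le => //; exact: init_rate_gt0 hinit.
    have lnN : expR 1 <= ln (N%:R : R) by near: N; exact: near_ln_ge.
    have llN : 1 <= ln (ln (N%:R : R)).
      by rewrite -[leLHS]expRK ler_ln ?posrE ?expR_gt0// (lt_le_trans _ lnN)// expR_gt0.
    have hr : forall r T, 0 < r -> r <= r0 + ln (ln (N%:R : R)) -> 0 < T ->
        (\int[P]_(w in moment_event (x0 N) r) ksd N T w <= (K * rt N)%:E)%E.
      by near: N; apply: hKr; exact: ltW.
    apply: ge_ereal_sup => _ [T /= T0 <-].
    have rt0 : 0 < rt N by apply: rsqrt_gt0; exact: lt_le_trans llN.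
    have hT := hr r0 T r00 _ T0.
    apply: (le_trans (ksd_tail_le N0 T0 M0 rt0 (measurable_moment_event x0 N r0) (hT _))).
      by rewrite lerDl (le_trans ler01).
    rewrite [(K + 1) / M]mulrDl mul1r addrC EFinD; apply: leeD => //; apply: (le_trans (hC N N0)).
    rewrite lee_fin; apply: (@le_trans _ _ ((C + 1) * N%:R `^ (- beta))).
      by rewrite ler_wpM2r ?powR_ge0// lerDl.
    by rewrite mulrC -ler_pdivlMr// ltr_wpDl.
  (* The upper limit is an infimum over eventual sets of indices, and the set where the bound holds
     is one of them. *)
  apply: ge_ereal_inf; exists (ereal_sup (g M @` [set N | (g M N <= ((K + 1) / M)%:E)%E])).
    by exists [set N | (g M N <= ((K + 1) / M)%:E)%E].
  by apply: ge_ereal_sup => _ [N hN <-].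
apply: (@squeeze_cvge _ _ _ _ (cst 0%E) _ (fun M => ((K + 1) / M)%:E)) => //.
- near=> M; rewrite f_ge0 f_le//; near: M; exact: nbhs_pinfty_gt.
- exact: cvg_cst.
- apply/cvg_EFin; first exact: nearW.
  apply/cvgr0Pnorm_lt => e e0; near=> M.
  have M0 : 0 < M by near: M; exact: nbhs_pinfty_gt.
  rewrite /= ger0_norm ?divr_ge0 ?addr_ge0 ?(ltW M0)// ltr_pdivrMr// mulrC -ltr_pdivrMr//.
  by near: M; exact: (nbhs_pinfty_gt (num_real _)).
Unshelve. all: by end_near.
Qed.

(** The entropy bound [c / T] degenerates for short averaging times; there the growth of second
    moments over [[0, 1]] bounds the KSD by the initial moment. *)
Lemma ksd_short_time : exists2 C : R, 0 <= C & forall N w T, (0 < N)%N -> 0 < T -> T <= 1 ->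
  (ksd N T w <= (C * (1 + mean_square (x0 N w)))%:E)%E.
Proof.
have [B B0 hB] := svgd_term_growth hV hk; have [C C_ge0 hC] := stein_growth hV hk hH.
have [B1 hB1] := mean_field_curve_moment hmu 1.
pose K := B * (1 + 2 * d%:R).
have K0 : 0 <= K by rewrite mulr_ge0// addr_ge0// mulr_ge0.
have B1_ge0 : 0 <= B1.
  rewrite -lee_fin; apply: le_trans (hB1 0 _); last by rewrite lexx ler01.
  by apply: integral_ge0 => x _; rewrite lee_fin addr_ge0// sqr_ge0.
have ms0 N (x : 'M[R]_(N, d)) : 0 <= mean_square x.
  by rewrite /mean_square mulr_ge0 ?invr_ge0// sumr_ge0// => c _; exact: sqr_ge0.
exists (C * (expR K + B1)) => [|N w T N0 T0 T1]; first by rewrite mulr_ge0// addr_ge0// expR_ge0.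
apply: (ksd_le hV hk hH hmu N0 (hX w N0) T0) => phi phiB; rewrite lee_fin.
apply: (stein_gap_le hV hk hH hmu (hX w N0) T0 phiB) => t /andP[t0 tT].
have mst := mean_square_growth hV hk N0 (hX w N0) B0 hB t0.
have X0 : X N w 0 = x0 N w by have [->] := hX w N0.
rewrite X0 -/K in mst.
have e1 : (\int[empirical (X N w t)]_x (stein V phi x)%:E <= (C * (expR K * (1 + mean_square (x0 N w))))%:E)%E.
  apply: (@le_trans _ _ (C%:E * (1 + mean_square (X N w t))%:E)%E).
    rewrite -(empirical_moment N0) !integral_empirical; last 2 first.
    - by apply: measurable_funD => //; exact: measurable_enorm2.
    - exact: (measurable_stein hV hk hH).
    rewrite -EFinM lee_fin mulrCA ler_wpM2l ?invr_ge0// mulr_sumr.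
    by apply: ler_sum => l _; apply: le_trans (ler_norm _) _; exact: hC.
  rewrite -EFinM lee_fin ler_wpM2l//; apply: (le_trans mst).
  rewrite ler_wpM2r ?addr_ge0// ler_expR ler_piMr//; exact: le_trans T1.
have t1 : 0 <= t <= 1 by rewrite t0 (le_trans tT).
have e2 := stein_abs_integral_le hB1 t1 phiB C_ge0 (hC phi ^~ phiB).
have e3 : (- (\int[mu t]_x (stein V phi x)%:E) <= (C * B1)%:E)%E.
  move: e2; rewrite /mean_field_curve max_r// => e2.
  apply: le_trans e2; apply: (@le_trans _ _ `|\int[mu t]_x (stein V phi x)%:E|%E).
    by rewrite -abseN lee_abs.
  apply: (le_trans (le_abse_integral _ _ _)) => //.
  by apply/measurable_EFinP; exact: (measurable_stein hV hk hH).
apply: (le_trans (leeD e1 e3)); rewrite -EFinD -mulrDr lee_fin -mulrA ler_wpM2l// mulrDl lerD2l.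
by rewrite ler_peMr// lerDl.
Qed.

(** On the moment event of radius [ln (ln N)] the rate is known. Off it, the exponential moment
    leaves a probability of order [(ln (ln N)) ^ (-2)], small enough for the entropy bound when
    [T > 1]; when [T <= 1], [ksd_short_time] is integrated against the exponential moment. *)
Lemma ksd_mean_rate (lambda : R) : 0 < lambda ->
  (ereal_sup [set \int[P]_w expeR (lambda%:E * second_moment (empirical (x0 N w)) ^+ 2)
    | N in [set N : nat | (0 < N)%N]] < +oo)%E ->
  exists C : R, \forall N \near \oo,
    (ereal_sup [set \int[P]_w ksd N T w | T in [set T | (0 < T)%R]] <= (C * rt N)%:E)%E.
Proof.
move=> la0 supL.
have [L L0 hL] : exists2 L : R, 0 <= L & forall N, (0 < N)%N ->
    (\int[P]_w (expR (lambda * mean_square (x0 N w) ^+ 2))%:E <= L%:E)%E.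
  have hle N : (0 < N)%N -> (\int[P]_w (expR (lambda * mean_square (x0 N w) ^+ 2))%:E <=
      ereal_sup [set \int[P]_w expeR (lambda%:E * second_moment (empirical (x0 N w)) ^+ 2)
        | N in [set N : nat | (0 < N)%N]])%E.
    move=> N0; apply: ereal_sup_ubound; exists N => //.
    by apply: eq_integral => w _; rewrite second_moment_empirical -EFin_expe -EFinM.
  move: supL hle; case: (ereal_sup _) => [L| |]// _ hle.
    exists `|L| => // N N0; apply: (le_trans (hle N N0)); rewrite lee_fin; exact: ler_norm.
  by exists 0 => // N N0; apply: (le_trans (hle N N0)); rewrite leNye.
have [K K0 hKr] := ksd_event_rate.
have [c c_ge0 hc] := ksd_entropy_le hK hH hV hinit hCstar hX hmu hC0.
have [Cg Cg0 hg] := ksd_short_time.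
pose q := L / lambda; have q0 : 0 <= q by rewrite divr_ge0// ltW.
(* [K] serves the moment event; off it, [2 * c + q + c * q] serves [T > 1] and [2 * Cg * q] serves
   [T <= 1]. *)
exists (K + (2 * c + q + c * q + 2 * Cg * q)); near=> N.
have N0 : (0 < N)%N by near: N; exists 1%N.
have lnN : expR 1 <= ln (N%:R : R) by near: N; exact: near_ln_ge.
have llN : 1 <= ln (ln (N%:R : R)).
  by rewrite -[leLHS]expRK ler_ln ?posrE ?expR_gt0// (lt_le_trans _ lnN)// expR_gt0.
have hr : forall r T, 0 < r -> r <= 0 + ln (ln (N%:R : R)) -> 0 < T ->
    (\int[P]_(w in moment_event (x0 N) r) ksd N T w <= (K * rt N)%:E)%E.
  by near: N; exact: hKr.
set r := ln (ln (N%:R : R)) in llN hr *; set s := r `^ (- 2^-1) in hr *.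
have r0 : 0 < r by exact: lt_le_trans llN.
have s0 : 0 < s by exact: rsqrt_gt0.
have ss : s * s = r^-1 by exact: rsqrt_sqr.
have s1 : s <= 1 by have := rsqrt_le ltr01 llN; rewrite powR1.
pose A := moment_event (x0 N) r.
have mA : measurable A by exact: measurable_moment_event.
have mAc : measurable (~` A) by exact: measurableC.
have Ac w : (~` A) w -> r < mean_square (x0 N w).
  by rewrite /A /moment_event /= second_moment_empirical lee_fin => /negP; rewrite -ltNge.
have mexp : measurable_fun setT (fun w => (expR (lambda * mean_square (x0 N w) ^+ 2))%:E).
  apply/measurable_EFinP; apply: measurableT_comp => //; apply: measurable_funM => //.
  by apply: measurable_funX; exact: measurable_moment.
have hA (f : Om -> R) (a : R) : 0 <= a ->
    (forall w, (~` A) w -> 0 <= f w <= a * expR (lambda * mean_square (x0 N w) ^+ 2)) ->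
    (\int[P]_(w in ~` A) (f w)%:E <= (a * L)%:E)%E.
  move=> a0 hf; apply: (@le_trans _ _ (\int[P]_(w in ~` A)
      (a%:E * (expR (lambda * mean_square (x0 N w) ^+ 2))%:E))%E).
    by apply: le_lower_integral => w /hf /andP[h1 h2]; rewrite -?EFinM lee_fin.
  rewrite ge0_integralZl_EFin//; last exact: measurable_funTS.
  rewrite EFinM lee_wpmul2l ?lee_fin//; apply: le_trans (hL N N0).
  by apply: ge0_subset_integral => // w _; rewrite lee_fin expR_ge0.
have expm (m : R) : lambda * m ^+ 2 <= expR (lambda * m ^+ 2).
  by apply: le_trans (expR_ge1Dx _); rewrite lerDr.
(* Four powers of [s]: one cancels the [1/s] of Young's constant below, one is the rate, and the
   others are bounded by 1. *)
have pAc : (P (~` A) <= (q * (s * s * (s * s)))%:E)%E.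
  rewrite -[P _]mul1e -integral_cst//.
  have -> : q * (s * s * (s * s)) = (lambda * r ^+ 2)^-1 * L.
    by rewrite ss /q; field; rewrite !gt_eqF.
  have lr : 0 < lambda * r ^+ 2 by rewrite mulr_gt0// exprn_gt0.
  apply: hA => [|w /Ac rw]; first by rewrite invr_ge0 ltW.
  rewrite ler01/= mulrC ler_pdivlMr// mul1r; apply: le_trans (expm _).
  by rewrite ler_pM2l// ler_sqr ?nnegrE ?(ltW rw)// ltW// (lt_trans r0).
have sss x : 0 <= x <= 1 -> s * x <= s by case/andP=> x0' x1; rewrite ler_piMr// ltW.
apply: ge_ereal_sup => _ [T /= T0 <-].
have mk := measurable_ksd hK hH hV hX hmu N0 T0.
have kp w : (0 <= ksd N T w)%E by exact: (ksd_ge0 hV hk hH hmu N0 (hX w N0) T0).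
rewrite -(setUv A) ge0_integral_setU//; last 2 first.
- by rewrite setUv.
- by apply/disj_setPS; rewrite setICr.
rewrite mulrDl EFinD; apply: leeD; first by apply: hr => //; rewrite add0r.
have p1 : 0 <= s * s <= 1 by rewrite mulr_ge0 ?(ltW s0)//= mulr_ile1 ?(ltW s0).
have p2 : 0 <= s * (s * s) <= 1.
  by case/andP: p1 => *; rewrite mulr_ge0 ?(ltW s0)//= mulr_ile1 ?(ltW s0).
have hs2 := sss _ (introT andP (conj (ltW s0) s1)).
have hs3 := sss _ p1; have hs4 := sss _ p2.
have cq0 : 0 <= c * q by rewrite mulr_ge0.
have gq0 : 0 <= 2 * Cg * q by rewrite mulr_ge0// mulr_ge0.
have cc0 : 0 <= 2 * c by rewrite mulr_ge0.
have [T1|T1] := leP T 1.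
  apply: (@le_trans _ _ (\int[P]_(w in ~` A) (Cg * (1 + mean_square (x0 N w)))%:E)%E).
    by apply: le_lower_integral => w _ //; exact: hg.
  apply: (@le_trans _ _ (Cg * (2 / (lambda * r)) * L)%:E).
    apply: hA => [|w /Ac rw]; first by rewrite mulr_ge0// divr_ge0// mulr_ge0// ltW.
    have m0 := lt_trans r0 rw; rewrite mulr_ge0 ?addr_ge0 ?(ltW m0)//= -mulrA ler_wpM2l//.
    move: rw m0 (expm (mean_square (x0 N w))); move: (mean_square _) => m rw m0 em.
    apply: (@le_trans _ _ (2 / (lambda * r) * (lambda * m ^+ 2))).
      rewrite (_ : _ * (lambda * _) = 2 * m * m / r); last by field; rewrite !gt_eqF.
      rewrite ler_pdivlMr//; have : m * r <= m * m by rewrite ler_pM2l// ltW.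
      have : r <= m * r by rewrite ler_peMl ?(ltW r0)// (le_trans llN)// ltW.
      by rewrite mulrDl mul1r -mulrA; lra.
    by rewrite ler_wpM2l// divr_ge0// mulr_ge0// ltW.
  rewrite lee_fin (_ : Cg * _ * L = 2 * Cg * q * (s * s)); last first.
    by rewrite ss /q; field; rewrite !gt_eqF.
  apply: (@le_trans _ _ (2 * Cg * q * s)); first by rewrite ler_wpM2l.
  by rewrite ler_wpM2r ?(ltW s0)// lerDr !addr_ge0.
(* Young's parameter is now [s]: since [T] may be close to 1, [e * c / T] must be of order [s] by
   itself, and the resulting [1/s] is paid for by the small probability of the complement. *)
apply: (le_trans (hc N T _ _ s N0 T0 s0 mAc pAc)); rewrite lee_fin.
have TT : c / T <= c by rewrite ler_piMr// invf_le1// ltW.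
have NN : c / N%:R <= c by rewrite ler_piMr// invf_le1 ?ltr0n// ler1n.
have sT : T `^ (- 2^-1) <= 1 by have := rsqrt_le ltr01 (ltW T1); rewrite powR1.
have h1 : s * (c / T + c / N%:R) <= s * (2 * c).
  by rewrite ler_pM2l//; lra.
have h2 : (s^-1 + c * T `^ (- 2^-1)) * (q * (s * s * (s * s))) <= q * s + c * q * s.
  rewrite mulrDl; apply: lerD.
    rewrite (_ : s^-1 * _ = q * (s * (s * s))); last by field; rewrite gt_eqF.
    by rewrite ler_wpM2l.
  apply: (@le_trans _ _ (c * (q * (s * (s * (s * s)))))).
    rewrite -[s * s * _]mulrA; apply: ler_wpM2r; last by rewrite ler_piMr.
    by rewrite mulr_ge0// mulr_ge0 ?(ltW s0)//; case/andP: p2.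
  by rewrite mulrA ler_wpM2l.
apply: (le_trans (lerD h1 h2)); rewrite !mulrDl.
have : 0 <= 2 * Cg * q * s by rewrite mulr_ge0// ltW.
by rewrite [s * _]mulrC; lra.
Unshelve. all: by end_near.
Qed.

End conclusions.

Theorem theorem2p5 (R : realType) (d : nat)
  (V : 'rV[R]_d -> R) (k : 'rV[R]_d -> 'rV[R]_d -> R)
  (pi : probability 'rV[R]_d R)
  (H : set ('rV[R]_d -> R))
  (ip : ('rV[R]_d -> R) -> ('rV[R]_d -> R) -> R)
  (dO : measure_display) (Om : measurableType dO) (P : probability Om R)
  (x0 : forall N, {RV P >-> 'M[R]_(N, d)})
  (X : forall N, Om -> R -> 'M[R]_(N, d))
  (mu0 : probability 'rV[R]_d R) (mu : R -> probability 'rV[R]_d R)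
  (beta C0 c0 : R)
  (hk : kernel_assumption k)
  (hH : is_rkhs k H ip)
  (hV : target_assumption V pi)
  (hinit : initial_assumption pi mu0 x0 beta)
  (hCstar : exists M : R, forall z, Cstar V k z <= M)
  (hX : forall (N : nat) (w : Om), (0 < N)%N ->
    particle_flow V k (X N w) (x0 N w))
  (hmu : mean_field_flow V k mu mu0)
  (hC0 : forall (r : R) (N : nat) (t : R), 0 < r -> (3 <= N)%N -> 0 <= t ->
    (\int[P]_(w in moment_event (x0 N) r)
       ereal_sup [set KSD V H ip (empirical (X N w s)) (mu s) | s in `[0%R, t]]
     <= (C0 * N%:R `^ (- (beta / 2))
         * expR (c0 * (1 + r) * expR (c0 * t)))%:E)%E) :
  let ksd (N : nat) (T : R) (w : Om) : \bar R :=
    KSD V H ip (time_average (fun t => empirical (X N w t)) T)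
               (time_average mu T) in
  [/\ exists2 C : R, 0 < C & forall delta r : R, 0 < delta -> 0 < r ->
        \forall N \near \oo,
          (ereal_sup
             [set \int[P]_(w in moment_event (x0 N) r) ksd N T w
             | T in [set T | (0 < T)%R]]
           <= (C * N%:R `^ (- (beta / 2))
                 * expR (c0 * (1 + r) * ln N%:R `^ (c0 * delta))
               + C * (delta * ln (ln N%:R)) `^ (- 2^-1))%:E)%E,
      limn_esup (fun N : nat =>
          ereal_sup
            [set P [set w |
                ((M * ln (ln N%:R) `^ (- 2^-1))%:E <= ksd N T w)%E]
            | T in [set T | 0 < T]]) @[M --> (+oo : set_system R)] --> 0%E &
      (exists2 lambda : R, 0 < lambda &
        (ereal_sup
           [set \int[P]_w
              expeR (lambda%:E * second_moment (empirical (x0 N w)) ^+ 2)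
           | N in [set N : nat | (0 < N)%N]] < +oo)%E) ->
      exists C : R, \forall N \near \oo,
        (ereal_sup [set \int[P]_w ksd N T w | T in [set T | (0 < T)%R]]
         <= (C * ln (ln N%:R) `^ (- 2^-1))%:E)%E].
Proof.
move=> ksd; split.
- have [C C0' hC] := ksd_moment_event_le hk hH hV hinit hCstar hX hmu hC0.
  exists C => // delta r delta0 r0; near=> N.
  apply: ge_ereal_sup => _ [T /= T0 <-].
  by move: r T r0 T0; near: N; exact: hC.
- exact: (ksd_tail_cvg hk hH hV hinit hCstar hX hmu hC0).
- case=> lambda lambda0 hl.
  exact: (ksd_mean_rate hk hH hV hinit hCstar hX hmu hC0 lambda0 hl).
Unshelve. all: by end_near.
Qed.
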